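(* Assume the data follow a standard linear model with true parameter $\beta^*\in\mathbb R^p$, that is, $y_n=X_n\beta^*+e_n$, where the error vector $e_n\in\mathbb R^n$ has i.i.d. components with mean zero and variance $\sigma_o^2$, and $X_n$ can be either random or deterministic. Assume the conditions (C) of the context, including (1-dim') for $\alpha\in\{0,1\}$, and the Lindeberg–Feller condition of the context. If in addition $m/(n\tau_{m,n})\to0$, then $$m^{1/2}\tau_{m,n}^{-1/2}\|\tilde\varepsilon_{m,n}\|^{-1}(\tilde X_{m,n}^\top\tilde X_{m,n})^{1/2}(\hat\beta^{\mathrm s}_{m,n}-\beta^* )\Rightarrow\mathcal N(0,I_p).$$ If instead $m/(\tau_{m,n}\|X_n\beta^*\|^2)\to0$ in probability, then $$m^{1/2}\tau_{m,n}^{-1/2}\Big(\|\tilde X_{m,n}\hat\beta^{\mathrm{pa}}_{m,n}\|^2(\tilde X_{m,n}^\top\tilde X_{m,n})^{-1}+(\alpha+1)\hat\beta^{\mathrm{pa}}_{m,n}\hat\beta^{\mathrm{pa}\top}_{m,n}\Big)^{-1/2}(\hat\beta^{\mathrm{pa}}_{m,n}-\beta^* )\Rightarrow\mathcal N(0,I_p).$$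
   Context: Asymptotic regime: $p$ fixed, $n\to\infty$, $m=m_n\to\infty$, $m<n$; $\Rightarrow$ is (unconditional) convergence in distribution. $X_n$ is $n\times p$ with SVD $X_n=U_nL_nV_n^\top$, where $U_n$ is $n\times p$ with orthonormal columns, $L_n=\mathrm{diag}(\ell_{n,1},\dots,\ell_{n,p})$, $\ell_{n,1}\ge\dots\ge\ell_{n,p}>0$, and $V_n$ is $p\times p$ orthogonal. Put $\beta_n=(X_n^\top X_n)^{-1}X_n^\top y_n$, residual $\varepsilon_n=y_n-X_n\beta_n$, $\bar\varepsilon_n=\varepsilon_n/\|\varepsilon_n\|$ (assumed well defined when used). $S_{m,n}$ is a random $m\times n$ sketching matrix, drawn independently of the data; $\tilde X_{m,n}=S_{m,n}X_n$, $\tilde y_{m,n}=S_{m,n}y_n$, $\hat\beta^{\mathrm s}_{m,n}=(\tilde X_{m,n}^\top\tilde X_{m,n})^{-1}\tilde X_{m,n}^\top\tilde y_{m,n}$, $\hat\beta^{\mathrm{pa}}_{m,n}=(\tilde X_{m,n}^\top\tilde X_{m,n})^{-1}X_n^\top y_n$, $\tilde\varepsilon_{m,n}=\tilde y_{m,n}-\tilde X_{m,n}\hat\beta^{\mathrm s}_{m,n}$. Conditions (C) (imposed on the data sequence regarded as fixed, i.e. conditionally on $(X_n,y_n)_{n\ge1}$): $\limsup_n\ell_{n,1}/\ell_{n,p}<\infty$; $\tau_{m,n}>0$ and $\tau_{m,n}/m\to0$; and, for conditions $\mathfrak p,\mathfrak P$ on sequences $(a_n,\tilde a_n)_{n\ge1}$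 of pairs of unit vectors of $\mathbb R^n$: (Bounded) if $(a_n,\tilde a_n)_{n\ge1}$ satisfies $\mathfrak p$, then $\sqrt m\,\tau_{m,n}^{-1/2}(a_n^\top S_{m,n}^\top S_{m,n}\tilde a_n-a_n^\top\tilde a_n)=O_P(1)$; (1-dim') if $(a_n,\tilde a_n)_{n\ge1}$ satisfies $\mathfrak P$, then $\sqrt m\,\tau_{m,n}^{-1/2}\big(1+(\alpha+1)(a_n^\top\tilde a_n)^2\big)^{-1/2}(a_n^\top S_{m,n}^\top S_{m,n}\tilde a_n-a_n^\top\tilde a_n)\Rightarrow\mathcal N(0,1)$; and, for any sequence $(b_n)_{n\ge1}$ of unit vectors of $\mathbb R^p$, $(U_nb_n,U_nb_n)_{n\ge1}$ and $(U_nb_n,\bar\varepsilon_n)_{n\ge1}$ satisfy $\mathfrak P$. Lindeberg–Feller condition (as in Example 2.28 of van der Vaart, Asymptotic Statistics): with $a_{n,i}\in\mathbb R^p$, $i\in[n]$, the columns of $(X_n^\top X_n)^{-1/2}X_n^\top$, for every $\eta>0$, $\sum_{i=1}^n\|a_{n,i}\|^2\,\mathbb E\big[e_{n,i}^2\mathbf 1\{\|a_{n,i}\||e_{n,i}|>\eta\}\big]\to0$, where the expectation is over the errors, with $X_n$ treated as fixed.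
   Formalization: Two assumptions are added to (C), without which it fails: for the first limit, (ε̄_n, ε̄_n) satisfies 𝔭; for the second, (U_n b_n, U_n b'_n) satisfies 𝔓 for all unit sequences b_n, b'_n, not only b_n = b'_n. *)

(* Defs.v *)
From HB Require Import structures.
From mathcomp Require Import all_boot all_order all_algebra.
From mathcomp Require Import all_classical all_reals all_analysis.

Set Implicit Arguments.
Unset Strict Implicit.
Unset Printing Implicit Defensive.

Import Order.TTheory GRing.Theory Num.Theory.
Import numFieldNormedType.Exports.

Local Open Scope classical_set_scope.
Local Open Scope ring_scope.

(* The notation `|v| for matrices is the sup norm, hence this definition of the
   Euclidean norm. *)
Definition enorm (R : realType) (n : nat) (v : 'cV[R]_n) : R :=
  Num.sqrt (\sum_(i < n) v i 0 ^+ 2).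

Definition edot (R : realType) (n : nat) (u v : 'cV[R]_n) : R :=
  (u^T *m v) 0 0.

Definition is_psd (R : realType) (n : nat) (A : 'M[R]_n) : Prop :=
  A^T = A /\ forall v : 'cV[R]_n, 0 <= edot v (A *m v).

(* The principal square root: for A positive semidefinite, the unique positive
   semidefinite B with B B = A. The value is 0 when there is no such B. *)
Definition sqrtmx (R : realType) (n : nat) (A : 'M[R]_n) : 'M[R]_n :=
  xget 0 [set B : 'M[R]_n | is_psd B /\ B *m B = A].

Definition invsqrtmx (R : realType) (n : nat) (A : 'M[R]_n) : 'M[R]_n :=
  invmx (sqrtmx A).

(* X = U diag(l) V^T with l_1 >= ... >= l_k > 0, where k = q.+1; in particular
   X has full column rank, which forces k <= n. *)
Definition is_svd (R : realType) (n q : nat) (X : 'M[R]_(n, q.+1))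
    (U : 'M[R]_(n, q.+1)) (l : 'rV[R]_q.+1) (V : 'M[R]_q.+1) : Prop :=
  [/\ X = U *m diag_mx l *m V^T,
      U^T *m U = 1%:M,
      V^T *m V = 1%:M,
      (forall i j : 'I_q.+1, (i <= j)%N -> l 0 j <= l 0 i) &
      0 < l 0 ord_max].

Section Estimators.

Definition ols (R : realType) (n k : nat) (X : 'M[R]_(n, k)) (y : 'cV[R]_n) :
    'cV[R]_k :=
  invmx (X^T *m X) *m (X^T *m y).

Definition residual (R : realType) (n k : nat) (X : 'M[R]_(n, k))
    (y : 'cV[R]_n) : 'cV[R]_n :=
  y - X *m ols X y.

Definition normalized_residual (R : realType) (n k : nat) (X : 'M[R]_(n, k))
    (y : 'cV[R]_n) : 'cV[R]_n :=
  (enorm (residual X y))^-1 *: residual X y.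

Definition sketch_gram (R : realType) (m n k : nat) (S : 'M[R]_(m, n))
    (X : 'M[R]_(n, k)) : 'M[R]_k :=
  (S *m X)^T *m (S *m X).

Definition beta_s (R : realType) (m n k : nat) (S : 'M[R]_(m, n))
    (X : 'M[R]_(n, k)) (y : 'cV[R]_n) : 'cV[R]_k :=
  ols (S *m X) (S *m y).

Definition beta_pa (R : realType) (m n k : nat) (S : 'M[R]_(m, n))
    (X : 'M[R]_(n, k)) (y : 'cV[R]_n) : 'cV[R]_k :=
  invmx (sketch_gram S X) *m (X^T *m y).

Definition sketch_residual (R : realType) (m n k : nat) (S : 'M[R]_(m, n))
    (X : 'M[R]_(n, k)) (y : 'cV[R]_n) : 'cV[R]_m :=
  residual (S *m X) (S *m y).

End Estimators.

Section RandomMatrices.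

Definition random_mx (d : measure_display) (T : measurableType d)
    (R : realType) (m n : nat) (A : T -> 'M[R]_(m, n)) : Prop :=
  forall i j, measurable_fun [set: T] (fun t => A t i j).

(* The Borel sigma-algebra of the space of m x n matrices, generated by the
   coordinate maps. *)
Definition mx_borel (R : realType) (m n : nat) : set (set 'M[R]_(m, n)) :=
  <<s [set C | exists i j (B : set R),
         measurable B /\ C = [set A : 'M[R]_(m, n) | B (A i j)]] >>.

Definition indep_mx (d : measure_display) (T : measurableType d)
    (R : realType) (P : probability T R) (m n k l : nat)
    (A : T -> 'M[R]_(m, n)) (B : T -> 'M[R]_(k, l)) : Prop :=
  forall C D, mx_borel C -> mx_borel D ->
    P ((A @^-1` C) `&` (B @^-1` D)) = (P (A @^-1` C) * P (B @^-1` D))%E.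

(* Taking some of the B i equal to the whole line gives the product rule for
   every subfamily. *)
Definition iid_entries (d : measure_display) (T : measurableType d)
    (R : realType) (P : probability T R) (n : nat) (e : T -> 'cV[R]_n) : Prop :=
  (forall B : 'I_n -> set R, (forall i, measurable (B i)) ->
     P [set t | forall i, B i (e t i 0)]
       = (\prod_(i < n) P [set t | B i (e t i 0%R)])%E) /\
  (forall (i j : 'I_n) (B : set R), measurable B ->
     P [set t | B (e t i 0)] = P [set t | B (e t j 0)]).

End RandomMatrices.

Section Modes.

(* Convergence in distribution to N(0, I_k), through joint distribution
   functions. That of N(0, I_k) is the product of k standard normal ones; it is
   continuous, so the convergence is required at every x. *)
Definition cvg_std_normal (d : measure_display) (T : measurableType d)
    (R : realType) (P : probability T R) (k : nat)
    (Z : nat -> T -> 'cV[R]_k) : Prop :=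
  forall x : 'cV[R]_k,
    P [set t | forall i, Z n t i 0 <= x i 0] @[n --> \oo] -->
      (\prod_(i < k) normal_prob 0%R 1%R `]-oo, x i 0%R]%classic)%E.

Definition bigO_P1 (d : measure_display) (T : measurableType d)
    (R : realType) (P : probability T R) (Y : nat -> T -> R) : Prop :=
  forall eps : R, 0 < eps -> exists M : R,
    \forall n \near \oo, (P [set t | (M < `|Y n t|)%R] < eps%:E)%E.

(* The values are extended reals, so that a ratio with denominator 0 is +oo
   and does not count as small. *)
Definition cvg_in_prob0 (d : measure_display) (T : measurableType d)
    (R : realType) (P : probability T R) (Y : nat -> T -> \bar R) : Prop :=
  forall eps : R, 0 < eps ->
    P [set t | (eps%:E < `|Y n t|)%E] @[n --> \oo] --> 0%E.

End Modes.

Section ConditionsC.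

Definition vseq (R : realType) : Type := forall n : nat, 'cV[R]_n.

(* Eventually only: R^0 has no unit vector, and U_n and the normalized residual
   are defined only for n large. *)
Definition unit_vseq (R : realType) (a : vseq R) : Prop :=
  \forall n \near \oo, enorm (a n) = 1.

Definition bilin_error (R : realType) (m n : nat) (S : 'M[R]_(m, n))
    (a b : 'cV[R]_n) : R :=
  edot (S *m a) (S *m b) - edot a b.

(* In the next two definitions the sequences a, a' are deterministic: as S is
   independent of the data, conditioning on the data leaves its law unchanged. *)
Definition cond_bounded (d : measure_display) (T : measurableType d)
    (R : realType) (P : probability T R) (m : nat -> nat)
    (S : forall n, T -> 'M[R]_(m n, n)) (tau : nat -> R)
    (frakp : vseq R -> vseq R -> Prop) : Prop :=
  forall a a' : vseq R, unit_vseq a -> unit_vseq a' -> frakp a a' ->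
    bigO_P1 P (fun n t =>
      Num.sqrt (m n)%:R / Num.sqrt (tau n) * bilin_error (S n t) (a n) (a' n)).

Definition cond_1dim (d : measure_display) (T : measurableType d)
    (R : realType) (P : probability T R) (m : nat -> nat)
    (S : forall n, T -> 'M[R]_(m n, n)) (tau : nat -> R) (alpha : R)
    (frakP : vseq R -> vseq R -> Prop) : Prop :=
  forall a a' : vseq R, unit_vseq a -> unit_vseq a' -> frakP a a' ->
    cvg_std_normal P (fun n t => const_mx
      (Num.sqrt (m n)%:R / Num.sqrt (tau n)
       / Num.sqrt (1 + (alpha + 1) * edot (a n) (a' n) ^+ 2)
       * bilin_error (S n t) (a n) (a' n)) : 'cV[R]_1).

(* Requirements on one realization of the data sequence. *)
Definition cond_data (R : realType) (q : nat)
    (frakP : vseq R -> vseq R -> Prop)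
    (X : forall n, 'M[R]_(n, q.+1)) (y : vseq R)
    (U : forall n, 'M[R]_(n, q.+1)) (l : nat -> 'rV[R]_q.+1)
    (V : nat -> 'M[R]_q.+1) : Prop :=
  [/\ \forall n \near \oo, is_svd (X n) (U n) (l n) (V n),
      (limn_esup (fun n => (l n 0 ord0 / l n 0 ord_max)%R%:E) < +oo)%E,
      \forall n \near \oo, residual (X n) (y n) != 0 &
      forall b : nat -> 'cV[R]_q.+1, (forall n, enorm (b n) = 1) ->
        frakP (fun n => U n *m b n) (fun n => U n *m b n) /\
        frakP (fun n => U n *m b n)
              (fun n => normalized_residual (X n) (y n))].

Definition conditionsC (d : measure_display) (T : measurableType d)
    (R : realType) (P : probability T R) (q : nat) (m : nat -> nat)
    (S : forall n, T -> 'M[R]_(m n, n)) (tau : nat -> R) (alpha : R)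
    (frakp frakP : vseq R -> vseq R -> Prop)
    (X : forall n, T -> 'M[R]_(n, q.+1)) (y : forall n, T -> 'cV[R]_n)
    (U : forall n, T -> 'M[R]_(n, q.+1)) (l : nat -> T -> 'rV[R]_q.+1)
    (V : nat -> T -> 'M[R]_q.+1) : Prop :=
  [/\ \forall n \near \oo, 0 < tau n,
      tau n / (m n)%:R @[n --> \oo] --> (0 : R),
      cond_bounded P S tau frakp,
      cond_1dim P S tau alpha frakP &
      {ae P, forall t, cond_data frakP (fun n => X n t) (fun n => y n t)
                         (fun n => U n t) (fun n => l n t) (fun n => V n t)}].

End ConditionsC.

(* The expectation is over the errors e n only; the design X n is fixed. *)
Definition lindeberg_feller (d : measure_display) (T : measurableType d)
    (R : realType) (P : probability T R) (k : nat)
    (e : forall n, T -> 'cV[R]_n) (X : forall n, 'M[R]_(n, k)) : Prop :=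
  let a n (i : 'I_n) := col i (invsqrtmx ((X n)^T *m X n) *m (X n)^T) in
  forall eta : R, 0 < eta ->
    (\sum_(i < n) (enorm (a n i) ^+ 2)%:E *
       'E_P[fun w => (e n w i 0 ^+ 2 *
                      (eta < enorm (a n i) * `|e n w i 0|)%R%:R)%R])%E
      @[n --> \oo] --> 0%E.

(* Main.v *)
Require Import Defs.
From HB Require Import structures.
From mathcomp Require Import all_boot all_order all_algebra.
From mathcomp Require Import all_classical all_reals all_analysis.
From mathcomp Require Import measurable_realfun.
From mathcomp Require Import ring lra.

Set Implicit Arguments.
Unset Strict Implicit.
Unset Printing Implicit Defensive.

Import Order.TTheory GRing.Theory Num.Theory.
Import numFieldNormedType.Exports.

Local Open Scope classical_set_scope.
Local Open Scope ring_scope.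

(** The estimators are compared with the full-data least squares estimator ols.
    For each of them the studentized error splits into a part centered at ols,
    which carries the randomness of the sketch, and a bias coming from
    ols - bstar, which the two rate conditions make negligible.

    The sketch S is independent of the data, hence the centered part may be
    studied for one fixed realization of the data sequence (freezing_std_normal)
    and the bias bounded likewise (freezing_whp). Write X = Q R0 with orthonormal
    columns in Q and R0 = (X^T X)^(1/2), and F = (S Q)^T S Q - 1. The
    one-dimensional limit theorem along the vectors U b shows that every
    quadratic form of F is o_P(1), hence so is its norm (gram_op1).
    Deterministic estimates, which rest on the Lipschitz continuity of the
    matrix square root (sqrt_lipschitz), identify the centered part, up to a
    relative error of order |F|, with a vector that is linear in S^T S:
    Q^T S^T S eps / |eps| in the first case (part1_estimate) and
    - W0^(-1/2) R0^-1 F Q^T y in the second one (part2_estimate), in units of the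
    rate. The projections of this vector on fixed directions are normalized
    bilinear errors of the sketch (pa_dir_norm in the second case), so they
    converge to N(0, 1), and beta_s_normal and beta_pa_normal follow from the
    Cramer-Wold theorem (cramer_wold) and Slutsky's lemma (slutsky).

    The Cramer-Wold theorem is proved for a normal limit and for distribution
    functions: expectations of cosines of linear forms converge (cvg_cos,
    gaussian_cos), hence those of products of trigonometric polynomials in the
    coordinates, and these approximate indicators of orthants
    (trig_indicator).

    The squared bias is at most a constant times the squared rate m / tau, times
    |X (ols - bstar)|^2, divided by |eps|^2, respectively by |X ols|^2. The
    vector X (ols - bstar) is the projection of the noise on the q + 1
    dimensional column space of X, hence O_P(1) (fitted_noise_Op1). In the first
    case |eps|^2 is at least of order n, by a law of large numbers whose uniform
    integrability comes from the Lindeberg-Feller condition (lindeberg_tail,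
    error_norm_whp). In the second case |X ols| is of the order of |X bstar|
    (noise_ratio_pa_op1). *)

(** * Frobenius inner product and positive semidefinite matrices *)

Section Frobenius.
Context {R : realType}.

Definition fdot m n (A B : 'M[R]_(m, n)) : R := \tr (A^T *m B).
Definition fnorm m n (A : 'M[R]_(m, n)) : R := Num.sqrt (fdot A A).

Lemma fdotE m n (A B : 'M[R]_(m, n)) :
  fdot A B = \sum_i \sum_j A i j * B i j.
Proof.
rewrite /fdot /mxtrace exchange_big /=; apply: eq_bigr => j _.
by rewrite mxE; apply: eq_bigr => i _; rewrite mxE.
Qed.

Lemma fdotC m n (A B : 'M[R]_(m, n)) : fdot A B = fdot B A.
Proof. by rewrite /fdot -mxtrace_tr trmx_mul trmxK. Qed.

Lemma fdotDl m n (A B C : 'M[R]_(m, n)) : fdot (A + B) C = fdot A C + fdot B C.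
Proof. by rewrite /fdot linearD /= mulmxDl linearD. Qed.

Lemma fdotZl m n c (A C : 'M[R]_(m, n)) : fdot (c *: A) C = c * fdot A C.
Proof. by rewrite /fdot linearZ /= -scalemxAl linearZ. Qed.

Lemma fdotDr m n (A B C : 'M[R]_(m, n)) : fdot A (B + C) = fdot A B + fdot A C.
Proof. by rewrite fdotC fdotDl !(fdotC _ A). Qed.

Lemma fdotZr m n c (A C : 'M[R]_(m, n)) : fdot A (c *: C) = c * fdot A C.
Proof. by rewrite fdotC fdotZl fdotC. Qed.

Lemma fdotNl m n (A C : 'M[R]_(m, n)) : fdot (- A) C = - fdot A C.
Proof. by rewrite -scaleN1r fdotZl mulN1r. Qed.

Lemma fdotNr m n (A C : 'M[R]_(m, n)) : fdot A (- C) = - fdot A C.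
Proof. by rewrite fdotC fdotNl fdotC. Qed.

Lemma fdot_ge0 m n (A : 'M[R]_(m, n)) : 0 <= fdot A A.
Proof.
by rewrite fdotE sumr_ge0// => i _; rewrite sumr_ge0// => j _; rewrite -expr2 sqr_ge0.
Qed.

Lemma fdot_eq0 m n (A : 'M[R]_(m, n)) : fdot A A = 0 -> A = 0.
Proof.
rewrite fdotE => /eqP; rewrite psumr_eq0; last first.
  by move=> i _; rewrite sumr_ge0// => j _; rewrite -expr2 sqr_ge0.
move=> /allP A0; apply/matrixP => i j; rewrite mxE.
have /= := A0 i (mem_index_enum _); rewrite psumr_eq0; last first.
  by move=> ? _; rewrite -expr2 sqr_ge0.
move=> /allP /(_ j (mem_index_enum _)) /=.
by rewrite -expr2 sqrf_eq0 => /eqP.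
Qed.

Lemma fdot_CS2 m n (A B : 'M[R]_(m, n)) :
  fdot A B ^+ 2 <= fdot A A * fdot B B.
Proof.
have [B0|B0] := eqVneq (fdot B B) 0.
  by rewrite (fdot_eq0 B0) /fdot !mulmx0 mxtrace0 expr0n /= mulr0.
have Bp : 0 < fdot B B by rewrite lt_def B0 fdot_ge0.
have := fdot_ge0 (fdot B B *: A - fdot A B *: B).
rewrite -scaleNr fdotDl !fdotDr !fdotZl !fdotZr (fdotC B A) => h.
rewrite -(ler_pM2l Bp) -subr_ge0; apply: le_trans h _.
by rewrite le_eqVlt; apply/orP; left; apply/eqP; ring.
Qed.

Lemma sum_CS2 n (a b : 'I_n -> R) :
  (\sum_k a k * b k) ^+ 2 <= (\sum_k a k ^+ 2) * (\sum_k b k ^+ 2).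
Proof.
have := fdot_CS2 (\col_k a k) (\col_k b k); rewrite !fdotE.
have E (u v : 'I_n -> R) :
    \sum_i \sum_(j < 1) (\col_k u k) i j * (\col_k v k) i j = \sum_i u i * v i.
  by apply: eq_bigr => i _; rewrite big_ord1 !mxE.
by rewrite !E.
Qed.

Lemma fnorm_ge0 m n (A : 'M[R]_(m, n)) : 0 <= fnorm A.
Proof. exact: sqrtr_ge0. Qed.

Lemma fnorm2 m n (A : 'M[R]_(m, n)) : fnorm A ^+ 2 = fdot A A.
Proof. by rewrite sqr_sqrtr// fdot_ge0. Qed.

Lemma fnorm0 m n : fnorm (0 : 'M[R]_(m, n)) = 0.
Proof. by rewrite /fnorm /fdot mulmx0 mxtrace0 sqrtr0. Qed.

Lemma fnorm_eq0 m n (A : 'M[R]_(m, n)) : fnorm A = 0 -> A = 0.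
Proof. by move=> A0; apply: fdot_eq0; rewrite -fnorm2 A0 expr0n. Qed.

Lemma fdot_CS m n (A B : 'M[R]_(m, n)) : `|fdot A B| <= fnorm A * fnorm B.
Proof.
rewrite -(@ler_pXn2r _ 2)// ?nnegrE ?mulr_ge0 ?fnorm_ge0//.
by rewrite exprMn !fnorm2 real_normK ?num_real// fdot_CS2.
Qed.

Lemma fnormD m n (A B : 'M[R]_(m, n)) : fnorm (A + B) <= fnorm A + fnorm B.
Proof.
rewrite -(@ler_pXn2r _ 2)// ?nnegrE ?addr_ge0 ?fnorm_ge0//.
rewrite fnorm2 fdotDl !fdotDr (fdotC B A) sqrrD !fnorm2.
have := ler_norm (fdot A B); have := fdot_CS A B; lra.
Qed.

Lemma fnormZ m n c (A : 'M[R]_(m, n)) : fnorm (c *: A) = `|c| * fnorm A.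
Proof.
by rewrite /fnorm fdotZl fdotZr mulrA -expr2 sqrtrM ?sqr_ge0// sqrtr_sqr.
Qed.

Lemma fnormN m n (A : 'M[R]_(m, n)) : fnorm (- A) = fnorm A.
Proof. by rewrite -scaleN1r fnormZ normrN1 mul1r. Qed.

Lemma fnormB m n (A B : 'M[R]_(m, n)) : fnorm (A - B) <= fnorm A + fnorm B.
Proof. by rewrite -(fnormN B) fnormD. Qed.

Lemma fnormT m n (A : 'M[R]_(m, n)) : fnorm A^T = fnorm A.
Proof.
by rewrite /fnorm !fdotE exchange_big; congr Num.sqrt; apply: eq_bigr => i _;
  apply: eq_bigr => j _; rewrite mxE.
Qed.

Lemma fnormM m n k (A : 'M[R]_(m, n)) (B : 'M[R]_(n, k)) :
  fnorm (A *m B) <= fnorm A * fnorm B.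
Proof.
rewrite -(@ler_pXn2r _ 2)// ?nnegrE ?mulr_ge0 ?fnorm_ge0//.
rewrite exprMn !fnorm2 fdotE (fdotE A) (fdotE B) mulr_suml ler_sum// => i _.
rewrite [X in _ <= _ * X]exchange_big mulr_sumr ler_sum//= => j _.
rewrite -expr2 mxE; apply: le_trans (sum_CS2 _ _) _.
by under [in leRHS]eq_bigr do rewrite -expr2;
   under [X in _ <= _ * X]eq_bigr do rewrite -expr2.
Qed.

Lemma fnorm_entry m n (A : 'M[R]_(m, n)) i j : `|A i j| <= fnorm A.
Proof.
rewrite -(@ler_pXn2r _ 2)// ?nnegrE ?fnorm_ge0// real_normK ?num_real// fnorm2.
rewrite fdotE (bigD1 i)//= (bigD1 j)//= -expr2 -addrA ler_wpDr// addr_ge0//.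
  by rewrite sumr_ge0// => ? _; rewrite -expr2 sqr_ge0.
by rewrite sumr_ge0// => ? _; rewrite sumr_ge0// => ? _; rewrite -expr2 sqr_ge0.
Qed.

Lemma fnorm_le_sum m n (A : 'M[R]_(m, n)) :
  fnorm A <= \sum_i \sum_j `|A i j|.
Proof.
rewrite {1}[A]matrix_sum_delta.
have fsum (I : finType) (F : I -> 'M[R]_(m, n)) :
    fnorm (\sum_i F i) <= \sum_i fnorm (F i).
  elim/big_ind2 : _ => //; first by rewrite fnorm0.
  by move=> x y x' y' h h'; apply: le_trans (fnormD _ _) (lerD h h').
apply: le_trans (fsum _ _) _; apply: ler_sum => i _.
apply: le_trans (fsum _ _) _; apply: ler_sum => j _.
rewrite fnormZ -[leRHS]mulr1 ler_wpM2l//.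
rewrite /fnorm fdotE (bigD1 i)//= (bigD1 j)//= !big1 ?addr0.
- by rewrite mxE !eqxx /= mulr1 sqrtr1.
- move=> i' ii'; rewrite big1// => j' _.
  by rewrite mxE (negbTE ii') mul0r.
- by move=> j' jj'; rewrite mxE (negbTE jj') andbF mul0r.
Qed.

Lemma enormE n (v : 'cV[R]_n) : enorm v = fnorm v.
Proof.
rewrite /enorm /fnorm fdotE; congr Num.sqrt; apply: eq_bigr => i _.
by rewrite big_ord1 expr2.
Qed.

Lemma edotE n (u v : 'cV[R]_n) : edot u v = fdot u v.
Proof. by rewrite /edot /fdot /mxtrace big_ord1. Qed.

Lemma fdotMl m n k (A : 'M[R]_(m, n)) (B : 'M[R]_(n, k)) C :
  fdot (A *m B) C = fdot B (A^T *m C).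
Proof. by rewrite /fdot trmx_mul mulmxA. Qed.

Lemma fdotMr m n k (A : 'M[R]_(m, n)) (B : 'M[R]_(n, k)) C :
  fdot C (A *m B) = fdot (A^T *m C) B.
Proof. by rewrite fdotC fdotMl fdotC. Qed.

Lemma fdot_isometry m n k (U : 'M[R]_(m, n)) (A B : 'M[R]_(n, k)) :
  U^T *m U = 1%:M -> fdot (U *m A) (U *m B) = fdot A B.
Proof. by move=> UU; rewrite fdotMl mulmxA UU mul1mx. Qed.

Lemma fnorm_isometry m n k (U : 'M[R]_(m, n)) (A : 'M[R]_(n, k)) :
  U^T *m U = 1%:M -> fnorm (U *m A) = fnorm A.
Proof. by move=> UU; rewrite /fnorm fdot_isometry. Qed.

End Frobenius.

Section Psd.
Context {R : realType}.

Lemma psdP n (A : 'M[R]_n) :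
  is_psd A <-> A^T = A /\ forall v : 'cV[R]_n, 0 <= fdot v (A *m v).
Proof. by split=> -[AT h]; split=> // v; [rewrite -edotE|rewrite edotE]. Qed.

Lemma psd_gram m n (A : 'M[R]_(m, n)) : is_psd (A^T *m A).
Proof.
apply/psdP; split; first by rewrite trmx_mul trmxK.
by move=> v; rewrite -mulmxA fdotMr trmxK fdot_ge0.
Qed.

Lemma psdZ n c (A : 'M[R]_n) : 0 <= c -> is_psd A -> is_psd (c *: A).
Proof.
move=> c0 /psdP[AT h]; apply/psdP; split; first by rewrite linearZ /= AT.
by move=> v; rewrite -scalemxAl fdotZr mulr_ge0.
Qed.

Lemma psdD n (A B : 'M[R]_n) : is_psd A -> is_psd B -> is_psd (A + B).
Proof.
move=> /psdP[AT hA] /psdP[BT hB]; apply/psdP; split; first by rewrite linearD /= AT BT.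
by move=> v; rewrite mulmxDl fdotDr addr_ge0.
Qed.

Lemma psd1 n : is_psd (1%:M : 'M[R]_n).
Proof. by rewrite -[1%:M]mul1mx -{1}[1%:M]trmx1; exact: psd_gram. Qed.

Lemma psd_congr m n (A : 'M[R]_n) (B : 'M[R]_(n, m)) :
  is_psd A -> is_psd (B^T *m A *m B).
Proof.
move=> /psdP[AT h]; apply/psdP; split.
  by rewrite !trmx_mul trmxK AT mulmxA.
by move=> v; rewrite -!mulmxA fdotMr trmxK.
Qed.

Lemma fdot_cols m n (A B : 'M[R]_(n, m)) :
  fdot A B = \sum_j fdot (col j A) (col j B).
Proof.
rewrite fdotE exchange_big; apply: eq_bigr => j _; rewrite fdotE.
by apply: eq_bigr => i _; rewrite big_ord1 !mxE.
Qed.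

Lemma colM m n k (A : 'M[R]_(m, n)) (B : 'M[R]_(n, k)) j :
  col j (A *m B) = A *m col j B.
Proof. by apply/colP => i; rewrite !mxE; apply: eq_bigr => l _; rewrite mxE. Qed.

Lemma psd_trace m n (A : 'M[R]_n) (D : 'M[R]_(n, m)) :
  is_psd A -> 0 <= fdot D (A *m D).
Proof.
by move=> /psdP[_ h]; rewrite fdot_cols sumr_ge0// => j _; rewrite colM.
Qed.

(** The discriminant of t |-> (v + t w)^T A (v + t w). *)
Lemma psd_CS n (A : 'M[R]_n) (u v : 'cV[R]_n) : is_psd A ->
  fdot u (A *m v) ^+ 2 <= fdot u (A *m u) * fdot v (A *m v).
Proof.
move=> /psdP[AT h].
have sA : fdot v (A *m u) = fdot u (A *m v) by rewrite fdotC fdotMl AT.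
have q t : 0 <= fdot u (A *m u) + t * fdot u (A *m v) *+ 2 + t ^+ 2 * fdot v (A *m v).
  apply: le_trans (h (u + t *: v)) _.
  rewrite mulmxDr -scalemxAr fdotDl !fdotDr !fdotZl !fdotZr sA.
  by rewrite le_eqVlt; apply/orP; left; apply/eqP; ring.
have [v0|v0] := eqVneq (fdot v (A *m v)) 0.
  rewrite v0 mulr0 in q *.
  have [->|b0] := eqVneq (fdot u (A *m v)) 0; first by rewrite expr0n.
  have := q (- (fdot u (A *m u) + 1) / (fdot u (A *m v) *+ 2)).
  rewrite mulr0 addr0 -mulrnAr divfK ?mulrn_eq0//.
  by rewrite opprD addrA subrr sub0r ler0N1.
have vp : 0 < fdot v (A *m v) by rewrite lt_def v0 h.
have := q (- fdot u (A *m v) / fdot v (A *m v)).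
rewrite -(ler_pM2r vp) mul0r => {}q; rewrite -subr_ge0; apply: le_trans q _.
by rewrite le_eqVlt; apply/orP; left; apply/eqP; field.
Qed.

Lemma psd_ker n (A : 'M[R]_n) (v : 'cV[R]_n) : is_psd A ->
  fdot v (A *m v) = 0 -> A *m v = 0.
Proof.
move=> Ap v0; apply: fdot_eq0.
have := psd_CS (A *m v) v Ap; rewrite v0 mulr0 => h.
by apply/eqP; rewrite -sqrf_eq0 eq_le h sqr_ge0.
Qed.

Lemma psd_trace_ker m n (A : 'M[R]_n) (D : 'M[R]_(n, m)) :
  is_psd A -> fdot D (A *m D) = 0 -> A *m D = 0.
Proof.
move=> Ap; rewrite fdot_cols => /eqP; rewrite psumr_eq0; last first.
  by move=> j _; rewrite colM; case/psdP : Ap => _; apply.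
move=> /allP h; apply/matrixP => i j.
have /= := h j (mem_index_enum _); rewrite colM => /eqP /(psd_ker Ap).
by rewrite -colM => /colP /(_ i); rewrite !mxE.
Qed.

Lemma sub_sqrE n (B C : 'M[R]_n) :
  B *m B - C *m C = B *m (B - C) + (B - C) *m C.
Proof. by rewrite mulmxBr mulmxBl addrA subrK. Qed.

(** With D = B - C one has B^2 - C^2 = B D + D C, whose inner product with D is
    tr (D B D) + tr (D C D), a sum of two nonnegative terms. *)
Lemma sqr_inj_psd n (B C : 'M[R]_n) :
  is_psd B -> is_psd C -> B *m B = C *m C -> B = C.
Proof.
move=> Bp Cp BC; apply/eqP; rewrite -subr_eq0; apply/eqP; set D := B - C.
have BT : B^T = B by case: Bp. have CT : C^T = C by case: Cp.
have DT : D^T = D by rewrite /D linearB /= BT CT.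
have : fdot D (B *m D + D *m C) = 0.
  by rewrite -sub_sqrE BC subrr /fdot mulmx0 mxtrace0.
have DC : fdot D (D *m C) = fdot D (C *m D).
  by rewrite /fdot DT mxtrace_mulC -mulmxA.
rewrite fdotDr DC => h.
have h1 := psd_trace D Bp; have h2 := psd_trace D Cp.
have /(psd_trace_ker Bp) BD : fdot D (B *m D) = 0 by apply/eqP; rewrite eq_le h1 andbT; lra.
have /(psd_trace_ker Cp) CD : fdot D (C *m D) = 0 by apply/eqP; rewrite eq_le h2 andbT; lra.
by apply: fdot_eq0; rewrite /fdot DT {1}/D mulmxBl BD CD subrr mxtrace0.
Qed.

(** The matrix square root is Lipschitz where it is bounded below: in the same
    inner product, tr (D B D) >= lam |D|^2 and tr (D C D) >= 0. *)
Lemma sqrt_lipschitz n (B C : 'M[R]_n) (lam : R) :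
  is_psd B -> is_psd C -> (forall v : 'cV[R]_n, lam * fdot v v <= fdot v (B *m v)) ->
  lam * fnorm (B - C) <= fnorm (B *m B - C *m C).
Proof.
move=> Bp Cp lamB; set D := B - C.
have [D0|D0] := eqVneq (fnorm D) 0; first by rewrite D0 mulr0 fnorm_ge0.
have Dp : 0 < fnorm D by rewrite lt_def D0 fnorm_ge0.
have BT : B^T = B by case: Bp. have CT : C^T = C by case: Cp.
have DT : D^T = D by rewrite /D linearB /= BT CT.
have DC : fdot D (D *m C) = fdot D (C *m D).
  by rewrite /fdot DT mxtrace_mulC -mulmxA.
rewrite -(ler_pM2r Dp); apply: le_trans (_ : fdot D (B *m B - C *m C) <= _); last first.
  by rewrite mulrC; apply: le_trans (ler_norm _) (fdot_CS _ _).
rewrite sub_sqrE fdotDr DC -mulrA -expr2 fnorm2 ler_wpDr ?psd_trace//.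
rewrite fdot_cols [leRHS]fdot_cols mulr_sumr ler_sum// => j _.
by rewrite colM.
Qed.

End Psd.

(** * Existence of the principal square root *)

Lemma cvg_sumr (R : realType) (T I : Type) (F : set_system T) (r : seq I)
    (P : pred I) (f : I -> T -> R) (a : I -> R) : Filter F ->
  (forall i, P i -> f i x @[x --> F] --> a i) ->
  \sum_(i <- r | P i) f i x @[x --> F] --> \sum_(i <- r | P i) a i.
Proof. by move=> FF h; apply: cvg_big => // -[x y]; exact: add_continuous. Qed.

Section SqrtExistence.
Context {R : realType} {q : nat}.
Implicit Types (A B Y : 'M[R]_q.+1) (v : 'cV[R]_q.+1).

(** The fixed points of this iteration satisfy (1 - Y)^2 = 1 - B. *)
Definition sqrt_iter B k : 'M[R]_q.+1 :=
  iter k (fun Y => 2^-1 *: (B + Y *m Y)) 0.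

Let sqrt_poly k : {poly R} := iter k (fun p => 2^-1 *: ('X + p * p)) 0.

Let sqrt_iterE B k : sqrt_iter B k = horner_mx B (sqrt_poly k).
Proof.
elim: k => [|k IH]; first by rewrite /= rmorph0.
by rewrite /sqrt_iter /sqrt_poly !iterS -/(sqrt_iter B k) -/(sqrt_poly k)
  linearZ /= rmorphD rmorphM /= horner_mx_X IH.
Qed.

Let ge0_coef (p : {poly R}) := forall i, 0 <= p`_i.

Let ge0_coefM p1 p2 : ge0_coef p1 -> ge0_coef p2 -> ge0_coef (p1 * p2).
Proof. by move=> h1 h2 i; rewrite coefM sumr_ge0// => j _; rewrite mulr_ge0. Qed.

Let ge0_coef_sqrt k : ge0_coef (sqrt_poly k).
Proof.
elim: k => [|k IH] i; first by rewrite coef0.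
rewrite /sqrt_poly iterS -/(sqrt_poly k) coefZ coefD coefX mulr_ge0 ?invr_ge0//.
by rewrite addr_ge0// ge0_coefM.
Qed.

Let ge0_coef_diff k : ge0_coef (sqrt_poly k.+1 - sqrt_poly k).
Proof.
elim: k => [|k IH].
  rewrite /sqrt_poly /= mulr0 addr0 subr0 => i.
  by rewrite coefZ coefX mulr_ge0 ?invr_ge0.
have -> : sqrt_poly k.+2 - sqrt_poly k.+1 =
    2^-1 *: ((sqrt_poly k.+1 - sqrt_poly k) * (sqrt_poly k.+1 + sqrt_poly k)).
  rewrite {1}/sqrt_poly iterS -/(sqrt_poly k.+1).
  rewrite [X in _ - X = _]/sqrt_poly iterS -/(sqrt_poly k).
  by rewrite -scalerBr; congr (_ *: _); ring.
move=> i; rewrite coefZ mulr_ge0 ?invr_ge0// ge0_coefM// => j.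
by rewrite coefD addr_ge0// ge0_coef_sqrt.
Qed.

Let sqrt_poly1_le1 k : (sqrt_poly k).[1] <= 1.
Proof.
have ge0 j : 0 <= (sqrt_poly j).[1].
  rewrite horner_coef sumr_ge0// => i _; rewrite mulr_ge0 ?exprn_ge0//.
  exact: ge0_coef_sqrt.
elim: k => [|k IH]; first by rewrite horner0.
rewrite /sqrt_poly iterS -/(sqrt_poly k) hornerZ hornerD hornerX hornerM.
have := ge0 k; nra.
Qed.

Section Contraction.
Variable B : 'M[R]_q.+1.
Hypothesis Bp : is_psd B.
Hypothesis B1 : forall v : 'cV[R]_q.+1, fdot v (B *m v) <= fdot v v.

Let contr v : fdot (B *m v) (B *m v) <= fdot v v.
Proof.
set w := B *m v.
have h : fdot w w ^+ 2 <= fdot w w * fdot v v.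
  apply: le_trans (psd_CS w v Bp) _.
  by apply: ler_pM; rewrite ?B1//; case/psdP : Bp => _; apply.
have [->|w0] := eqVneq (fdot w w) 0; first exact: fdot_ge0.
by rewrite -(@ler_pM2l _ (fdot w w)) ?lt_def ?w0 ?fdot_ge0// -expr2.
Qed.

Let contrX i v : fdot (B ^+ i *m v) (B ^+ i *m v) <= fdot v v.
Proof.
elim: i => [|i IH]; first by rewrite expr0 mul1mx.
by rewrite exprS -mulmxA; apply: le_trans (contr _) IH.
Qed.

Let BXT i : (B ^+ i)^T = B ^+ i.
Proof.
elim: i => [|i IH]; first by rewrite expr0 trmx1.
by rewrite exprS trmx_mul IH (proj1 Bp) -[RHS]exprS exprSr.
Qed.

Let powB_ge0 i v : 0 <= fdot v (B ^+ i *m v).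
Proof.
have e : i = (odd i + (i./2 + i./2))%N by rewrite addnn odd_double_half.
rewrite e addnA [(odd i + _)%N]addnC -addnA exprD -mulmxE -mulmxA fdotMr BXT.
rewrite exprD -mulmxE -mulmxA.
case: (odd i); last by rewrite expr0 mul1mx fdot_ge0.
by rewrite expr1; case/psdP : Bp => _; apply.
Qed.

Let powB_le i v : fdot v (B ^+ i *m v) <= fdot v v.
Proof.
apply: le_trans (ler_norm _) _; apply: le_trans (fdot_CS _ _) _.
rewrite -fnorm2 expr2 ler_wpM2l ?fnorm_ge0//.
by rewrite /fnorm ler_wsqrtr// contrX.
Qed.

Let formE p v : fdot v (horner_mx B p *m v) =
  \sum_(i < size p) p`_i * fdot v (B ^+ i *m v).
Proof.
rewrite -{1}[p]coefK poly_def.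
rewrite linear_sum /= mulmx_suml /fdot mulmx_sumr linear_sum /=.
apply: eq_bigr => i _.
by rewrite linearZ /= rmorphXn /= horner_mx_X -scalemxAl -scalemxAr linearZ.
Qed.

Let form_ge0 p v : ge0_coef p -> 0 <= fdot v (horner_mx B p *m v).
Proof. by move=> hp; rewrite formE sumr_ge0// => i _; rewrite mulr_ge0. Qed.

Let form_le p v : ge0_coef p -> fdot v (horner_mx B p *m v) <= p.[1] * fdot v v.
Proof.
move=> hp; rewrite formE horner_coef mulr_suml ler_sum// => i _.
by rewrite expr1n mulr1 ler_wpM2l.
Qed.

Let iter_sym k : (sqrt_iter B k)^T = sqrt_iter B k.
Proof.
elim: k => [|k IH]; first by rewrite /= trmx0.
by rewrite /sqrt_iter iterS -/(sqrt_iter B k) linearZ linearD /= trmx_mul IH;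
  case: Bp => -> _.
Qed.

(** Each iterate is a polynomial in B with nonnegative coefficients, and so is
    each increment: the quadratic forms of the iterates are nondecreasing, and
    they are at most that of the identity. *)
Let form_cvg v : cvgn (fun k => fdot v (sqrt_iter B k *m v)).
Proof.
apply: nondecreasing_is_cvgn.
  apply/nondecreasing_seqP => k; rewrite -subr_ge0.
  rewrite -fdotNr -fdotDr -mulmxBl !sqrt_iterE -rmorphB /=.
  exact/form_ge0/ge0_coef_diff.
exists (fdot v v) => _ [k _ <-].
rewrite sqrt_iterE; apply: le_trans (form_le _ (ge0_coef_sqrt k)) _.
by rewrite ler_piMl ?fdot_ge0.
Qed.

Let entryE Y i j : Y^T = Y -> Y i j = 2^-1 *
  (fdot (delta_mx i 0 + delta_mx j 0 : 'cV_q.+1) (Y *m (delta_mx i 0 + delta_mx j 0))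
   - fdot (delta_mx i 0 : 'cV_q.+1) (Y *m delta_mx i 0)
   - fdot (delta_mx j 0 : 'cV_q.+1) (Y *m delta_mx j 0)).
Proof.
move=> YT; rewrite mulmxDr !fdotDl !fdotDr.
have E a b : fdot (delta_mx a 0 : 'cV_q.+1) (Y *m delta_mx b 0) = Y a b.
  by rewrite /fdot trmx_delta -colE -rowE /mxtrace big_ord1 !mxE.
rewrite !E; have -> : Y j i = Y i j by rewrite -[in LHS]YT mxE.
by field.
Qed.

Lemma sqrt_iter_cvg : exists Y, [/\
  forall i j, sqrt_iter B k i j @[k --> \oo] --> Y i j,
  is_psd (1%:M - Y) & (1%:M - Y) *m (1%:M - Y) = 1%:M - B].
Proof.
have cv i j : cvgn (fun k => sqrt_iter B k i j).
  under eq_fun do rewrite entryE//.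
  by apply: is_cvgMl_tmp; apply: is_cvgB; [apply: is_cvgB|]; exact: form_cvg.
pose Y := \matrix_(i, j) limn (fun k => sqrt_iter B k i j) : 'M[R]_q.+1.
have cY i j : sqrt_iter B k i j @[k --> \oo] --> Y i j.
  by rewrite mxE; exact: cv.
have YT : Y^T = Y.
  apply/matrixP => i j; rewrite !mxE.
  suff -> : (fun k => sqrt_iter B k j i) = (fun k => sqrt_iter B k i j) by [].
  by apply/funext => k; rewrite -[in LHS]iter_sym mxE.
have YE : Y = 2^-1 *: (B + Y *m Y).
  apply/matrixP => i j; rewrite !mxE.
  apply/cvg_lim => //; rewrite -cvg_shiftS.
  have -> : (fun k => sqrt_iter B k.+1 i j) =
      (fun k => 2^-1 * (B i j + \sum_l sqrt_iter B k i l * sqrt_iter B k l j)).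
    by apply/funext => k; rewrite /sqrt_iter iterS -/(sqrt_iter B k) !mxE.
  apply: cvgMl_tmp; apply: cvgD; first exact: cvg_cst.
  by apply: cvg_sumr => l _; apply: cvgM; exact: cY.
exists Y; split=> //.
  apply/psdP; split; first by rewrite linearB /= trmx1 YT.
  move=> v.
  have cf : fdot v ((1%:M - sqrt_iter B k) *m v) @[k --> \oo] --> fdot v ((1%:M - Y) *m v).
    rewrite fdotE; under eq_fun do rewrite fdotE.
    apply: cvg_sumr => i _; apply: cvg_sumr => j _; apply: cvgMl_tmp.
    rewrite mxE; under eq_fun do rewrite mxE.
    apply: cvg_sumr => l _; apply: cvgMr_tmp.
    by rewrite !mxE; under eq_fun do rewrite !mxE; apply: cvgB => //; exact: cvg_cst.
  rewrite -(cvg_lim _ cf)//; apply: limr_ge; first by apply/cvg_ex; eexists; exact: cf.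
  apply: nearW => k; rewrite mulmxBl mul1mx fdotDr fdotNr subr_ge0 sqrt_iterE.
  by apply: le_trans (form_le _ (ge0_coef_sqrt k)) _; rewrite ler_piMl ?fdot_ge0.
have e : B + Y *m Y = 2 *: Y by rewrite [in RHS]YE scalerA divff// scale1r.
rewrite mulmxBl mul1mx mulmxBr mulmx1 opprB addrA.
have -> : Y *m Y = 2 *: Y - B by rewrite -e addrAC subrr add0r.
by rewrite scaler_nat mulr2n; apply/matrixP => i j; rewrite !mxE; ring.
Qed.

End Contraction.

Definition sqrt_scale A : R := 1 + fnorm A.

Lemma sqrt_scale_gt0 A : 0 < sqrt_scale A.
Proof. by rewrite /sqrt_scale ltr_pwDl ?fnorm_ge0. Qed.

(** Scaling A by 1 + |A| makes B = I - A / (1 + |A|) satisfy 0 <= B <= I; the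
    iteration Y |-> (B + Y^2) / 2 then solves (I - Y)^2 = I - B. *)
Lemma sqrtmx_iter A : is_psd A ->
  [/\ is_psd (sqrtmx A), sqrtmx A *m sqrtmx A = A &
    forall i j, Num.sqrt (sqrt_scale A) * ((i == j)%:R -
       sqrt_iter (1%:M - (sqrt_scale A)^-1 *: A) k i j) @[k --> \oo] --> sqrtmx A i j].
Proof.
move=> Ap; set c := sqrt_scale A; have c0 : 0 < c := sqrt_scale_gt0 A.
set B := 1%:M - c^-1 *: A.
have Bform v : fdot v (B *m v) = fdot v v - c^-1 * fdot v (A *m v).
  by rewrite mulmxBl mul1mx -scalemxAl fdotDr fdotNr fdotZr.
have Bp : is_psd B.
  apply/psdP; split; first by rewrite linearB linearZ /= trmx1; case: Ap => ->.
  move=> v; rewrite Bform subr_ge0 ler_pdivrMl//.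
  apply: le_trans (ler_norm _) _; apply: le_trans (fdot_CS _ _) _.
  apply: le_trans (ler_wpM2l (fnorm_ge0 _) (fnormM _ _)) _.
  by rewrite mulrCA -expr2 fnorm2 ler_wpM2r ?fdot_ge0// /c /sqrt_scale lerDr.
have B1 v : fdot v (B *m v) <= fdot v v.
  rewrite Bform gerBl mulr_ge0 ?invr_ge0 ?(ltW c0)//.
  by case/psdP : Ap => _; apply.
have [Y [cY Yp YY]] := sqrt_iter_cvg Bp B1.
pose C := Num.sqrt c *: (1%:M - Y).
have Cp : is_psd C by apply: psdZ => //; exact: sqrtr_ge0.
have CC : C *m C = A.
  rewrite /C -scalemxAl -scalemxAr scalerA -expr2 sqr_sqrtr ?ltW// YY.
  by rewrite /B opprB addrC subrK scalerA divff ?gt_eqF// scale1r.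
have [Sp SS] : is_psd (sqrtmx A) /\ sqrtmx A *m sqrtmx A = A.
  by rewrite /sqrtmx; case: xgetP => [_ _ []//|/(_ C)[]].
split=> // i j.
have -> : sqrtmx A = C by apply: sqr_inj_psd => //; rewrite SS.
rewrite /C !mxE; apply: cvgMl_tmp; apply: cvgB; first exact: cvg_cst.
exact: cY.
Qed.

Lemma sqrtmx_psd A : is_psd A -> is_psd (sqrtmx A).
Proof. by case/sqrtmx_iter. Qed.

Lemma sqrtmx_sqr A : is_psd A -> sqrtmx A *m sqrtmx A = A.
Proof. by case/sqrtmx_iter. Qed.

End SqrtExistence.

(** * Measurability of matrix operations *)

Section Measurability.
Context {d : measure_display} {T : measurableType d} {R : realType}.

(** With 0^-1 = 0 one has x^-1 = x |x|^-2, and real powers are measurable. *)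
Lemma measurable_invr (f : T -> R) :
  measurable_fun setT f -> measurable_fun setT (fun t => (f t)^-1).
Proof.
move=> mf.
rewrite (_ : (fun t => _) = (fun t => f t * (`|f t| `^ (-1)) ^+ 2)).
  apply: measurable_funM => //; apply: measurable_funX.
  apply: (@measurableT_comp _ _ _ _ _ _ (fun x : R => x `^ (-1)) _ (fun t => `|f t|)).
    exact: measurable_powR.
  exact: measurableT_comp.
apply/funext => t; rewrite powR_inv1//.
have [->|f0] := eqVneq (f t) 0; first by rewrite mul0r invr0.
by rewrite exprVn real_normK ?num_real// expr2 invfM mulrA divff// mul1r.
Qed.

Lemma measurable_sqrtr (f : T -> R) :
  measurable_fun setT f -> measurable_fun setT (fun t => Num.sqrt (f t)).
Proof.
move=> mf.
rewrite (_ : (fun t => _) = (fun t => (Num.max (f t) 0) `^ 2^-1)).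
  apply: (@measurableT_comp _ _ _ _ _ _ (fun x : R => x `^ 2^-1) _
    (fun t => Num.max (f t) 0)); first exact: measurable_powR.
  exact: measurable_maxr.
apply/funext => t; rewrite powR12_sqrt ?le_max ?lexx ?orbT//.
by have [h|h] := leP 0 (f t) => //; rewrite ltr0_sqrtr// sqrtr0.
Qed.

Lemma random_cst m n (A : 'M[R]_(m, n)) : random_mx (fun _ : T => A).
Proof. by move=> i j; exact: measurable_cst. Qed.

Lemma randomD m n (A B : T -> 'M[R]_(m, n)) :
  random_mx A -> random_mx B -> random_mx (fun t => A t + B t).
Proof.
move=> mA mB i j; under eq_fun do rewrite mxE.
by apply: measurable_funD.
Qed.

Lemma randomZ m n (c : T -> R) (A : T -> 'M[R]_(m, n)) :
  measurable_fun setT c -> random_mx A -> random_mx (fun t => c t *: A t).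
Proof.
move=> mc mA i j; under eq_fun do rewrite mxE.
by apply: measurable_funM.
Qed.

Lemma randomN m n (A : T -> 'M[R]_(m, n)) :
  random_mx A -> random_mx (fun t => - A t).
Proof.
move=> mA i j; under eq_fun do rewrite mxE.
by apply: measurableT_comp.
Qed.

Lemma randomB m n (A B : T -> 'M[R]_(m, n)) :
  random_mx A -> random_mx B -> random_mx (fun t => A t - B t).
Proof. by move=> mA mB; apply: randomD => //; exact: randomN. Qed.

Lemma randomM m n k (A : T -> 'M[R]_(m, n)) (B : T -> 'M[R]_(n, k)) :
  random_mx A -> random_mx B -> random_mx (fun t => A t *m B t).
Proof.
move=> mA mB i j; under eq_fun do rewrite mxE.
by apply: measurable_sum => l; apply: measurable_funM.
Qed.

Lemma randomT m n (A : T -> 'M[R]_(m, n)) :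
  random_mx A -> random_mx (fun t => (A t)^T).
Proof. by move=> mA i j; under eq_fun do rewrite mxE; exact: mA. Qed.

Lemma random_row_mx m n k (A : T -> 'M[R]_(m, n)) (B : T -> 'M[R]_(m, k)) :
  random_mx A -> random_mx B -> random_mx (fun t => row_mx (A t) (B t)).
Proof.
by move=> mA mB i j; under eq_fun do rewrite mxE; case: (fintype.split j) => k'; [exact: mA|exact: mB].
Qed.

Lemma random_lsubmx m n k (A : T -> 'M[R]_(m, n + k)) :
  random_mx A -> random_mx (fun t => lsubmx (A t)).
Proof. by move=> mA i j; under eq_fun do rewrite mxE; exact: mA. Qed.

Lemma random_rsubmx m n k (A : T -> 'M[R]_(m, n + k)) :
  random_mx A -> random_mx (fun t => rsubmx (A t)).
Proof. by move=> mA i j; under eq_fun do rewrite mxE; exact: mA. Qed.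

Lemma random_if m n (b : T -> bool) (A B : T -> 'M[R]_(m, n)) :
  measurable_fun setT b -> random_mx A -> random_mx B ->
  random_mx (fun t => if b t then A t else B t).
Proof.
move=> mb mA mB i j; rewrite (_ : (fun t => _) = (fun t => if b t then A t i j else B t i j)).
  exact: measurable_fun_ifT.
by apply/funext => t; case: ifP.
Qed.

Lemma measurable_fdot m n (A B : T -> 'M[R]_(m, n)) :
  random_mx A -> random_mx B -> measurable_fun setT (fun t => fdot (A t) (B t)).
Proof.
move=> mA mB; under eq_fun do rewrite fdotE.
by apply: measurable_sum => i; apply: measurable_sum => j; exact: measurable_funM.
Qed.

Lemma measurable_fnorm m n (A : T -> 'M[R]_(m, n)) :
  random_mx A -> measurable_fun setT (fun t => fnorm (A t)).
Proof. by move=> mA; apply: measurable_sqrtr; exact: measurable_fdot. Qed.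

Lemma measurable_det n (A : T -> 'M[R]_n) :
  random_mx A -> measurable_fun setT (fun t => \det (A t)).
Proof.
move=> mA; apply: measurable_sum => s.
apply: measurable_funM => //.
by apply: measurable_prod => i _; exact: mA.
Qed.

Lemma random_invmx n (A : T -> 'M[R]_n) :
  random_mx A -> random_mx (fun t => invmx (A t)).
Proof.
move=> mA; rewrite /invmx.
under eq_fun do rewrite unitmxE unitfE.
apply: random_if => //.
  rewrite (_ : (fun t => _) = (fun t => ~~ (\det (A t) == 0)))//.
  apply: (measurableT_comp (f := negb)) => //.
  by apply: measurable_fun_eqr => //; exact: measurable_det.
apply: randomZ; first by apply: measurable_invr; exact: measurable_det.
move=> i j; rewrite (_ : (fun t => _) = (fun t => cofactor (A t) j i)).
  apply: measurable_funM => //; apply: measurable_det => a b.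
  by under eq_fun do rewrite !mxE; exact: mA.
by apply/funext => t; rewrite mxE.
Qed.

(** The square root is a pointwise limit of iterates that are measurable. *)
Lemma random_sqrtmx q (A : T -> 'M[R]_q.+1) :
  (forall t, is_psd (A t)) -> random_mx A -> random_mx (fun t => sqrtmx (A t)).
Proof.
move=> pA mA i j.
have mc : measurable_fun setT (fun t => sqrt_scale (A t)).
  by apply: measurable_funD => //; exact: measurable_fnorm.
apply: (measurable_fun_cvg (h := fun k t => Num.sqrt (sqrt_scale (A t)) *
   ((i == j)%:R - sqrt_iter (1%:M - (sqrt_scale (A t))^-1 *: A t) k i j))); last first.
  by move=> t _; have [_ _] := sqrtmx_iter (pA t); exact.
move=> k; apply: measurable_funM; first exact: measurable_sqrtr.
apply: measurable_funB => //.
suff h : random_mx (fun t => sqrt_iter (1%:M - (sqrt_scale (A t))^-1 *: A t) k) by exact: h.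
elim: k => [|k IH]; first exact: random_cst.
apply: randomZ => //; apply: randomD.
  apply: randomB; first exact: random_cst.
  by apply: randomZ => //; exact: measurable_invr.
exact: randomM.
Qed.

Lemma random_invsqrtmx q (A : T -> 'M[R]_q.+1) :
  (forall t, is_psd (A t)) -> random_mx A -> random_mx (fun t => invsqrtmx (A t)).
Proof. by move=> pA mA; apply: random_invmx; exact: random_sqrtmx. Qed.

Lemma measurable_lower_orthant k (Z : T -> 'cV[R]_k) (x : 'cV[R]_k) :
  random_mx Z -> measurable [set t | forall i, Z t i 0 <= x i 0].
Proof.
move=> mZ.
rewrite (_ : [set t | _] = \bigcap_(i in [set: 'I_k]) [set t | Z t i 0 <= x i 0]).
  apply: fin_bigcap_measurable => // i _.
  have := mZ i 0 measurableT `]-oo, x i 0]%classic (measurable_itv _).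
  by rewrite setTI; congr measurable; apply/seteqP; split => t /=; rewrite in_itv.
by apply/seteqP; split=> t /= h i; [move=> _|]; exact: (h i).
Qed.

Lemma measurable_ltr_set (f g : T -> R) :
  measurable_fun setT f -> measurable_fun setT g -> measurable [set t | f t < g t].
Proof.
move=> mf mg; have := measurable_fun_ltr mf mg measurableT (Y := [set true]) I.
by rewrite setTI; congr measurable.
Qed.

Lemma measurable_ler_set (f g : T -> R) :
  measurable_fun setT f -> measurable_fun setT g -> measurable [set t | f t <= g t].
Proof.
move=> mf mg; have := measurable_fun_ler mf mg measurableT (Y := [set true]) I.
by rewrite setTI; congr measurable.
Qed.

End Measurability.

(** * High probability, stochastic orders and freezing of an independent matrix *)

Section WithHighProbability.
Context {d : measure_display} {T : measurableType d} {R : realType}.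
Variable P : probability T R.

Definition prob (A : set T) : R := fine (P A).

Lemma probE A : measurable A -> P A = (prob A)%:E.
Proof. by move=> mA; rewrite fineK// fin_num_measure. Qed.

Lemma le_prob A B : measurable A -> measurable B -> A `<=` B ->
  prob A <= prob B.
Proof.
by move=> mA mB AB; rewrite -lee_fin -!probE// le_measure ?inE.
Qed.

Lemma prob_le1 A : measurable A -> prob A <= 1.
Proof. by move=> mA; rewrite -lee_fin -probE// probability_le1. Qed.

Lemma probC A : measurable A -> prob (~` A) = 1 - prob A.
Proof.
move=> mA; apply: EFin_inj; rewrite EFinB -!probE//; last exact: measurableC.
exact: probability_setC.
Qed.

Lemma probU A B : measurable A -> measurable B ->
  prob (A `|` B) <= prob A + prob B.
Proof.
move=> mA mB; rewrite -lee_fin EFinD -!probE//; last exact: measurableU.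
exact: measureU2.
Qed.

Lemma prob_cvgP (A : nat -> set T) (c : R) : (forall n, measurable (A n)) ->
  (P (A n) @[n --> \oo] --> c%:E) <->
  (forall eps, 0 < eps -> \forall n \near \oo, `|prob (A n) - c| <= eps).
Proof.
move=> mA; split.
  move/fine_cvg => h eps e0.
  have /cvgrPdist_le/(_ eps e0) := h.
  by apply: filterS => n; rewrite distrC.
move=> h; apply: cvg_EFin.
  by apply: nearW => n; rewrite fin_num_measure.
apply/cvgrPdist_le => eps e0; have := h eps e0.
by apply: filterS => n; rewrite distrC.
Qed.

(** The exceptional sets are only covered by measurable sets of small
    probability, so that the properties Q n need not be measurable. *)
Definition whp (Q : nat -> T -> Prop) : Prop := forall eta : R, 0 < eta ->
  \forall n \near \oo, exists B, [/\ measurable B, prob B <= eta &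
    forall t, ~ B t -> Q n t].

Lemma whp_near (Q : nat -> T -> Prop) :
  (\forall n \near \oo, forall t, Q n t) -> whp Q.
Proof.
move=> h eta eta0; apply: filterS h => n h; exists set0; split=> //.
by rewrite /prob measure0 ltW.
Qed.

Lemma whpI (Q Q' : nat -> T -> Prop) :
  whp Q -> whp Q' -> whp (fun n t => Q n t /\ Q' n t).
Proof.
move=> h h' eta eta0; have eta2 : 0 < eta / 2 by rewrite divr_gt0.
apply: filterS2 (h _ eta2) (h' _ eta2) => n [B [mB pB hB]] [B' [mB' pB' hB']].
exists (B `|` B'); split; first exact: measurableU.
  by apply: le_trans (probU mB mB') _; rewrite (splitr eta) lerD.
by move=> t /not_orP[Bt B't]; split; [exact: hB|exact: hB'].
Qed.

Lemma whp_imp (Q Q' : nat -> T -> Prop) :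
  (\forall n \near \oo, forall t, Q n t -> Q' n t) -> whp Q -> whp Q'.
Proof.
move=> QQ' h eta eta0; apply: filterS2 QQ' (h _ eta0) => n QQ' [B [mB pB hB]].
by exists B; split=> // t Bt; exact/QQ'/hB.
Qed.

Lemma whpS (Q Q' : nat -> T -> Prop) :
  (forall n t, Q n t -> Q' n t) -> whp Q -> whp Q'.
Proof. by move=> h; apply: whp_imp; apply: nearW. Qed.

Lemma whp_meas (A : nat -> set T) : (forall n, measurable (A n)) ->
  whp (fun n t => A n t) <-> (forall eps, 0 < eps -> \forall n \near \oo, prob (~` A n) <= eps).
Proof.
move=> mA; split=> h eps e0; have {}h := h eps e0; apply: filterS h => n.
  move=> [B [mB pB hB]]; apply: le_trans pB; apply: le_prob => //.
    exact: measurableC.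
  by move=> t At; apply: contrapT => /hB.
move=> pA; exists (~` A n); split=> //; first exact: measurableC.
by move=> t /contrapT.
Qed.

(** Y = o_P(1). *)
Definition op1 (Y : nat -> T -> R) : Prop :=
  forall eps : R, 0 < eps -> whp (fun n t => `|Y n t| <= eps).

(** Y = O_P(1). *)
Definition Op1 (Y : nat -> T -> R) : Prop := forall eta : R, 0 < eta ->
  exists2 K : R, 0 < K & \forall n \near \oo, exists B, [/\ measurable B, prob B <= eta &
    forall t, ~ B t -> `|Y n t| <= K].

Lemma op1M (Y Z : nat -> T -> R) : op1 Y -> Op1 Z -> op1 (fun n t => Y n t * Z n t).
Proof.
move=> hY hZ eps e0 eta eta0.
have eta2 : 0 < eta / 2 by rewrite divr_gt0.
have [K K0 hK] := hZ _ eta2.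
apply: filterS2 hK (hY (eps / K) (divr_gt0 e0 K0) _ eta2) => n [B [mB pB hB]] [B' [mB' pB' hB']].
exists (B `|` B'); split; first exact: measurableU.
  by apply: le_trans (probU mB mB') _; rewrite (splitr eta) lerD.
move=> t /not_orP[Bt B't]; rewrite normrM -[leRHS](divfK (lt0r_neq0 K0)).
by apply: ler_pM => //; [exact: hB'|exact: hB].
Qed.

Lemma op1Z (k : R) (Y : nat -> T -> R) : op1 Y -> op1 (fun n t => k * Y n t).
Proof.
move=> h e e0; have k1 : 0 < `|k| + 1 by rewrite ltr_wpDl.
apply: whpS (h _ (divr_gt0 e0 k1)) => n t h1; rewrite normrM.
apply: (@le_trans _ _ ((`|k| + 1) * (e / (`|k| + 1)))); last by rewrite mulrC mulfVK ?gt_eqF.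
by rewrite ler_pM// lerDl.
Qed.

Lemma op1_le (Y Z : nat -> T -> R) :
  whp (fun n t => `|Y n t| <= `|Z n t|) -> op1 Z -> op1 Y.
Proof.
move=> YZ hZ eps e0; apply: whpS (whpI YZ (hZ eps e0)) => n t [h h'].
exact: le_trans h h'.
Qed.

Lemma op1D (Y Z : nat -> T -> R) : op1 Y -> op1 Z -> op1 (fun n t => Y n t + Z n t).
Proof.
move=> hY hZ eps e0; have e2 : 0 < eps / 2 by rewrite divr_gt0.
apply: whpS (whpI (hY _ e2) (hZ _ e2)) => n t [h h'].
by rewrite (splitr eps); apply: le_trans (ler_normD _ _) (lerD h h').
Qed.

Lemma op1_sum (I : finType) (Y : I -> nat -> T -> R) :
  (forall i, op1 (Y i)) -> op1 (fun n t => \sum_i Y i n t).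
Proof.
move=> h.
suff H (s : seq I) : op1 (fun n t => \sum_(i <- s) Y i n t) by exact: H.
elim: s => [|i s IH].
  move=> eps e0; apply: whp_near; apply: nearW => n t.
  by rewrite big_nil normr0 ltW.
move=> eps e0; apply: whpS (op1D (h i) IH e0) => n t.
by rewrite big_cons.
Qed.

Lemma op1_Op1 (Y : nat -> T -> R) : op1 Y -> Op1 Y.
Proof. by move=> h eta eta0; exists 1 => //; exact: (h 1 ltr01 _ eta0). Qed.

Lemma Op1_le (Y Z : nat -> T -> R) :
  (forall n t, `|Y n t| <= `|Z n t|) -> Op1 Z -> Op1 Y.
Proof.
move=> YZ h eta eta0; have [K K0 hK] := h _ eta0; exists K => //.
apply: filterS hK => n [B [mB pB hB]]; exists B; split=> // t Bt.
by apply: le_trans (YZ n t) (hB _ Bt).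
Qed.

Lemma Op1D (Y Z : nat -> T -> R) : Op1 Y -> Op1 Z -> Op1 (fun n t => Y n t + Z n t).
Proof.
move=> hY hZ eta eta0; have eta2 : 0 < eta / 2 by rewrite divr_gt0.
have [K K0 hK] := hY _ eta2; have [L L0 hL] := hZ _ eta2.
exists (K + L); first exact: addr_gt0.
apply: filterS2 hK hL => n [B [mB pB hB]] [B' [mB' pB' hB']].
exists (B `|` B'); split; first exact: measurableU.
  by apply: le_trans (probU mB mB') _; rewrite (splitr eta) lerD.
move=> t /not_orP[Bt B't]; apply: le_trans (ler_normD _ _) _.
by apply: lerD; [exact: hB|exact: hB'].
Qed.

Lemma Op1_sum (I : finType) (Y : I -> nat -> T -> R) :
  (forall i, Op1 (Y i)) -> Op1 (fun n t => \sum_i Y i n t).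
Proof.
move=> h.
suff H (s : seq I) : Op1 (fun n t => \sum_(i <- s) Y i n t) by exact: H.
elim: s => [|i s IH].
  apply: op1_Op1 => eps e0; apply: whp_near; apply: nearW => n t.
  by rewrite big_nil normr0 ltW.
by apply: Op1_le (Op1D (h i) IH) => n t; rewrite big_cons.
Qed.

End WithHighProbability.

Section Freezing.
Context {R : realType}.

(** Stable measurability of a predicate on pairs of matrices, tested on
    every pair of random matrices. *)
Definition measurable_event m n k l
    (phi : 'M[R]_(m, n) -> 'M[R]_(k, l) -> Prop) : Prop :=
  forall (d : measure_display) (T : measurableType d)
    (A : T -> 'M[R]_(m, n)) (B : T -> 'M[R]_(k, l)),
    random_mx A -> random_mx B -> measurable [set t | phi (A t) (B t)].

Let coord_sets m n : set (set 'M[R]_(m, n)) :=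
  [set C | exists i j (B : set R),
         measurable B /\ C = [set A : 'M[R]_(m, n) | B (A i j)]].

Let mxT m n := g_sigma_algebraType (@coord_sets m n).

Let random_id m n : random_mx (fun A : mxT m n => A : 'M[R]_(m, n)).
Proof.
move=> i j _ B mB; rewrite setTI; apply: sub_sigma_algebra.
by exists i, j, B; split.
Qed.

Context {d : measure_display} {T : measurableType d}.
Variable P : probability T R.

Let random_measurable m n (A : T -> 'M[R]_(m, n)) : random_mx A ->
  measurable_fun setT (A : T -> mxT m n).
Proof.
move=> mA; apply: (@measurability _ _ T (mxT m n) setT A (@coord_sets m n)) => //.
move=> _ [_ [i [j [B [mB ->]]]] <-].
exact: mA.
Qed.

(** Conditionally on B, the law of A is unchanged: the joint law is the product
    law, and Tonelli's theorem applies. *)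
Lemma freezing m n k l (A : T -> 'M[R]_(m, n)) (B : T -> 'M[R]_(k, l))
    (phi : 'M[R]_(m, n) -> 'M[R]_(k, l) -> Prop) :
  random_mx A -> random_mx B -> indep_mx P A B -> measurable_event phi ->
  measurable_fun setT (fun t => P [set s | phi (A s) (B t)]) /\
  P [set t | phi (A t) (B t)] = (\int[P]_t P [set s | phi (A s) (B t)])%E.
Proof.
move=> mA mB AB mphi.
have mA' := random_measurable mA; have mB' := random_measurable mB.
pose A' : {mfun T >-> mxT m n} := HB.pack (A : T -> mxT m n) (isMeasurableFun.Build _ _ _ _ _ mA').
pose B' : {mfun T >-> mxT k l} := HB.pack (B : T -> mxT k l) (isMeasurableFun.Build _ _ _ _ _ mB').
pose muA := distribution P A'; pose muB := distribution P B'.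
have mAB : measurable_fun setT (fun t => (A' t, B' t)) by exact: measurable_fun_pair.
pose AB' : {mfun T >-> (mxT m n * mxT k l)%type} := HB.pack (fun t => (A' t, B' t)) (isMeasurableFun.Build _ _ _ _ _ mAB).
pose E : set (mxT m n * mxT k l) := [set z | phi z.1 z.2].
have mE : measurable E.
  apply: mphi => i j.
    by apply: (@measurableT_comp _ _ _ _ _ _ (fun M : mxT m n => @fun_of_matrix R m n M i j) setT fst) => //; exact: random_id.
  by apply: (@measurableT_comp _ _ _ _ _ _ (fun M : mxT k l => @fun_of_matrix R k l M i j) setT snd) => //; exact: random_id.
have mS t : measurable [set s | phi (A s) (B t)] by apply: mphi => // i j; exact: measurable_cst.
have mfB : measurable_fun setT (muA \o ysection E).
  exact: measurable_fun_ysection.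
have e t : P [set s | phi (A s) (B t)] = muA (ysection E (B' t)).
  by rewrite /muA /distribution /pushforward; congr (P _); apply/seteqP; split=> s;
    rewrite /ysection /= inE.
split.
  rewrite (_ : (fun t => _) = (muA \o ysection E) \o B'); last exact/funext.
  exact: measurableT_comp.
under eq_integral do rewrite e.
have -> : (\int[P]_t muA (ysection E (B' t)) = \int[muB]_y muA (ysection E y))%E.
  by rewrite /muB ge0_integral_distribution.
have -> : P [set t | phi (A t) (B t)] = distribution P AB' E by [].
rewrite -(product_measure_unique (m1 := muA) (m2 := muB)) => //.
  by apply: (product_measure_unique (m' := (muA \x^ muB)%E)) => //= C D mC mD;
    rewrite product_measure2E.
Qed.

Lemma freezing_le m n k l (A : T -> 'M[R]_(m, n)) (B : T -> 'M[R]_(k, l))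
    (phi : 'M[R]_(m, n) -> 'M[R]_(k, l) -> Prop) (c : R) :
  random_mx A -> random_mx B -> indep_mx P A B -> measurable_event phi ->
  (forall t, prob P [set s | phi (A s) (B t)] <= c) ->
  prob P [set t | phi (A t) (B t)] <= c.
Proof.
move=> mA mB AB mphi h; have [mf e] := freezing mA mB AB mphi.
have mS t : measurable [set s | phi (A s) (B t)] by apply: mphi => // i j; exact: measurable_cst.
rewrite -lee_fin -probE; last exact: mphi.
rewrite e; apply: (@le_trans _ _ (\int[P]_t c%:E)%E).
  by apply: ge0_le_integral => // t _; rewrite probE// lee_fin.
by rewrite integral_cst//= probability_setT mule1.
Qed.

(** Dominated convergence for the conditional probabilities. *)
Lemma freezing_cvg (m n k l : nat -> nat) (A : forall N, T -> 'M[R]_(m N, n N))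
    (B : forall N, T -> 'M[R]_(k N, l N))
    (phi : forall N, 'M[R]_(m N, n N) -> 'M[R]_(k N, l N) -> Prop) (c : R) :
  (forall N, random_mx (A N)) -> (forall N, random_mx (B N)) ->
  (forall N, indep_mx P (A N) (B N)) -> (forall N, measurable_event (phi N)) ->
  {ae P, forall t, P [set s | phi N (A N s) (B N t)] @[N --> \oo] --> c%:E} ->
  P [set t | phi N (A N t) (B N t)] @[N --> \oo] --> c%:E.
Proof.
move=> mA mB AB mphi h.
pose f N t := P [set s | phi N (A N s) (B N t)].
have mf N : measurable_fun setT (f N) by have [] := freezing (mA N) (mB N) (AB N) (mphi N).
have mS N t : measurable [set s | phi N (A N s) (B N t)].
  by apply: mphi => // i j; exact: measurable_cst.
under eq_fun => N do rewrite (proj2 (freezing (mA N) (mB N) (AB N) (mphi N))).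
have h' : {ae P, forall t, setT t -> f ^~ t @ \oo --> (c%:E : \bar R)}.
  by apply: filterS h => t ht _.
have le1 : {ae P, forall t N, setT t -> (`|f N t| <= cst 1%E t)%E}.
  by apply: aeW => t N _; rewrite gee0_abs ?measure_ge0//= probability_le1.
have int1 : P.-integrable setT (cst 1%E : T -> \bar R).
  by apply: finite_measure_integrable_cst.
have [_ _] := @dominated_convergence _ _ _ P setT measurableT f (cst c%:E) (cst 1%E)
  mf (measurable_cst _) h' int1 le1.
by rewrite integral_cst//= probability_setT mule1.
Qed.

(** This lemma and the next reduce an unconditional limit to the one obtained
    when B is fixed at almost every of its realizations. *)
Lemma freezing_std_normal (m n k l : nat -> nat) r (A : forall N, T -> 'M[R]_(m N, n N))
    (B : forall N, T -> 'M[R]_(k N, l N))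
    (z : forall N, 'M[R]_(m N, n N) -> 'M[R]_(k N, l N) -> 'cV[R]_r) :
  (forall N, random_mx (A N)) -> (forall N, random_mx (B N)) ->
  (forall N, indep_mx P (A N) (B N)) ->
  (forall N, forall (d' : measure_display) (T' : measurableType d')
    (A' : T' -> 'M[R]_(m N, n N)) (B' : T' -> 'M[R]_(k N, l N)),
    random_mx A' -> random_mx B' -> random_mx (fun t => z N (A' t) (B' t))) ->
  {ae P, forall t, cvg_std_normal P (fun N s => z N (A N s) (B N t))} ->
  cvg_std_normal P (fun N t => z N (A N t) (B N t)).
Proof.
move=> mA mB AB mz h x.
pose c := \prod_(i < r) fine (normal_prob 0%R 1%R `]-oo, x i 0%R]%classic : \bar R).
have cE : (\prod_(i < r) normal_prob 0%R 1%R `]-oo, x i 0%R]%classic)%E = c%:E.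
  rewrite /c -prodEFin; apply: eq_bigr => i _.
  by rewrite fineK// fin_num_measure.
rewrite cE; apply: (@freezing_cvg _ _ _ _ A B (fun N a b => forall i, z N a b i 0 <= x i 0)) => //.
  move=> N d' T' A' B' mA' mB'.
  by apply: measurable_lower_orthant; exact: mz.
by apply: filterS h => t /(_ x); rewrite cE.
Qed.

Lemma freezing_whp (m n k l : nat -> nat) (A : forall N, T -> 'M[R]_(m N, n N))
    (B : forall N, T -> 'M[R]_(k N, l N))
    (phi : forall N, 'M[R]_(m N, n N) -> 'M[R]_(k N, l N) -> Prop) :
  (forall N, random_mx (A N)) -> (forall N, random_mx (B N)) ->
  (forall N, indep_mx P (A N) (B N)) -> (forall N, measurable_event (phi N)) ->
  {ae P, forall t, whp P (fun N s => phi N (A N s) (B N t))} ->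
  whp P (fun N t => phi N (A N t) (B N t)).
Proof.
move=> mA mB AB mphi h.
have mD N : measurable [set t | phi N (A N t) (B N t)] by exact: mphi.
have mS N t : measurable [set s | phi N (A N s) (B N t)].
  by apply: mphi => // i j; exact: measurable_cst.
apply/(whp_meas P mD).
suff : P [set t | phi N (A N t) (B N t)] @[N --> \oo] --> (1%R)%:E.
  move=> /(prob_cvgP P _ mD) h1 eps e0; apply: filterS (h1 _ e0) => N.
  by rewrite distrC probC//; apply: le_trans; exact: ler_norm.
apply: freezing_cvg => //; apply: filterS h => t /(whp_meas P (mS^~ t)) ht.
apply/prob_cvgP => // eps e0; apply: filterS (ht _ e0) => N.
by rewrite probC// distrC ger0_norm// subr_ge0 prob_le1.
Qed.

End Freezing.

(** * Cosine transform of the Gaussian density *)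

Section GaussianCharacteristic.
Context {R : realType}.
Local Notation mu := (@lebesgue_measure R).
Local Notation w := (@normal_pdf R 0 1).

(** Integration by parts on the line: the fundamental theorem of calculus on
    [-n, n], then dominated convergence. *)
Lemma integral_derive_vanishing (F f : R -> R) :
  (forall x : R, is_derive x 1 F (f x)) -> continuous f ->
  mu.-integrable setT (EFin \o f) ->
  F n%:R - F (- n%:R) @[n --> \oo] --> (0 : R) ->
  \int[mu]_x f x = 0.
Proof.
move=> dF cf intf F0.
pose I (n : nat) : set R := `[(- n%:R), n%:R]%classic.
have lim1 : (\int[mu]_x (f x * \1_(I n) x)%:E)%E @[n --> \oo] --> (\int[mu]_x (f x)%:E)%E.
  have mf : measurable_fun setT f by case/integrableP : intf => /measurable_EFinP.
  have [] // := @dominated_convergence _ _ _ mu setT measurableT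
    (fun n x => (f x * \1_(I n) x)%:E) (EFin \o f) (fun x => `|f x|%:E).
  - move=> n; apply/measurable_EFinP; apply: measurable_funM => //.
    by apply: measurable_indic; exact: measurable_itv.
  - exact/measurable_EFinP.
  - apply: aeW => x _; apply: cvg_near_cst.
    near=> n; rewrite indicE mem_set ?mulr1//=.
    rewrite /I /= in_itv /= -ler_norml; near: n; exact: nbhs_infty_ger.
  - exact: integrable_abse intf.
  - apply: aeW => x n _; rewrite /= lee_fin normrM ler_piMr// indicE.
    by case: (_ \in _); rewrite ?normr1 ?normr0.
have e n : (\int[mu]_x (f x * \1_(I n.+1) x)%:E = (F n.+1%:R - F (- n.+1%:R))%:E)%E.
  have lt : - n.+1%:R < n.+1%:R :> R by rewrite -subr_gt0 opprK addr_gt0 ?ltr0n.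
  rewrite EFinB -(@continuous_FTC2 _ f F) //.
  - rewrite [RHS]integral_mkcond; apply: eq_integral => x _.
    rewrite /I patchE indicE; case: ifPn => /=; by rewrite ?mulr1 ?mulr0.
  - exact: continuous_subspaceT.
  - have cF : continuous F.
      move=> x; apply: differentiable_continuous; apply/derivable1_diffP.
      exact: ex_derive.
    split.
    + by move=> x _; exact: ex_derive.
    + by apply: cvg_at_right_filter; exact: cF.
    + by apply: cvg_at_left_filter; exact: cF.
  - by move=> x _; rewrite derive1E derive_val.
have lim0 : (\int[mu]_x (f x * \1_(I n) x)%:E)%E @[n --> \oo] --> 0%E.
  rewrite -cvg_shiftS; under eq_fun do rewrite e.
  apply: cvg_EFin; first exact: nearW.
  by rewrite (_ : _ \o _ = fun n => F n.+1%:R - F (- n.+1%:R))// (cvg_shiftS (fun n => F n%:R - F (- n%:R))).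
by rewrite /Rintegral (cvg_unique _ lim1 lim0).
Unshelve. all: by end_near. Qed.

Let wE x : w x = normal_peak 1 * expR (- (x ^+ 2 / 2)).
Proof.
by rewrite normal_pdfE ?oner_eq0//= /normal_fun subr0 expr1n mulNr.
Qed.

Let pk_ge0 : 0 <= normal_peak (1 : R). Proof. exact: normal_peak_ge0. Qed.

(** This bound dominates the derivative in t of the integrand below. *)
Let wxE x : w x * `|x| <= normal_peak 1 * expR (- (x ^+ 2 / 4)).
Proof.
rewrite wE -mulrA ler_wpM2l//.
have -> : - (x ^+ 2 / 2) = - (x ^+ 2 / 4) - x ^+ 2 / 4 by field.
rewrite expRD -mulrA -[leRHS]mulr1 ler_wpM2l ?expR_ge0//.
rewrite expRN mulrC ler_pdivrMr ?expR_gt0// mul1r.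
have h := expR_ge1Dx (x ^+ 2 / 4).
apply: le_trans h; rewrite -[x ^+ 2]real_normK ?num_real//.
have := sqr_ge0 (`|x| / 2 - 1); nra.
Qed.

Let int_quarter : mu.-integrable setT (fun x => (normal_peak 1 * expR (- (x ^+ 2 / 4)))%:E).
Proof.
have s0 : Num.sqrt 2 != 0 :> R by rewrite gt_eqF// sqrtr_gt0.
have h := @integrable_normal_pdf R 0 (Num.sqrt 2).
have := integrableZl measurableT (normal_peak 1 / normal_peak (Num.sqrt 2)) h.
congr (_.-integrable _ _); apply/funext => x; rewrite -EFinM; congr EFin.
rewrite normal_pdfE//= mulrA divfK; last by rewrite gt_eqF// normal_peak_gt0.
rewrite /normal_fun subr0 sqr_sqrtr// mulNr.
by congr (_ * expR (- (_ / _))); rewrite -mulrnA.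
Qed.

Let mw : measurable_fun setT w. Proof. exact: measurable_normal_pdf. Qed.

Let int_w : mu.-integrable setT (EFin \o w).
Proof. exact: integrable_normal_pdf. Qed.

Let int_wx (h : R -> R) : measurable_fun setT h -> (forall x, `|h x| <= 1) ->
  mu.-integrable setT (fun x => (w x * x * h x)%:E).
Proof.
move=> mh h1; apply: (le_integrable measurableT _ _ int_quarter).
  apply/measurable_EFinP; apply: measurable_funM => //.
  by apply: measurable_funM.
move=> x _ /=; rewrite lee_fin [leRHS]ger0_norm ?mulr_ge0 ?expR_ge0//.
apply: le_trans (wxE x); rewrite normrM normrM (ger0_norm (normal_pdf_ge0 _ _ _)).
by rewrite ler_piMr// mulr_ge0// normal_pdf_ge0.
Qed.

Variable phi : R.

Let mcos t : measurable_fun setT (fun x : R => cos (t * x + phi)).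
Proof.
apply: continuous_measurable_fun => x; apply: continuous_comp.
  by apply: cvgD; [exact: mulrl_continuous|exact: cvg_cst].
exact: continuous_cos.
Qed.

Let msin t : measurable_fun setT (fun x : R => sin (t * x + phi)).
Proof.
apply: continuous_measurable_fun => x; apply: continuous_comp.
  by apply: cvgD; [exact: mulrl_continuous|exact: cvg_cst].
exact: continuous_sin.
Qed.

Let int_wb (h : R -> R) : measurable_fun setT h -> (forall x, `|h x| <= 1) ->
  mu.-integrable setT (fun x => (w x * h x)%:E).
Proof.
move=> mh h1; apply: (le_integrable measurableT _ _ int_w).
  by apply/measurable_EFinP; apply: measurable_funM.
move=> x _ /=; rewrite lee_fin normrM ler_piMr//.
Qed.

Let psi (t : R) : R := \int[mu]_x (w x * cos (t * x + phi)).

Let dw x : is_derive (x : R) 1 w (- x * w x).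
Proof.
rewrite (_ : w = fun x => normal_peak 1 * expR (- (x ^+ 2 / 2))); last exact/funext.
have d1 : is_derive x 1 (fun x : R => - (x ^+ 2 / 2)) (- x).
  by apply: is_derive_eq; rewrite /GRing.scale /=; field.
have d2 := is_derive1_comp (f := expR) (is_derive_expR _) d1.
have d3 : is_derive x 1 (fun x : R => normal_peak 1 * expR (- (x ^+ 2 / 2)))
   (normal_peak 1 *: (- x * expR (- (x ^+ 2 / 2)))).
  by apply: is_deriveZ; apply: is_derive_eq d2 _; rewrite mulrC.
by apply: is_derive_eq d3 _; rewrite /GRing.scale /=; ring.
Qed.

(** Differentiation under the integral sign gives
    psi' (t) = - E (N sin (t N + phi)), and N times the density is minus its
    derivative. *)
Let dpsi (t : R) : is_derive t 1 psi (- t * psi t).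
Proof.
pose f (s x : R) := w x * cos (s * x + phi).
have df (s x : R) : is_derive s 1 (f ^~ x) (- (w x * x * sin (s * x + phi))).
  have d1 : is_derive s 1 (fun s : R => s * x + phi) x.
    by apply: is_derive_eq; rewrite /GRing.scale /=; ring.
  have d2 := is_derive1_comp (f := cos) (is_derive_cos _) d1.
  have d3 := is_deriveZ (w x) d2.
  by apply: is_derive_eq d3 _; rewrite /GRing.scale /=; ring.
have pf (s x : R) : partial1of2 f s x = - (w x * x * sin (s * x + phi)).
  by rewrite partial1of2E derive_val.
have tI : `]t - 1, t + 1[%classic t.
  by rewrite /= in_itv /= gtrBl ltrDl ltr01.
have i1 s : `]t - 1, t + 1[%classic s -> mu.-integrable setT (EFin \o f s).
  by move=> _; apply: int_wb => // x; exact: cos_max.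
have i2 s x : `]t - 1, t + 1[%classic s -> setT x -> derivable (f ^~ x) s 1.
  by move=> _ _; exact: ex_derive.
have i3 x : 0 <= normal_peak 1 * expR (- (x ^+ 2 / 4)) :> R.
  by rewrite mulr_ge0 ?expR_ge0.
have i4 s x : `]t - 1, t + 1[%classic s -> setT x ->
    `|partial1of2 f s x| <= normal_peak 1 * expR (- (x ^+ 2 / 4)).
  move=> _ _; rewrite pf normrN !normrM (ger0_norm (normal_pdf_ge0 _ _ _)).
  by apply: le_trans (wxE x); rewrite ler_piMr ?sin_max// mulr_ge0// normal_pdf_ge0.
have D := @derivable_under_integral R _ _ mu f setT measurableT t _ _ tI i1 i2 _ i3 int_quarter i4.
have E := @differentiation_under_integral R _ _ mu f setT measurableT t _ _ tI i1 i2 _ i3 int_quarter i4.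
apply: DeriveDef => //; rewrite -derive1E E.
under eq_Rintegral do rewrite pf.
pose F (x : R) := w x * sin (t * x + phi).
have dF (x : R) : is_derive x 1 F (- (w x * x * sin (t * x + phi)) + t * (w x * cos (t * x + phi))).
  have d1 : is_derive x 1 (fun x : R => t * x + phi) t.
    by apply: is_derive_eq; rewrite /GRing.scale /=; ring.
  have d2 := is_derive1_comp (f := sin) (is_derive_sin _) d1.
  have d3 := is_deriveM (dw x) d2.
  by apply: is_derive_eq d3 _; rewrite /GRing.scale /=; ring.
have cw : continuous w by apply: continuous_normal_pdf; rewrite oner_eq0.
have ctx : continuous (fun x : R => t * x + phi).
  by move=> x; apply: cvgD; [exact: mulrl_continuous|exact: cvg_cst].
have csin : continuous (fun x : R => sin (t * x + phi)).
  by move=> x; apply: continuous_comp; [exact: ctx|exact: continuous_sin].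
have ccos : continuous (fun x : R => cos (t * x + phi)).
  by move=> x; apply: continuous_comp; [exact: ctx|exact: continuous_cos].
have I1 : mu.-integrable setT (EFin \o (fun x => - (w x * x * sin (t * x + phi)))).
  have := integrableN (int_wx (msin t) (fun x => sin_max _)).
  by congr (_.-integrable _ _); apply/funext => x /=; rewrite EFinN.
have I2 : mu.-integrable setT (EFin \o (fun x => t * (w x * cos (t * x + phi)))).
  exact: (integrableZl measurableT t (int_wb (mcos t) (fun x => cos_max _))).
have : \int[mu]_x (- (w x * x * sin (t * x + phi)) + t * (w x * cos (t * x + phi))) = 0.
  apply: (integral_derive_vanishing dF).
  - move=> x; apply: cvgD.
      apply: cvgN; apply: cvgM; last exact: csin.
      by apply: cvgM; [exact: cw|exact: cvg_id].
    by apply: cvgMl_tmp; apply: cvgM; [exact: cw|exact: ccos].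
  - exact: (integrableD measurableT I1 I2).
  - apply: norm_cvg0; apply: (@squeeze_cvgr _ _ _ _ (cst 0) (fun n : nat => (4 * normal_peak 1) * harmonic n)) => //.
    + apply: nearW => n; rewrite normr_ge0 andTb.
      have wn : w n%:R <= (2 * normal_peak 1) * harmonic n.
        rewrite /harmonic /= ler_pdivlMr ?ltr0Sn// -natr1 mulrDr mulr1.
        have h1 := normal_pdf_ub 0 n%:R (oner_neq0 R).
        have h2 := wxE n%:R; rewrite normr_nat in h2.
        have h3 : normal_peak 1 * expR (- (n%:R ^+ 2 / 4)) <= normal_peak 1 :> R.
          by rewrite ler_piMr// -[leRHS]expR0 ler_expR oppr_le0 mulr_ge0 ?sqr_ge0.
        lra.
      have wN (x : R) : w (- x) = w x by rewrite !wE sqrrN.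
      have Fw (x : R) : `|F x| <= w x.
        by rewrite normrM ger0_norm ?normal_pdf_ge0// ler_piMr ?normal_pdf_ge0// sin_max.
      apply: le_trans (ler_normB _ _) _.
      have := Fw n%:R; have := Fw (- n%:R); rewrite wN.
      set H := harmonic n in wn *; lra.
    + exact: cvg_cst.
    + by rewrite -(mulr0 (4 * normal_peak 1)); apply: cvgMl_tmp; exact: cvg_harmonic.
rewrite RintegralD// RintegralZl//; last by apply: int_wb => // x; exact: cos_max.
by move/eqP; rewrite addr_eq0 => /eqP ->; rewrite mulNr.
Qed.

(** The differential equation psi' (t) = - t psi (t) makes
    t |-> exp (t^2 / 2) psi (t) constant. *)
Lemma gaussian_cos t :
  \int[mu]_x (w x * cos (t * x + phi)) = expR (- (t ^+ 2 / 2)) * cos phi.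
Proof.
pose h (s : R) := expR (s ^+ 2 / 2) * psi s.
have dh (s : R) : is_derive s 1 h 0.
  have d1 : is_derive s 1 (fun x : R => x ^+ 2 / 2) s.
    by apply: is_derive_eq; rewrite /GRing.scale /=; field.
  have d2 := is_derive1_comp (f := expR) (is_derive_expR _) d1.
  have d3 := is_deriveM d2 (dpsi s).
  by apply: is_derive_eq d3 _; rewrite /GRing.scale /=; ring.
have := is_derive_0_is_cst t 0 dh.
rewrite /h expr0n /= mul0r expR0 mul1r => e.
have p0 : psi 0 = cos phi.
  rewrite /psi; under eq_Rintegral do rewrite mul0r add0r mulrC.
  rewrite RintegralZl//.
  by rewrite /Rintegral integral_normal_pdf mulr1.
by rewrite -/(psi t) expRN -p0 -e mulKf ?gt_eqF// expR_gt0.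
Qed.

End GaussianCharacteristic.

(** * Expectations of Lipschitz functions and the normal distribution function *)

Section StepApproximation.
Context {d : measure_display} {T : measurableType d} {R : realType}.
Variables (mu : {measure set T -> \bar R}) (h : T -> R) (Y : T -> R).
Hypotheses (h0 : forall t, 0 <= h t) (inth : mu.-integrable setT (EFin \o h))
  (h1 : \int[mu]_t h t = 1) (mY : measurable_fun setT Y).

Let mh : measurable_fun setT h.
Proof. by case/integrableP : inth => /measurable_EFinP. Qed.

Let int_bounded (f : T -> R) (M : R) : measurable_fun setT f ->
  (forall t, `|f t| <= M) -> mu.-integrable setT (EFin \o (fun t => f t * h t)).
Proof.
move=> mf fM.
apply: (le_integrable measurableT _ _ (integrableZl measurableT M inth)).
  by apply/measurable_EFinP; apply: measurable_funM.
move=> t _ /=; rewrite lee_fin !normrM (ger0_norm (h0 t)) ler_wpM2r//.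
exact: le_trans (fM t) (ler_norm _).
Qed.

Definition weighted_cdf (x : R) : R := \int[mu]_t ((Y t <= x)%R%:R * h t).

Let mle x : measurable_fun setT (fun t => (Y t <= x)%R%:R : R).
Proof.
rewrite (_ : (fun t => _) = \1_[set t | Y t <= x]).
  by apply: measurable_indic; exact: measurable_ler_set.
by apply/funext => t; rewrite indicE mem_setE.
Qed.

(** The value of g at the left end of the cell of the grid x that contains y. *)
Let step_fun (g : R -> R) (x : nat -> R) J y : R :=
  \sum_(j < J) g (x j) * ((y <= x j.+1)%R%:R - (y <= x j)%R%:R).

Let step_funP g x J y : (forall j, x j <= x j.+1) ->
  [/\ y <= x 0%N -> step_fun g x J y = 0, x J < y -> step_fun g x J y = 0 &
      x 0%N < y <= x J -> exists2 j, step_fun g x J y = g (x j) & x j < y <= x j.+1].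
Proof.
move=> xS.
have x0 j : x 0%N <= x j by elim: j => // j; move/le_trans; apply.
elim: J => [|J [IH1 IH2 IH3]].
  rewrite /step_fun big_ord0; split=> // /andP[]; by rewrite ltNge => /negbTE ->.
rewrite /step_fun big_ord_recr /= -/(step_fun g x J y); split.
- move=> yx; rewrite IH1// add0r (le_trans yx (x0 _)) (le_trans yx (x0 _)).
  by rewrite subrr mulr0.
- move=> xy; have xy' : x J < y by exact: le_lt_trans (xS J) xy.
  by rewrite IH2// !leNgt xy xy' /= subrr mulr0 addr0.
- move=> /andP[xy yx]; have [yJ|yJ] := leP y (x J).
    have [j e hj] := IH3 (introT andP (conj xy yJ)); exists j => //.
    by rewrite e yx subrr mulr0 addr0.
  by exists J; rewrite ?yJ// IH2// add0r yx subr0 mulr1.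
Qed.

(** The Riemann-Stieltjes sum of g against the distribution function
    approximates the expectation of g (Y). *)
Lemma step_approximation (g : R -> R) (L delta : R) (x : nat -> R) J :
  measurable_fun setT g -> (forall y, `|g y| <= 1) -> 0 <= L -> 0 <= delta ->
  (forall y z, `|g y - g z| <= L * `|y - z|) ->
  (forall j, x j <= x j.+1 <= x j + delta) ->
  `|\int[mu]_t (g (Y t) * h t)
    - \sum_(j < J) g (x j) * (weighted_cdf (x j.+1) - weighted_cdf (x j))|
  <= L * delta + 1 - weighted_cdf (x J) + weighted_cdf (x 0%N).
Proof.
move=> mg g1 L0 delta0 gL xSd.
have xS j : x j <= x j.+1 by have /andP[] := xSd j.
have cdf_int y : mu.-integrable setT (EFin \o (fun t => (Y t <= y)%R%:R * h t)).
  by apply: (int_bounded (M := 1)) => // t; case: (Y t <= y); rewrite ?normr1 ?normr0.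
have mgY : measurable_fun setT (g \o Y) by exact: measurableT_comp.
have mstep : measurable_fun setT (fun t => step_fun g x J (Y t)).
  by apply: measurable_sum => j; apply: measurable_funM => //; exact: measurable_funB.
have dist y : `|g y - step_fun g x J y| <= L * delta + 1 - (y <= x J)%R%:R + (y <= x 0%N)%R%:R.
  have [s1 s2 s3] := step_funP g J y xS.
  have Ld : 0 <= L * delta by rewrite mulr_ge0.
  have x0J : x 0%N <= x J by elim: (J) => // j /le_trans; apply.
  have [y0|y0] := leP y (x 0%N).
    by rewrite s1// subr0 (le_trans y0 x0J) /=; have := g1 y; lra.
  have [yJ|yJ] := leP y (x J); last by rewrite s2// subr0 /=; have := g1 y; lra.
  rewrite /= addr0 addrK; have [|j -> /andP[h2 h3]] := s3; first by rewrite y0.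
  apply: le_trans (gL _ _) _; rewrite ler_wpM2l// ger0_norm; last by rewrite subr_ge0 ltW.
  rewrite lerBlDl; apply: le_trans h3 _.
  by have /andP[] := xSd j.
have step_le y : `|step_fun g x J y| <= L * delta + 3.
  have -> : step_fun g x J y = g y - (g y - step_fun g x J y) by rewrite subKr.
  apply: le_trans (ler_normB _ _) _; have := dist y; have := g1 y.
  by case: (y <= x J); case: (y <= x 0%N) => /=; lra.
have intstep := int_bounded mstep (fun t => step_le (Y t)).
have intg := int_bounded mgY (fun t => g1 (Y t)).
have Estep : \int[mu]_t (step_fun g x J (Y t) * h t) =
    \sum_(j < J) g (x j) * (weighted_cdf (x j.+1) - weighted_cdf (x j)).
  have E (s : seq 'I_J) : \int[mu]_t
      ((\sum_(j <- s) g (x j) * ((Y t <= x j.+1)%R%:R - (Y t <= x j)%R%:R)) * h t)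
      = \sum_(j <- s) g (x j) * (weighted_cdf (x j.+1) - weighted_cdf (x j)).
    elim: s => [|j s IH].
      under eq_Rintegral do rewrite big_nil mul0r.
      by rewrite big_nil Rintegral_cst// mul0r.
    rewrite big_cons -IH /weighted_cdf -RintegralB// -RintegralZl//; last first.
      have := integrableB measurableT (cdf_int (x j.+1)) (cdf_int (x j)).
      by congr (_.-integrable _ _); apply/funext.
    rewrite -RintegralD//.
    - by apply: eq_Rintegral => t _; rewrite big_cons; ring.
    - have := integrableZl measurableT (g (x j)) (integrableB measurableT (cdf_int (x j.+1)) (cdf_int (x j))).
      by congr (_.-integrable _ _); apply/funext.
    - apply: (int_bounded (M := \sum_(j <- s) `|g (x j)|)).
        by apply: measurable_sum => i; apply: measurable_funM => //; exact: measurable_funB.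
      move=> t; apply: le_trans (ler_norm_sum _ _ _) _; apply: ler_sum => i _.
      rewrite normrM ler_piMr//.
      by case: (Y t <= x i.+1); case: (Y t <= x i); rewrite /= ?subrr ?subr0 ?sub0r ?normrN ?normr0 ?normr1.
  exact: E.
rewrite -Estep -RintegralB//.
under eq_Rintegral do rewrite -mulrBl.
apply: le_trans (le_normr_Rintegral _ _) _ => //.
  have := integrableB measurableT intg intstep.
  by congr (_.-integrable _ _); apply/funext => t /=; rewrite -EFinB -mulrBl.
have intc : mu.-integrable setT (EFin \o (fun t => (L * delta + 1) * h t)).
  exact: (integrableZl measurableT (L * delta + 1) inth).
have -> : L * delta + 1 - weighted_cdf (x J) + weighted_cdf (x 0%N) =
  \int[mu]_t ((L * delta + 1 - (Y t <= x J)%R%:R + (Y t <= x 0%N)%R%:R) * h t).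
  under eq_Rintegral do rewrite mulrDl mulrBl.
  rewrite RintegralD// ?RintegralB// ?RintegralZl// ?h1 ?mulr1//.
  have := integrableB measurableT intc (cdf_int (x J)).
  by congr (_.-integrable _ _); apply/funext.
apply: le_Rintegral => //.
- have := integrable_abse (integrableB measurableT intg intstep).
  by congr (_.-integrable _ _); apply/funext => t /=; rewrite -mulrBl.
- have := integrableD measurableT (integrableB measurableT intc (cdf_int (x J))) (cdf_int (x 0%N)).
  by congr (_.-integrable _ _); apply/funext => t /=; rewrite -EFinB -EFinD; congr EFin; ring.
- by move=> t _; rewrite normrM (ger0_norm (h0 t)) ler_wpM2r.
Qed.

End StepApproximation.

Section BoundedMeasurable.
Context {d : measure_display} {T : measurableType d} {R : realType}.

Definition bounded_measurable (f : T -> R) : Prop :=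
  measurable_fun setT f /\ exists M, forall t, `|f t| <= M.

Lemma bm_cst c : bounded_measurable (cst c).
Proof. by split; [exact: measurable_cst|exists `|c|]. Qed.

Lemma bmD f g : bounded_measurable f -> bounded_measurable g ->
  bounded_measurable (fun t => f t + g t).
Proof.
move=> [mf [M fM]] [mg [N gN]]; split; first exact: measurable_funD.
by exists (M + N) => t; apply: le_trans (ler_normD _ _) (lerD (fM t) (gN t)).
Qed.

Lemma bmM f g : bounded_measurable f -> bounded_measurable g ->
  bounded_measurable (fun t => f t * g t).
Proof.
move=> [mf [M fM]] [mg [N gN]]; split; first exact: measurable_funM.
by exists (M * N) => t; rewrite normrM ler_pM.
Qed.

Lemma bmZ c f : bounded_measurable f -> bounded_measurable (fun t => c * f t).
Proof. by move=> bf; apply: bmM => //; exact: bm_cst. Qed.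

Lemma bmB f g : bounded_measurable f -> bounded_measurable g ->
  bounded_measurable (fun t => f t - g t).
Proof.
move=> bf bg; rewrite (_ : (fun t => _) = (fun t => f t + -1 * g t)).
  by apply: bmD => //; exact: bmZ.
by apply/funext => t; rewrite mulN1r.
Qed.

Lemma bm_prod (I : eqType) (s : seq I) (F : I -> T -> R) :
  (forall i, bounded_measurable (F i)) -> bounded_measurable (fun t => \prod_(i <- s) F i t).
Proof.
move=> h; elim: s => [|i s IH].
  by rewrite (_ : (fun t => _) = cst 1); [exact: bm_cst|apply/funext => t; rewrite big_nil].
rewrite (_ : (fun t => _) = (fun t => F i t * \prod_(j <- s) F j t)); first exact: bmM.
by apply/funext => t; rewrite big_cons.
Qed.

Lemma bm_sum (I : Type) (s : seq I) (F : I -> T -> R) :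
  (forall i, bounded_measurable (F i)) -> bounded_measurable (fun t => \sum_(i <- s) F i t).
Proof.
move=> h; elim: s => [|i s IH].
  by rewrite (_ : (fun t => _) = cst 0); [exact: bm_cst|apply/funext => t; rewrite big_nil].
rewrite (_ : (fun t => _) = (fun t => F i t + \sum_(j <- s) F j t)); first exact: bmD.
by apply/funext => t; rewrite big_cons.
Qed.

Lemma bm_le (Y : T -> R) x : measurable_fun setT Y ->
  bounded_measurable (fun t => (Y t <= x)%R%:R).
Proof.
move=> mY; split; last by exists 1 => t; case: (Y t <= x); rewrite ?normr1 ?normr0.
rewrite (_ : (fun t => _) = \1_[set t | Y t <= x]).
  by apply: measurable_indic; exact: measurable_ler_set.
by apply/funext => t; rewrite indicE mem_setE.
Qed.

Variables (mu : {measure set T -> \bar R}) (h : T -> R).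
Hypotheses (h0 : forall t, 0 <= h t) (inth : mu.-integrable setT (EFin \o h))
  (h1 : \int[mu]_t h t = 1).

(** Used with mu = P and h = 1, and with the Lebesgue measure and the density of
    N(0, 1), so that one theory serves both expectations. *)
Definition weighted_mean (f : T -> R) : R := \int[mu]_t (f t * h t).

Lemma bm_integrable f : bounded_measurable f ->
  mu.-integrable setT (EFin \o (fun t => f t * h t)).
Proof.
move=> [mf [M fM]].
have mh : measurable_fun setT h by case/integrableP : inth => /measurable_EFinP.
apply: (le_integrable measurableT _ _ (integrableZl measurableT M inth)).
  by apply/measurable_EFinP; apply: measurable_funM.
move=> t _ /=; rewrite lee_fin !normrM (ger0_norm (h0 t)) ler_wpM2r//.
exact: le_trans (fM t) (ler_norm _).
Qed.

Lemma mean_cst c : weighted_mean (cst c) = c.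
Proof. by rewrite /weighted_mean RintegralZl// h1 mulr1. Qed.

Lemma meanZ c f : bounded_measurable f -> weighted_mean (fun t => c * f t) = c * weighted_mean f.
Proof.
move=> bf; rewrite /weighted_mean -RintegralZl//; last exact: bm_integrable.
by apply: eq_Rintegral => t _; rewrite mulrA.
Qed.

Lemma meanD f g : bounded_measurable f -> bounded_measurable g ->
  weighted_mean (fun t => f t + g t) = weighted_mean f + weighted_mean g.
Proof.
move=> bf bg; rewrite /weighted_mean -RintegralD//; [|exact: bm_integrable..].
by apply: eq_Rintegral => t _; rewrite mulrDl.
Qed.

Lemma meanB f g : bounded_measurable f -> bounded_measurable g ->
  weighted_mean (fun t => f t - g t) = weighted_mean f - weighted_mean g.
Proof.
move=> bf bg; rewrite /weighted_mean -RintegralB//; [|exact: bm_integrable..].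
by apply: eq_Rintegral => t _; rewrite mulrBl.
Qed.

Lemma mean_sum (I : Type) (s : seq I) (F : I -> T -> R) :
  (forall i, bounded_measurable (F i)) ->
  weighted_mean (fun t => \sum_(i <- s) F i t) = \sum_(i <- s) weighted_mean (F i).
Proof.
move=> bF; elim: s => [|i s IH].
  rewrite big_nil -[RHS](mean_cst 0); congr weighted_mean.
  by apply/funext => t; rewrite big_nil.
rewrite big_cons -IH -meanD//; last exact: bm_sum.
by congr weighted_mean; apply/funext => t; rewrite big_cons.
Qed.

Lemma le_mean f g : bounded_measurable f -> bounded_measurable g ->
  (forall t, f t <= g t) -> weighted_mean f <= weighted_mean g.
Proof.
move=> bf bg fg; apply: le_Rintegral => //; [exact: bm_integrable..|].
by move=> t _; rewrite ler_wpM2r.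
Qed.

End BoundedMeasurable.

Section NormalCdf.
Context {R : realType}.
Local Notation mu := (@lebesgue_measure R).
Local Notation w := (@normal_pdf R 0 1).

Definition Phi (x : R) : R := fine (normal_prob 0%R 1%R `]-oo, x]%classic : \bar R).

Lemma PhiE x : (normal_prob 0%R 1%R `]-oo, x]%classic = (Phi x)%:E :> \bar R)%E.
Proof. by rewrite fineK// fin_num_measure. Qed.

Lemma Phi_ge0 x : 0 <= Phi x. Proof. by rewrite fine_ge0. Qed.

Lemma Phi_le1 x : Phi x <= 1.
Proof. by rewrite -lee_fin -PhiE probability_le1. Qed.

Lemma pdf_ge0 x : 0 <= w x. Proof. exact: normal_pdf_ge0. Qed.

Lemma pdf_integrable : mu.-integrable setT (EFin \o w).
Proof. exact: integrable_normal_pdf. Qed.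

Lemma pdf_integral1 : \int[mu]_x w x = 1.
Proof. by rewrite /Rintegral integral_normal_pdf. Qed.

Lemma weighted_cdf_Phi x : weighted_cdf mu w id x = Phi x.
Proof.
rewrite /weighted_cdf /Phi /normal_prob /Rintegral; congr fine.
rewrite [RHS]integral_mkcond; apply: eq_integral => y _.
rewrite patchE mem_setE in_itv /=.
by case: (y <= x); rewrite ?mul1r ?mul0r.
Qed.

Lemma Phi_lipschitz x y : x <= y -> 0 <= Phi y - Phi x <= normal_peak 1 * (y - x).
Proof.
move=> xy.
have E : Phi y - Phi x = fine (normal_prob 0%R 1%R `]x, y]%classic : \bar R).
  apply: EFin_inj; rewrite EFinB -(PhiE y) -(PhiE x) fineK; last exact: fin_num_measure.
  have -> : (`]-oo, y] = `]-oo, x] `|` `]x, y] :> set R)%classic.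
    by rewrite -itv_bndbnd_setU// bnd_simp.
  rewrite measureU//; last first.
    apply/seteqP; split=> z //= [] /=; rewrite !in_itv /= => zx /andP[xz _].
    by move: (lt_le_trans xz zx); rewrite ltxx.
  by rewrite addeAC subee ?add0e// fin_num_measure.
rewrite E fine_ge0//= -lee_fin fineK ?fin_num_measure//.
have -> : ((normal_peak 1 * (y - x))%:E = \int[mu]_(z in `]x, y]) (normal_peak 1)%:E :> \bar R)%E.
  rewrite integral_cst//= lebesgue_measure_itv /= lte_fin.
  have [_|yx] := ltP x y; first by rewrite -EFinB -EFinM.
  by rewrite mule0 (le_anti (introT andP (conj xy yx))) subrr mulr0.
rewrite /normal_prob; apply: ge0_le_integral => //.
- by move=> z _; rewrite lee_fin normal_pdf_ge0.
- by apply/measurable_EFinP/measurable_funTS; exact: measurable_normal_pdf.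
- by move=> z _; rewrite lee_fin normal_pdf_ub// oner_eq0.
Qed.

Lemma Phi_tail (eps : R) : 0 < eps -> exists2 K, 0 < K & 1 - Phi K + Phi (- K) <= eps.
Proof.
move=> e0; have e2 : 0 < eps / 2 by rewrite divr_gt0.
pose id' : measurableTypeR R -> R := idfun.
have mid : measurable_fun setT id' by exact: measurable_id.
pose X : {mfun measurableTypeR R >-> R} := HB.pack id' (isMeasurableFun.Build _ _ _ _ _ mid).
have XE : Phi = fine \o cdf (X : {RV (normal_prob 0%R 1%R : probability _ R) >-> R}) by [].
have cy : Phi x @[x --> +oo] --> (1 : R) by rewrite XE; apply: fine_cvg; exact: cvg_cdfy1.
have cN : Phi x @[x --> -oo] --> (0 : R) by rewrite XE; apply: fine_cvg; exact: cvg_cdfNy0.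
have /cvgrPdist_le/(_ _ e2)[M1 [_ h1]] := cy.
have /cvgrPdist_le/(_ _ e2)[M2 [_ h2]] := cN.
pose K := `|M1| + `|M2| + 1.
have K1 : M1 < K by rewrite /K; have := ler_norm M1; have := normr_ge0 M2; lra.
have K2 : - K < M2.
  by rewrite /K; have := lerNnormlW (lexx `|M2|); have := normr_ge0 M1; lra.
exists K; first by rewrite /K ltr_wpDl// addr_ge0.
have {}h1 := h1 _ K1; have {}h2 := h2 _ K2.
have := le_trans (ler_norm _) h1.
have := le_trans (ler_norm _) h2.
rewrite sub0r; have := Phi_ge0 (- K); move: h2; rewrite /= sub0r normrN.
move=> /(le_trans (ler_norm _)); lra.
Qed.

End NormalCdf.

(** * The Cramer-Wold theorem with a normal limit *)

Section CramerWold.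
Context {d : measure_display} {T : measurableType d} {R : realType}.
Variable P : probability T R.
Local Notation mu := (@lebesgue_measure R).
Local Notation w := (@normal_pdf R 0 1).

Lemma cos_lipschitz (u v : R) : `|cos u - cos v| <= `|u - v|.
Proof.
wlog uv : u v / u <= v => [hw|].
  have [/hw//|/ltW/hw] := leP u v.
  by rewrite distrC [leRHS]distrC.
rewrite distrC [leRHS]distrC.
have [c _ ->] : exists2 c, c \in `[u, v]%R & cos v - cos u = - sin c * (v - u).
  apply: (@MVT_segment _ _ (fun x => - sin x)) => //.
  by apply: continuous_subspaceT => x; exact: continuous_cos.
by rewrite normrM normrN ler_piMl// sin_max.
Qed.

Let int1 : P.-integrable setT (EFin \o cst (1 : R)).
Proof. exact: finite_measure_integrable_cst. Qed.

Let mean1 : \int[P]_t (cst 1 t) = 1 :> R.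
Proof. by rewrite /Rintegral /= integral_cst//= probability_setT mule1. Qed.

Definition Ex (f : T -> R) : R := weighted_mean P (cst 1) f.
Definition EN (f : R -> R) : R := weighted_mean mu w f.

Let c1_ge0 (t : T) : 0 <= cst 1 t :> R. Proof. by []. Qed.

Lemma Ex_le_event (Y : T -> R) x : measurable_fun setT Y ->
  Ex (fun t => (Y t <= x)%R%:R) = prob P [set t | Y t <= x].
Proof.
move=> mY; rewrite /Ex /weighted_mean.
under eq_Rintegral do rewrite mulr1.
rewrite /prob /Rintegral; congr fine.
rewrite -[X in _ = P X]setIT -integral_indic//; last exact: measurable_ler_set.
by apply: eq_integral => t _; rewrite indicE mem_setE.
Qed.

(** A cosine is bounded and Lipschitz, so its expectation is, up to a small
    error, a fixed finite combination of values of the distribution function. *)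
Lemma cvg_cos (Y : nat -> T -> R) (a phi : R) :
  (forall n, measurable_fun setT (Y n)) ->
  (forall x, prob P [set t | Y n t <= x] @[n --> \oo] --> Phi x) ->
  Ex (fun t => cos (a * Y n t + phi)) @[n --> \oo] --> expR (- (a ^+ 2 / 2)) * cos phi.
Proof.
move=> mY cY.
pose g (y : R) := cos (a * y + phi).
have mg : measurable_fun setT g.
  apply: continuous_measurable_fun => x; apply: continuous_comp.
    by apply: cvgD; [exact: mulrl_continuous|exact: cvg_cst].
  exact: continuous_cos.
have g1 y : `|g y| <= 1 by exact: cos_max.
have gL y z : `|g y - g z| <= `|a| * `|y - z|.
  by apply: le_trans (cos_lipschitz _ _) _; rewrite -normrM mulrBr opprD addrACA subrr addr0.
have tgt : EN g = expR (- (a ^+ 2 / 2)) * cos phi.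
  by rewrite -gaussian_cos; apply: eq_Rintegral => y _; rewrite mulrC.
rewrite -tgt; apply/cvgrPdist_lt => eps e0.
have e8 : 0 < eps / 8 by rewrite divr_gt0.
have [K K0 tailK] := @Phi_tail R _ e8.
(* A grid of J cells of length delta on [-K, K], with |a| delta <= eps / 8. *)
pose J := (Num.truncn (`|a| * (2 * K) / (eps / 8))).+1.
have J0 : 0 < J%:R :> R by rewrite ltr0n.
pose delta := 2 * K / J%:R.
have d0 : 0 <= delta by rewrite divr_ge0// mulr_ge0// ltW.
have ad : `|a| * delta <= eps / 8.
  rewrite /delta mulrA ler_pdivrMr// -ler_pdivrMl// [leLHS]mulrC.
  by apply: ltW; exact: truncnS_gt.
pose x (j : nat) := - K + j%:R * delta.
have xS j : x j <= x j.+1 <= x j + delta.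
  rewrite /x -natr1 mulrDl mul1r addrA lexx andbT lerDl.
  exact: d0.
have xJ : x J = K by rewrite /x /delta mulrC divfK ?gt_eqF//; ring.
have x0 : x 0%N = - K by rewrite /x mul0r addr0.
pose SP n := \sum_(j < J) g (x j) * (prob P [set t | Y n t <= x j.+1] - prob P [set t | Y n t <= x j]).
pose SN := \sum_(j < J) g (x j) * (Phi (x j.+1) - Phi (x j)).
have cS : SP n @[n --> \oo] --> SN.
  by apply: cvg_sumr => j _; apply: cvgMl_tmp; apply: cvgB; exact: cY.
have hN : `|EN g - SN| <= `|a| * delta + 1 - Phi K + Phi (- K).
  have := @step_approximation _ _ R mu w id (@pdf_ge0 R) (@pdf_integrable R) (@pdf_integral1 R)
    (@measurable_id _ _ setT) g `|a| delta x J mg g1 (normr_ge0 _) d0 gL xS.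
  under eq_bigr do rewrite !weighted_cdf_Phi.
  by rewrite !weighted_cdf_Phi xJ x0.
have hP n : `|Ex (g \o Y n) - SP n| <= `|a| * delta + 1 -
    prob P [set t | Y n t <= K] + prob P [set t | Y n t <= - K].
  have := @step_approximation _ _ R P (cst 1) (Y n) c1_ge0 int1 mean1
    (mY n) g `|a| delta x J mg g1 (normr_ge0 _) d0 gL xS.
  have E y : weighted_cdf P (cst 1) (Y n) y = prob P [set t | Y n t <= y].
    by rewrite -Ex_le_event.
  under eq_bigr do rewrite !E.
  by rewrite !E xJ x0.
have /cvgrPdist_lt/(_ _ e8) cK := cY K.
have /cvgrPdist_lt/(_ _ e8) cNK := cY (- K).
move/cvgrPdist_lt/(_ _ e8) : cS => cS'.
near=> n.
have h1 : `|Phi K - prob P [set t | Y n t <= K]| < eps / 8 by near: n.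
have h2 : `|Phi (- K) - prob P [set t | Y n t <= - K]| < eps / 8 by near: n.
have h3 : `|SN - SP n| < eps / 8 by near: n.
have h4 := hP n.
have -> : EN g - Ex (g \o Y n) = (EN g - SN) + (SN - SP n) - (Ex (g \o Y n) - SP n) by ring.
apply: le_lt_trans (ler_normB _ _) _.
apply: le_lt_trans (lerD (ler_normD _ _) (lexx _)) _.
move: h1 h2; rewrite !ltr_norml => /andP[? ?] /andP[? ?].
lra.
Unshelve. all: by end_near. Qed.

Lemma cosM (u v : R) : cos u * cos v = 2^-1 * cos (u + v) + 2^-1 * cos (u - v).
Proof. by rewrite cosD cosB; field. Qed.

(** Trigonometric polynomials, presented as a span of phase-shifted cosines. *)
Inductive trig : (R -> R) -> Prop :=
| trig_cos a phi : trig (fun x => cos (a * x + phi))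
| trig_add f g : trig f -> trig g -> trig (fun x => f x + g x)
| trig_scale c f : trig f -> trig (fun x => c * f x).

Lemma trig_eq f g : f =1 g -> trig f -> trig g.
Proof. by move=> /funext ->. Qed.

Lemma trig_cst c : trig (fun=> c).
Proof.
apply: trig_eq (trig_scale c (trig_cos 0 0)) => x.
by rewrite mul0r addr0 cos0 mulr1.
Qed.

Lemma trig_mul f g : trig f -> trig g -> trig (fun x => f x * g x).
Proof.
elim=> [a phi|f1 f2 _ IH1 _ IH2|c f1 _ IH1] tg; last 2 first.
- by apply: trig_eq (trig_add (IH1 tg) (IH2 tg)) => x; rewrite mulrDl.
- by apply: trig_eq (trig_scale c (IH1 tg)) => x; rewrite mulrA.
elim: tg => [b psi|g1 g2 _ IH1 _ IH2|c g1 _ IH1]; last 2 first.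
- by apply: trig_eq (trig_add IH1 IH2) => x; rewrite mulrDr.
- by apply: trig_eq (trig_scale c IH1) => x; rewrite mulrCA.
apply: trig_eq (trig_add (trig_scale 2^-1 (trig_cos (a + b) (phi + psi)))
   (trig_scale 2^-1 (trig_cos (a - b) (phi - psi)))) => x.
by rewrite cosM; congr (_ * cos _ + _ * cos _); ring.
Qed.

Lemma trig_exp n f : trig f -> trig (fun x => f x ^+ n).
Proof.
move=> tf; elim: n => [|n IH]; first by apply: trig_eq (trig_cst 1) => x; rewrite expr0.
by apply: trig_eq (trig_mul tf IH) => x; rewrite exprS.
Qed.

Lemma trig_bm f : trig f -> bounded_measurable f.
Proof.
elim=> [a phi|f1 f2 _ IH1 _ IH2|c f1 _ IH1]; last 2 first.
- exact: bmD.
- exact: bmZ.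
split; last by exists 1 => x; exact: cos_max.
apply: continuous_measurable_fun => x; apply: continuous_comp.
  by apply: cvgD; [exact: mulrl_continuous|exact: cvg_cst].
exact: continuous_cos.
Qed.

Let bm_comp (f : R -> R) (Y : T -> R) : measurable_fun setT Y ->
  bounded_measurable f -> bounded_measurable (fun t => f (Y t)).
Proof.
move=> mY [mf [M fM]]; split; first exact: measurableT_comp.
by exists M => t.
Qed.

Let ExD f g : bounded_measurable f -> bounded_measurable g ->
  Ex (fun t => f t + g t) = Ex f + Ex g.
Proof. by move=> bf bg; rewrite /Ex (meanD c1_ge0 int1). Qed.

Let ExZ c f : bounded_measurable f -> Ex (fun t => c * f t) = c * Ex f.
Proof. by move=> bf; rewrite /Ex (meanZ c1_ge0 int1). Qed.

Let bmR (f : R -> R) : bounded_measurable f ->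
  bounded_measurable (T := measurableTypeR R) f.
Proof. by case. Qed.

Let END (f g : R -> R) : bounded_measurable f -> bounded_measurable g ->
  EN (fun t => f t + g t) = EN f + EN g.
Proof.
move=> /bmR bf /bmR bg.
exact: (meanD (T := measurableTypeR R) (h := w) (@pdf_ge0 R) (@pdf_integrable R) bf bg).
Qed.

Let ENZ c (f : R -> R) : bounded_measurable f -> EN (fun t => c * f t) = c * EN f.
Proof. move=> /bmR bf; exact: (meanZ (T := measurableTypeR R) (h := w) (@pdf_ge0 R) (@pdf_integrable R) c bf). Qed.

Let EN_cos a phi : EN (fun x => cos (a * x + phi)) = expR (- (a ^+ 2 / 2)) * cos phi.
Proof. by rewrite -gaussian_cos; apply: eq_Rintegral => y _; rewrite mulrC. Qed.

Lemma sin_le_pihalf (y z : R) : - (pi / 2) <= y <= pi / 2 ->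
  - (pi / 2) <= z <= pi / 2 -> y <= z -> sin y <= sin z.
Proof.
move=> /andP[y1 y2] /andP[z1 z2] yz.
pose A := (z + y) / 2; pose B := (z - y) / 2.
have -> : z = A + B by rewrite /A /B; field.
have -> : y = A - B by rewrite /A /B; field.
rewrite -subr_ge0 sinD sinB.
have cA : 0 <= cos A by apply: cos_ge0_pihalf; rewrite /A; lra.
have sB : 0 <= sin B by apply: sin_ge0_pi; rewrite /B; lra.
have : 0 <= cos A * sin B by rewrite mulr_ge0.
lra.
Qed.

Lemma bernoulli_ge (y : R) n : 0 <= y <= 1 -> 1 - n%:R * y <= (1 - y) ^+ n.
Proof.
move=> /andP[y0 y1]; elim: n => [|n IH]; first by rewrite mul0r subr0 expr0.
rewrite exprS -natr1; have n0 : 0 <= n%:R :> R by [].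
have h : 0 <= (1 - y) ^+ n by rewrite exprn_ge0// subr_ge0.
have := ler_wpM2l (_ : 0 <= 1 - y) IH; rewrite subr_ge0 => /(_ y1); nra.
Qed.

Lemma bernoulli_le (y : R) n : 0 <= y <= 1 -> (1 - y) ^+ n * (1 + n%:R * y) <= 1.
Proof.
move=> /andP[y0 y1]; elim: n => [|n IH]; first by rewrite mul0r addr0 expr0 mulr1.
rewrite exprS -natr1; have n0 : 0 <= n%:R :> R by [].
have h : 0 <= (1 - y) ^+ n by rewrite exprn_ge0// subr_ge0.
apply: le_trans IH; rewrite -mulrA mulrCA ler_wpM2l//.
have : 0 <= n%:R * y by rewrite mulr_ge0. have : 0 <= n%:R * y * y by rewrite !mulr_ge0.
nra.
Qed.

Lemma one_plus_exp_ge (s : R) n : 0 <= s -> 1 + n%:R * s <= (1 + s) ^+ n.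
Proof.
move=> s0; elim: n => [|n IH]; first by rewrite mul0r addr0 expr0.
rewrite exprS -natr1; have n0 : 0 <= n%:R * s :> R by rewrite mulr_ge0.
have := ler_wpM2l (_ : 0 <= 1 + s) IH; rewrite addr_ge0// => /(_ isT); nra.
Qed.

(** A trigonometric polynomial with values in [0, 1], close to the indicator
    of ]-oo, a] on [-K, K] away from a. With v = (1 + sin (om (a - x))) / 2, the
    point a corresponds to v = 1/2, and v |-> 1 - (1 - v^N)^(2^N) is close to 0
    below 1/2 and to 1 above 1/2 by Bernoulli's inequality. *)
Lemma trig_indicator (a K delta eps : R) : 0 < K -> 0 < delta -> 0 < eps ->
  exists q, [/\ trig q, forall x, 0 <= q x <= 1,
    forall x, `|x| <= K -> x <= a - delta -> 1 - eps <= q x &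
    forall x, `|x| <= K -> a + delta <= x -> q x <= eps].
Proof.
move=> K0 d0 e0.
pose om := (pi / 2) / (K + `|a| + 1) : R.
have D0 : 0 < K + `|a| + 1 by rewrite ltr_wpDl// addr_ge0// ltW.
have om0 : 0 < om by rewrite !divr_gt0// pi_gt0.
pose dl := Num.min delta 1.
have dl0 : 0 < dl by rewrite lt_min d0 ltr01.
have dl1 : dl <= 1 by rewrite ge_min lexx orbT.
have dld : dl <= delta by rewrite ge_min lexx.
have omD (u : R) : `|u| <= K + `|a| -> - (pi / 2) <= om * u <= pi / 2.
  move=> hu; rewrite -ler_norml normrM (gtr0_norm om0) /om.
  rewrite mulrAC ler_pdivrMr// ler_wpM2l//; last by apply: le_trans hu _; rewrite lerDl.
  by rewrite divr_ge0// pi_ge0.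
have omdl : - (pi / 2) <= om * dl <= pi / 2.
  rewrite -ler_norml normrM !gtr0_norm// /om mulrAC ler_pdivrMr// ler_wpM2l//.
    by rewrite divr_ge0// pi_ge0.
  by apply: le_trans dl1 _; rewrite lerDr addr_ge0// ltW.
pose s := sin (om * dl).
have s0 : 0 < s.
  apply: sin_gt0_pi; rewrite mulr_gt0//=.
  have /andP[_ h] := omdl; apply: le_lt_trans h _.
  by rewrite ltr_pdivrMr// ltr_pMr ?pi_gt0// ltr1n.
have s1 : s <= 1 by exact: sin_le1.
pose v x := 2^-1 + 2^-1 * cos (om * x + (pi / 2 - om * a)).
have vE x : v x = (1 + sin (om * (a - x))) / 2.
  rewrite /v.
  have -> : om * x + (pi / 2 - om * a) = - (om * (a - x)) + pi / 2 by ring.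
  by rewrite cosDpihalf sinN opprK; field.
have v01 x : 0 <= v x <= 1.
  by rewrite vE; have := sin_le1 (om * (a - x)); have := sin_geN1 (om * (a - x)); lra.
pose N := (Num.truncn (s^-1 / eps)).+1.
have hN : (1 + s) ^+ N >= eps^-1.
  apply: le_trans (one_plus_exp_ge N (ltW s0)); rewrite ler_wpDl//.
  rewrite -ler_pdivrMr// mulrC; apply: ltW.
  exact: truncnS_gt.
have Npos : 0 < (1 + s) ^+ N by rewrite exprn_gt0// addr_gt0.
have trv : trig v.
  exact: (trig_add (trig_cst 2^-1) (trig_scale 2^-1 (trig_cos om (pi / 2 - om * a)))).
pose q x := 1 + -1 * (1 + -1 * v x ^+ N) ^+ (2 ^ N).
have trq : trig q.
  apply: trig_add; first exact: trig_cst.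
  apply: trig_scale; apply: trig_exp; apply: trig_add; first exact: trig_cst.
  by apply: trig_scale; exact: trig_exp.
have vN01 x : 0 <= v x ^+ N <= 1.
  by have /andP[h1 h2] := v01 x; rewrite exprn_ge0//= exprn_ile1.
have qE x : q x = 1 - (1 - v x ^+ N) ^+ (2 ^ N) by rewrite /q !mulN1r.
exists q; split=> //.
- move=> x; rewrite qE; have /andP[h1 h2] := vN01 x.
  have : 0 <= (1 - v x ^+ N) ^+ (2 ^ N) <= 1.
    by rewrite exprn_ge0 ?subr_ge0//= exprn_ile1 ?subr_ge0// gerBl.
  lra.
- move=> x xK xa; rewrite qE lerD2l lerN2.
  have ux : - (pi / 2) <= om * (a - x) <= pi / 2.
    by apply: omD; rewrite [leRHS]addrC; apply: le_trans (ler_normB _ _) _; rewrite lerD2l.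
  have sx : s <= sin (om * (a - x)).
    apply: sin_le_pihalf => //; rewrite ler_wpM2l ?(ltW om0)//.
    apply: le_trans dld _; lra.
  have vx : (1 + s) ^+ N <= (2 ^ N)%:R * v x ^+ N.
    rewrite natrX -exprMn lerXn2r ?nnegrE ?addr_ge0 ?(ltW s0)//.
      by rewrite mulr_ge0//; case/andP : (v01 x).
    by rewrite vE; lra.
  have h := bernoulli_le (2 ^ N) (vN01 x).
  have p1 : 0 <= (1 - v x ^+ N) ^+ (2 ^ N).
    by rewrite exprn_ge0// subr_ge0; case/andP : (vN01 x).
  have : (1 - v x ^+ N) ^+ (2 ^ N) * eps^-1 <= 1.
    apply: le_trans h; apply: ler_wpM2l => //.
    by apply: le_trans hN _; apply: le_trans vx _; rewrite lerDr.
  by rewrite ler_pdivrMr// mul1r.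
- move=> x xK ax; rewrite qE.
  have ux : - (pi / 2) <= om * (x - a) <= pi / 2.
    by apply: omD; apply: le_trans (ler_normB _ _) _; rewrite lerD2r.
  have sx : sin (om * (a - x)) <= - s.
    have -> : om * (a - x) = - (om * (x - a)) by ring.
    rewrite sinN lerN2; apply: sin_le_pihalf => //; rewrite ler_wpM2l ?(ltW om0)//.
    apply: le_trans dld _; lra.
  have vx : (2 ^ N)%:R * v x ^+ N <= (1 - s) ^+ N.
    rewrite natrX -exprMn lerXn2r ?nnegrE ?subr_ge0//.
      by rewrite mulr_ge0//; case/andP : (v01 x).
    by rewrite vE; lra.
  have h := bernoulli_ge (2 ^ N) (vN01 x).
  have h1 : (1 - s) ^+ N * (1 + s) ^+ N <= 1.
    rewrite -exprMn exprn_ile1//; last by nra.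
    by rewrite mulr_ge0 ?subr_ge0// addr_ge0// ltW.
  have h2 : (1 - s) ^+ N <= eps.
    have h3 : (1 - s) ^+ N * eps^-1 <= 1.
      by apply: le_trans h1; rewrite ler_wpM2l// exprn_ge0// subr_ge0.
    by rewrite ler_pdivrMr// mul1r in h3.
  lra.
Qed.

Section Vector.
Variables (k : nat) (xi : nat -> T -> 'cV[R]_k).
Hypothesis mxi : forall n, random_mx (xi n).
Hypothesis cxi : forall c : 'cV[R]_k, enorm c = 1 ->
  forall x, prob P [set t | fdot c (xi n t) <= x] @[n --> \oo] --> Phi x.

Let mdot c n : measurable_fun setT (fun t => fdot c (xi n t)).
Proof. by apply: measurable_fdot => //; exact: random_cst. Qed.

Let cvg_char (c : 'cV[R]_k) phi :
  Ex (fun t => cos (fdot c (xi n t) + phi)) @[n --> \oo] -->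
    expR (- (fdot c c / 2)) * cos phi.
Proof.
have [->|c0] := eqVneq c 0.
  have f0 v : fdot (0 : 'cV[R]_k) v = 0 by rewrite /fdot trmx0 mul0mx mxtrace0.
  rewrite f0 mul0r oppr0 expR0 mul1r.
  under eq_fun do under eq_fun do rewrite f0 add0r.
  by rewrite /Ex (mean_cst int1 mean1); exact: cvg_cst.
have n0 : fnorm c != 0 by apply: contra_neq c0; exact: fnorm_eq0.
pose u := (fnorm c)^-1 *: c.
have u1 : enorm u = 1.
  by rewrite enormE fnormZ normfV ger0_norm ?fnorm_ge0// mulVf.
have cu : c = fnorm c *: u by rewrite scalerA divff// scale1r.
have := @cvg_cos (fun n t => fdot u (xi n t)) (fnorm c) phi (mdot u) (cxi u1).
rewrite fnorm2; under eq_fun do under eq_fun do rewrite -fdotZl -cu.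
by [].
Qed.

Let dotD c c' n t : fdot (c + c') (xi n t) = fdot c (xi n t) + fdot c' (xi n t).
Proof. by rewrite fdotDl. Qed.

Let dot_delta a i n t : fdot (a *: delta_mx i 0) (xi n t) = a * xi n t i 0.
Proof.
by rewrite fdotZl /fdot trmx_delta -rowE /mxtrace big_ord1 mxE.
Qed.

Let sq_shift a (c : 'cV[R]_k) i : c i 0 = 0 ->
  fdot (c + a *: delta_mx i 0) (c + a *: delta_mx i 0) = fdot c c + a ^+ 2.
Proof.
move=> ci; have e : fdot c (delta_mx i 0) = 0.
  by rewrite fdotC /fdot trmx_delta -rowE /mxtrace big_ord1 mxE.
have e1 : fdot (delta_mx i 0 : 'cV[R]_k) (delta_mx i 0) = 1.
  by rewrite /fdot trmx_delta -rowE /mxtrace big_ord1 !mxE !eqxx.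
by rewrite fdotDl !fdotDr !fdotZl !fdotZr (fdotC (delta_mx i 0)) e e1; ring.
Qed.

(** Products of trigonometric polynomials of distinct coordinates, times a
    cosine of the remaining ones; cos u cos v is expanded into cosines. *)
Let cvg_trig_cos (s : seq ('I_k * (R -> R))) (c : 'cV[R]_k) phi :
  uniq (map fst s) -> (forall p, List.In p s -> trig p.2) ->
  (forall i, i \in map fst s -> c i 0 = 0) ->
  Ex (fun t => (\prod_(p <- s) p.2 (xi n t p.1 0)) * cos (fdot c (xi n t) + phi))
    @[n --> \oo] --> (\prod_(p <- s) EN p.2) * (expR (- (fdot c c / 2)) * cos phi).
Proof.
have bcos c' phi' n : bounded_measurable (fun t => cos (fdot c' (xi n t) + phi')).
  have b := trig_bm (trig_cos 1 phi').
  have := bm_comp (mdot c' n) b; congr bounded_measurable.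
  by apply/funext => t; rewrite mul1r.
elim: s c phi => [|[i f] s IH] c phi /=.
  move=> _ _ _; rewrite big_nil mul1r; under eq_fun do under eq_fun do rewrite big_nil mul1r.
  exact: cvg_char.
move=> /andP[iNs us] ts c0.
have ci : c i 0 = 0 by apply: c0; rewrite mem_head.
have ts' p : List.In p s -> trig p.2 by move=> ps; apply: ts; right.
have cs j : j \in map fst s -> c j 0 = 0 by move=> js; apply: c0; rewrite inE js orbT.
have bprod n : bounded_measurable (fun t => \prod_(p <- s) p.2 (xi n t p.1 0)).
  elim: (s) (ts') => [|p s' IH'] h.
    by rewrite (_ : (fun t => _) = cst 1); [exact: bm_cst|apply/funext => t; rewrite big_nil].
  rewrite (_ : (fun t => _) = (fun t => p.2 (xi n t p.1 0) * \prod_(p <- s') p.2 (xi n t p.1 0))).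
    apply: bmM; last by apply: IH' => p' hp'; apply: h; right.
    by apply: bm_comp; [exact: mxi|apply: trig_bm; apply: h; left].
  by apply/funext => t; rewrite big_cons.
have tf : trig f by apply: (ts (i, f)); left.
rewrite big_cons /=; under eq_fun do under eq_fun do rewrite big_cons /= -mulrA.
set Q := \prod_(p <- s) _.
elim: tf => [a psi|f1 f2 t1 IH1 t2 IH2|b f1 t1 IH1]; last 2 first.
- have bf g n : trig g -> bounded_measurable (fun t => g (xi n t i 0) * ((\prod_(p <- s) p.2 (xi n t p.1 0)) * cos (fdot c (xi n t) + phi))).
    move=> tg; apply: bmM; last exact: bmM.
    by apply: bm_comp; [exact: mxi|exact: trig_bm].
  rewrite END; [|exact: trig_bm..]; rewrite !mulrDl.
  apply: cvg_trans (cvgD IH1 IH2); apply: near_eq_cvg; apply: nearW => n.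
  rewrite fctE -ExD; [|exact: bf..].
  by congr Ex; apply/funext => t; rewrite mulrDl.
- have bf g n : trig g -> bounded_measurable (fun t => g (xi n t i 0) * ((\prod_(p <- s) p.2 (xi n t p.1 0)) * cos (fdot c (xi n t) + phi))).
    move=> tg; apply: bmM; last exact: bmM.
    by apply: bm_comp; [exact: mxi|exact: trig_bm].
  rewrite ENZ; [|exact: trig_bm..]; rewrite -!mulrA.
  rewrite -mulrA in IH1.
  apply: cvg_trans (cvgMl_tmp (a := b) IH1); apply: near_eq_cvg; apply: nearW => n /=.
  rewrite -ExZ; last exact: bf.
  by congr Ex; apply/funext => t; rewrite mulrA.
have shift0 a' j : j \in map fst s -> (c + a' *: delta_mx i 0) j 0 = 0.
  move=> js; rewrite !mxE cs// add0r; have [e|] := eqVneq j i; last by rewrite mulr0.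
  by move: js; rewrite e (negbTE iNs).
have h1 := IH (c + a *: delta_mx i 0) (phi + psi) us ts' (shift0 a).
have h2 := IH (c + (- a) *: delta_mx i 0) (phi - psi) us ts' (shift0 (- a)).
pose ca a' := c + a' *: delta_mx i 0.
have -> : EN (fun x => cos (a * x + psi)) * Q * (expR (- (fdot c c / 2)) * cos phi) =
   2^-1 * (Q * (expR (- (fdot (ca a) (ca a) / 2)) * cos (phi + psi))) +
   2^-1 * (Q * (expR (- (fdot (ca (- a)) (ca (- a)) / 2)) * cos (phi - psi))).
  by rewrite EN_cos /ca !sq_shift// sqrrN mulrDl opprD expRD cosD cosB; field.
have bb a' ph n : bounded_measurable (fun t => (\prod_(p <- s) p.2 (xi n t p.1 0)) * cos (fdot (c + a' *: delta_mx i 0) (xi n t) + ph)).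
  exact: bmM.
have h3 := cvgD (cvgMl_tmp (a := 2^-1) h1) (cvgMl_tmp (a := 2^-1) h2).
apply: cvg_trans (h3 _ _ _).
apply: near_eq_cvg; apply: nearW => n.
rewrite fctE -!ExZ; [|exact: bb..]; rewrite -ExD; [|exact/bmZ/bb..].
congr Ex; apply/funext => t; rewrite !dotD !dot_delta.
rewrite [RHS]mulrCA 2!(mulrCA 2^-1) -mulrDr; congr (_ * _).
rewrite [RHS]mulrC cosM; congr (_ * cos _ + _ * cos _); ring.
Qed.

Lemma cvg_trig_prod (F : 'I_k -> R -> R) : (forall i, trig (F i)) ->
  Ex (fun t => \prod_i F i (xi n t i 0)) @[n --> \oo] --> \prod_i EN (F i).
Proof.
move=> tF; pose s := [seq (i, F i) | i <- enum 'I_k].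
have E (g : 'I_k -> (R -> R) -> R) : \prod_(p <- s) g p.1 p.2 = \prod_i g i (F i).
  by rewrite /s big_map big_enum.
have := @cvg_trig_cos s 0 0.
rewrite (E (fun _ f => EN f)).
have f0 v : fdot (0 : 'cV[R]_k) v = 0 by rewrite /fdot trmx0 mul0mx mxtrace0.
rewrite f0 mul0r oppr0 expR0 cos0 !mulr1.
under eq_fun do under eq_fun do rewrite f0 addr0 cos0 mulr1.
have -> : (fun n => Ex (fun t => \prod_i F i (xi n t i 0))) =
    (fun n => Ex (fun t => \prod_(p <- s) p.2 (xi n t p.1 0))).
  by apply/funext => n; congr Ex; apply/funext => t; rewrite (E (fun i f => f (xi n t i 0))).
apply.
- by rewrite /s -map_comp map_id_in ?enum_uniq.
- rewrite /s => p; elim: (enum 'I_k) => //= i r IH [<-|/IH//].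
  exact: tF.
- by move=> i _; rewrite mxE.
Qed.

(** Telescoping, as all factors lie in [0, 1]. *)
Lemma prod_perturb (r : seq 'I_k) (a b c : 'I_k -> R) :
  (forall i, 0 <= a i <= 1) -> (forall i, 0 <= b i <= 1) ->
  (forall i, 0 <= c i) -> (forall i, a i <= b i + c i) ->
  \prod_(i <- r) a i <= \prod_(i <- r) b i + \sum_(i <- r) c i.
Proof.
move=> a01 b01 c0 abc.
have p01 (f : 'I_k -> R) s : (forall i, 0 <= f i <= 1) -> 0 <= \prod_(i <- s) f i <= 1.
  move=> f01; elim: s => [|i s /andP[h0 h1]]; first by rewrite big_nil ler01 lexx.
  have /andP[fi0 fi1] := f01 i.
  by rewrite big_cons mulr_ge0//= mulr_ile1.
elim: r => [|i r IH]; first by rewrite !big_nil addr0.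
rewrite !big_cons; have /andP[A0 A1] := p01 a r a01; have /andP[B0 B1] := p01 b r b01.
have /andP[ai0 ai1] := a01 i; have := abc i; have := c0 i.
have C0 : 0 <= \sum_(i <- r) c i by rewrite sumr_ge0.
nra.
Qed.

(** Products of trigonometric polynomials of the coordinates bound indicators of
    orthants from above and from below, up to small terms and to tails of single
    coordinates, which are controlled by the coordinate projections. *)
Lemma cramer_wold : cvg_std_normal P xi.
Proof.
have mcoord n i : measurable_fun setT (fun t => xi n t i 0) := mxi n i 0.
have cvg_coord i x : prob P [set t | xi n t i 0 <= x] @[n --> \oo] --> Phi x.
  have e1 : enorm (delta_mx i 0 : 'cV[R]_k) = 1.
    rewrite enormE /fnorm /fdot trmx_delta -rowE /mxtrace big_ord1 !mxE !eqxx.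
    by rewrite sqrtr1.
  have := @cxi _ e1 x; rewrite (_ : (fun n => _) = fun n => prob P [set t | xi n t i 0 <= x])//.
  apply/funext => n; congr prob; apply/seteqP; split => t /=;
    by rewrite -{1}[delta_mx i 0]scale1r dot_delta mul1r.
move=> x.
have -> : (\prod_(i < k) normal_prob 0%R 1%R `]-oo, x i 0%R]%classic)%E = (\prod_(i < k) Phi (x i 0))%:E.
  by rewrite -prodEFin; apply: eq_bigr => i _; rewrite PhiE.
apply/prob_cvgP => [n|eta eta0]; first exact: measurable_lower_orthant.
(* Each coordinate costs at most 3 rho for its approximation under N(0, 1) and
   2 rho for its tail. *)
pose rho := eta / (5 * k%:R + 1).
have k5 : 0 < 5 * k%:R + 1 :> R by rewrite ltr_wpDl// mulr_ge0.
have rho0 : 0 < rho by rewrite divr_gt0.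
have krho : 5 * k%:R * rho < eta.
  by rewrite /rho mulrA ltr_pdivrMr// mulrC ltr_pM2l// ltrDl.
have aux (A B S : R) : A <= B + 3 * k%:R * rho -> S <= 2 * k%:R * rho -> A + S < B + eta.
  by move=> h1 h2; lra.
have aux' (A B S p u : R) : p <= u + S -> u + S < B + eta -> A <= p + S ->
    B - eta < A - S -> - eta <= p - B <= eta.
  by move=> h1 h2 h3 h4; apply/andP; split; lra.
have [K K0 tailK] := @Phi_tail R _ rho0.
have tail2 : rho + (1 - Phi K + Phi (- K)) <= 2 * rho by lra.
have pk : 0 < normal_peak (1 : R) by rewrite normal_peak_gt0// oner_eq0.
pose delta := rho / (2 * normal_peak 1).
have d0 : 0 < delta by rewrite divr_gt0// mulr_gt0.
have Phi2 (y : R) : Phi (y + 2 * delta) <= Phi y + rho /\ Phi y - rho <= Phi (y - 2 * delta).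
  have e : normal_peak 1 * (2 * delta) = rho.
    by rewrite mulrCA mulrA /delta mulrC divfK// gt_eqF// mulr_gt0.
  have l1 : y <= y + 2 * delta by rewrite lerDl mulr_ge0// ltW.
  have l2 : y - 2 * delta <= y by rewrite gerDl oppr_le0 mulr_ge0// ltW.
  have /andP[_ h1] := Phi_lipschitz l1; have /andP[_ h2] := Phi_lipschitz l2.
  have e1 : y + 2 * delta - y = 2 * delta by ring.
  have e2 : y - (y - 2 * delta) = 2 * delta by ring.
  rewrite e1 e in h1; rewrite e2 e in h2; split; lra.
pose tail (y : R) : R := 1 - (y <= K)%R%:R + (y <= - K)%R%:R.
have tail0 y : 0 <= tail y by rewrite /tail; case: (y <= K); case: (y <= - K) => /=; lra.
have bind (z : R) : bounded_measurable (fun y : R => (y <= z)%R%:R : R).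
  by apply: bm_le; exact: measurable_id.
have btail : bounded_measurable tail.
  by apply: bmD => //; apply: bmB => //; exact: bm_cst.
have EN_ind z : EN (fun y => (y <= z)%R%:R) = Phi z by rewrite -weighted_cdf_Phi.
have EN_cst (c : R) : EN (cst c) = c by apply: mean_cst; [exact: pdf_integrable|exact: pdf_integral1].
have EN_le (f g : R -> R) : bounded_measurable f -> bounded_measurable g -> (forall y, f y <= g y) -> EN f <= EN g.
  move=> /bmR bf /bmR bg.
  exact: (le_mean (T := measurableTypeR R) (h := w) (@pdf_ge0 R) (@pdf_integrable R) bf bg).
have EN_B (f g : R -> R) : bounded_measurable f -> bounded_measurable g -> EN (fun y => f y - g y) = EN f - EN g.
  move=> /bmR bf /bmR bg.
  exact: (meanB (T := measurableTypeR R) (h := w) (@pdf_ge0 R) (@pdf_integrable R) bf bg).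
have EN_tail : EN tail <= rho.
  rewrite END//; last by apply: bmB => //; exact: bm_cst.
  by rewrite EN_B ?EN_ind// ?EN_cst//; exact: bm_cst.
have approx (a : R) : exists q, [/\ trig q, forall y, 0 <= q y <= 1,
    forall y, (y <= a - delta)%R%:R <= q y + (rho + tail y) &
    forall y, q y <= (y <= a + delta)%R%:R + (rho + tail y)].
  have [q [tq q01 q1 q2]] := trig_indicator a K0 d0 rho0; exists q; split=> // y.
  - have /andP[qy0 qy1] := q01 y; have := tail0 y.
    case: (leP y (a - delta)) => [ya|_] /=; last lra.
    have [yK|yK] := leP `|y| K; first by have := q1 y yK ya; lra.
    suff : 1 <= tail y by lra.
    move: yK; rewrite lter_normr /tail => /orP[yK|yK].
      by rewrite (leNgt y K) yK /= subr0 lerDl.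
    by rewrite lerNr (ltW yK); case: (y <= K) => /=; lra.
  - have /andP[qy0 qy1] := q01 y; have := tail0 y.
    case: (leP y (a + delta)) => [ya|ya] /=; first lra.
    have [yK|yK] := leP `|y| K; first by have := q2 y yK (ltW ya); lra.
    suff : 1 <= tail y by lra.
    move: yK; rewrite lter_normr /tail => /orP[yK|yK].
      by rewrite (leNgt y K) yK /= subr0 lerDl.
    by rewrite lerNr (ltW yK); case: (y <= K) => /=; lra.
have [qu hqu] := choice (fun i : 'I_k => approx (x i 0 + delta)).
have [ql hql] := choice (fun i : 'I_k => approx (x i 0 - delta)).
have bcomp (f : R -> R) n i : bounded_measurable f -> bounded_measurable (fun t => f (xi n t i 0)).
  by move=> bf; apply: bm_comp => //; exact: mcoord.
have Ex_cst c : Ex (cst c) = c by apply: mean_cst; [exact: int1|exact: mean1].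
have ExB f g : bounded_measurable f -> bounded_measurable g -> Ex (fun y => f y - g y) = Ex f - Ex g.
  by move=> bf bg; exact: (meanB c1_ge0 int1 bf bg).
pose tl n i := prob P [set t | xi n t i 0 <= K]; pose tr n i := prob P [set t | xi n t i 0 <= - K].
have Ex_tail n i : Ex (fun t => rho + tail (xi n t i 0)) = rho + (1 - tl n i + tr n i).
  have b1 := bcomp _ n i (bind K); have b2 := bcomp _ n i (bind (- K)).
  have b3 : bounded_measurable (cst 1 : T -> R) by exact: bm_cst.
  have b4 : bounded_measurable (cst rho : T -> R) by exact: bm_cst.
  rewrite (ExD b4 (bcomp _ n i btail)) Ex_cst /tail; congr (_ + _).
  rewrite (ExD (bmB b3 b1) b2) (ExB _ _ b3 b1) Ex_cst.
  by rewrite !Ex_le_event//; exact: mcoord.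
have btailn n i : bounded_measurable (fun t => rho + tail (xi n t i 0)).
  by apply: bmD; [exact: bm_cst|exact: bcomp].
pose I n t := \prod_i ((xi n t i 0 <= x i 0)%R%:R : R).
have bI n : bounded_measurable (I n) by apply: bm_prod => i; apply: (bcomp (fun y => (y <= x i 0)%R%:R)).
have ExI n : Ex (I n) = prob P [set t | forall i, xi n t i 0 <= x i 0].
  rewrite /Ex /weighted_mean; under eq_Rintegral do rewrite mulr1.
  rewrite /prob /Rintegral; congr fine.
  rewrite -[X in _ = P X]setIT -integral_indic//; last exact: measurable_lower_orthant.
  apply: eq_integral => t _; congr EFin; rewrite indicE /I.
  case: (boolP (t \in _)) => [|] /=.
    by rewrite inE /= => h; rewrite big1// => i _; rewrite h.
  rewrite notin_setE /= => /existsNP[i /negP /negbTE h].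
  by rewrite (bigD1 i)//= h mul0r.
have I01 n t i : 0 <= ((xi n t i 0 <= x i 0)%R%:R : R) <= 1 by case: (_ <= x i 0); rewrite /= ?lexx ?ler01.
have c0 n t (i : 'I_k) : 0 <= rho + tail (xi n t i 0) by rewrite addr_ge0// ltW.
have bq (q : 'I_k -> R -> R) n : (forall i, trig (q i)) -> bounded_measurable (fun t => \prod_i q i (xi n t i 0)).
  by move=> tq; apply: bm_prod => i; apply: bcomp; exact: trig_bm.
have bsum n : bounded_measurable (fun t => \sum_i (rho + tail (xi n t i 0))).
  by apply: bm_sum => i.
have Ex_sum n : Ex (fun t => \sum_i (rho + tail (xi n t i 0))) = \sum_i (rho + (1 - tl n i + tr n i)).
  have -> : Ex (fun t => \sum_i (rho + tail (xi n t i 0))) = \sum_i Ex (fun t => rho + tail (xi n t i 0)).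
    exact: (mean_sum c1_ge0 int1 mean1).
  by apply: eq_bigr => i _; exact: Ex_tail.
have tu i : trig (qu i) by have [] := hqu i.
have tql i : trig (ql i) by have [] := hql i.
have up n : Ex (I n) <= Ex (fun t => \prod_i qu i (xi n t i 0)) + \sum_i (rho + (1 - tl n i + tr n i)).
  rewrite -Ex_sum -(ExD (bq _ n tu) (bsum n)).
  apply: (le_mean c1_ge0 int1 (bI n) (bmD (bq _ n tu) (bsum n))) => t.
  apply: prod_perturb => // i; have [_ h1 h2 _] := hqu i; first exact: h1.
  by have := h2 (xi n t i 0); rewrite addrK.
have lo n : Ex (fun t => \prod_i ql i (xi n t i 0)) <= Ex (I n) + \sum_i (rho + (1 - tl n i + tr n i)).
  rewrite -Ex_sum -(ExD (bI n) (bsum n)).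
  apply: (le_mean c1_ge0 int1 (bq _ n tql) (bmD (bI n) (bsum n))) => t.
  apply: prod_perturb => // i; have [_ h1 _ h2] := hql i; first exact: h1.
  by have := h2 (xi n t i 0); rewrite subrK.
have EN01 q : trig q -> (forall y, 0 <= q y <= 1) -> 0 <= EN q <= 1.
  move=> tq q01; rewrite -{1}(EN_cst 0) -(EN_cst 1).
  by apply/andP; split; apply: EN_le; try exact: trig_bm; try exact: bm_cst;
    move=> y /=; case/andP : (q01 y).
have Phi01 (y : R) : 0 <= Phi y <= 1 by rewrite Phi_ge0 Phi_le1.
have rtail_bm : bounded_measurable (fun y => rho + tail y) by apply: bmD => //; exact: bm_cst.
have EN_rtail : EN (fun y => rho + tail y) <= 2 * rho.
  have br : bounded_measurable (cst rho : R -> R) by exact: bm_cst.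
  by rewrite (END br btail) EN_cst; lra.
have upN i : EN (qu i) <= Phi (x i 0) + 3 * rho.
  have [tq _ _ h] := hqu i; rewrite -addrA (_ : delta + delta = 2 * delta) in h; last by ring.
  apply: (@le_trans _ _ (EN (fun y => (y <= x i 0 + 2 * delta)%R%:R + (rho + tail y)))).
    by apply: EN_le => //; [exact: trig_bm|exact: bmD].
  by rewrite (END (bind _) rtail_bm) EN_ind; have [] := Phi2 (x i 0); lra.
have loN i : Phi (x i 0) <= EN (ql i) + 3 * rho.
  have [tq _ h _] := hql i; rewrite -addrA (_ : - delta - delta = - (2 * delta)) in h; last by ring.
  have : EN (fun y => (y <= x i 0 - 2 * delta)%R%:R) <= EN (fun y => ql i y + (rho + tail y)).
    by apply: EN_le => //; apply: bmD => //; exact: trig_bm.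
  by rewrite (END (trig_bm tq) rtail_bm) EN_ind; have [] := Phi2 (x i 0); lra.
have r3 (i : 'I_k) : 0 <= 3 * rho by rewrite mulr_ge0// ltW.
have sum3 : \sum_(i < k) (3 * rho) = 3 * k%:R * rho.
  by rewrite sumr_const card_ord -mulr_natl; ring.
have limu : \prod_i EN (qu i) <= \prod_(i < k) Phi (x i 0) + 3 * k%:R * rho.
  by rewrite -sum3; apply: prod_perturb => // i; apply: EN01 => //; have [] := hqu i.
have liml : \prod_(i < k) Phi (x i 0) <= \prod_i EN (ql i) + 3 * k%:R * rho.
  by rewrite -sum3; apply: prod_perturb => // i; apply: EN01 => //; have [] := hql i.
pose tot : R := \sum_(i < k) (rho + (1 - Phi K + Phi (- K))).
have totle : tot <= 2 * k%:R * rho.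
  apply: (@le_trans _ _ (\sum_(i < k) (2 * rho))); first exact: ler_sum.
  by rewrite sumr_const card_ord -[leLHS]mulr_natl mulrCA mulrA.
have ctot : \sum_(i < k) (rho + (1 - tl n i + tr n i)) @[n --> \oo] --> tot.
  apply: cvg_sumr => i _; apply: cvgD; first exact: cvg_cst.
  by apply: cvgD; [apply: cvgB; [exact: cvg_cst|exact: cvg_coord]|exact: cvg_coord].
clearbody tot.
have cu : Ex (fun t => \prod_i qu i (xi n t i 0)) + \sum_(i < k) (rho + (1 - tl n i + tr n i))
    @[n --> \oo] --> \prod_i EN (qu i) + tot.
  by apply: cvgD; [exact: cvg_trig_prod|exact: ctot].
have cl : Ex (fun t => \prod_i ql i (xi n t i 0)) - \sum_(i < k) (rho + (1 - tl n i + tr n i))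
    @[n --> \oo] --> \prod_i EN (ql i) - tot.
  by apply: cvgB; [exact: cvg_trig_prod|exact: ctot].
have ltu := aux _ _ _ limu totle.
have ltl : \prod_(i < k) Phi (x i 0) - eta < \prod_i EN (ql i) - tot.
  by rewrite ltrBlDr addrAC ltrBrDr; exact: aux liml totle.
near=> n; have h3 := up n; have h4 := lo n; rewrite ExI in h3 h4; rewrite ler_norml.
apply: aux' h3 _ h4 _.
  by near: n; exact: (cvgr_lt _ cu _ ltu).
by near: n; exact: (cvgr_gt _ cl _ ltl).
Unshelve. all: by end_near. Qed.

End Vector.

End CramerWold.

(** * Slutsky's lemma and tightness *)

Section Slutsky.
Context {d : measure_display} {T : measurableType d} {R : realType}.
Variable P : probability T R.

Lemma std_normal_probP k (Z : nat -> T -> 'cV[R]_k) : (forall n, random_mx (Z n)) ->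
  cvg_std_normal P Z <-> (forall (x : 'cV[R]_k) (eps : R), 0 < eps -> \forall n \near \oo,
    `|prob P [set t | forall i, Z n t i 0 <= x i 0] - \prod_(i < k) Phi (x i 0)| <= eps).
Proof.
move=> mZ.
have E x : (\prod_(i < k) normal_prob 0%R 1%R `]-oo, (x : 'cV[R]_k) i 0%R]%classic)%E =
    (\prod_(i < k) Phi (x i 0))%:E.
  by rewrite -prodEFin; apply: eq_bigr => i _; rewrite PhiE.
have mO x n : measurable [set t | forall i, Z n t i 0 <= (x : 'cV[R]_k) i 0].
  exact: measurable_lower_orthant.
split=> h x; first by have := h x; rewrite E => /(prob_cvgP P _ (mO x)).
by rewrite E; apply/prob_cvgP => //; exact: h.
Qed.

(** Continuity of the limit distribution function. *)
Let prod_Phi_shift k (x : 'cV[R]_k) (eps : R) : 0 < eps -> exists2 delta, 0 < delta &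
  \prod_(i < k) Phi (x i 0 + delta) <= \prod_(i < k) Phi (x i 0) + eps /\
  \prod_(i < k) Phi (x i 0) - eps <= \prod_(i < k) Phi (x i 0 - delta).
Proof.
move=> e0.
have pk : 0 < normal_peak (1 : R) by rewrite normal_peak_gt0// oner_eq0.
pose delta := eps / ((k%:R + 1) * normal_peak 1).
have k1 : 0 < k%:R + 1 :> R by rewrite ltr_wpDl.
have d0 : 0 < delta by rewrite divr_gt0// mulr_gt0.
pose c := normal_peak 1 * delta.
have c0 : 0 <= c by rewrite mulr_ge0// ltW.
have kc : \sum_(i < k) c <= eps.
  rewrite sumr_const card_ord -[leLHS]mulr_natl /c /delta.
  have -> : k%:R * (normal_peak 1 * (eps / ((k%:R + 1) * normal_peak 1))) = (k%:R / (k%:R + 1)) * eps.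
    by field; rewrite !gt_eqF.
  by rewrite ler_piMl ?(ltW e0)// ler_pdivrMr// mul1r lerDl.
have Phi01 (y : R) : 0 <= Phi y <= 1 by rewrite Phi_ge0 Phi_le1.
exists delta => //; split.
  apply: le_trans (prod_perturb (c := fun=> c) (index_enum 'I_k) (fun i => Phi01 _) (fun i => Phi01 (x i 0)) (fun=> c0) _) _.
    move=> i; have /Phi_lipschitz/andP[_] : x i 0 <= x i 0 + delta by rewrite lerDl ltW.
    by rewrite addrAC subrr add0r -lerBlDl.
  by rewrite lerD2l.
rewrite lerBlDr; apply: le_trans (prod_perturb (c := fun=> c) (index_enum 'I_k) (fun i => Phi01 (x i 0)) (fun i => Phi01 (x i 0 - delta)) (fun=> c0) _) _.
  move=> i; have /Phi_lipschitz/andP[_] : x i 0 - delta <= x i 0 by rewrite gerBl ltW.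
  by rewrite subKr -lerBlDl.
by rewrite lerD2l.
Qed.

(** When |Z - xi| <= delta, the orthant of Z at x lies between those of xi at
    x - delta and x + delta. *)
Lemma slutsky k (xi Z : nat -> T -> 'cV[R]_k) :
  (forall n, random_mx (xi n)) -> (forall n, random_mx (Z n)) ->
  cvg_std_normal P xi ->
  (forall eps, 0 < eps -> whp P (fun n t => forall i, `|Z n t i 0 - xi n t i 0| <= eps)) ->
  cvg_std_normal P Z.
Proof.
have shiftu (delta z w x : R) : `|z - w| <= delta -> z <= x -> w <= x + delta.
  by rewrite ler_norml => /andP[? ?] ?; lra.
have shiftl (delta z w x : R) : `|z - w| <= delta -> w <= x - delta -> z <= x.
  by rewrite ler_norml => /andP[? ?] ?; lra.
have combine (eps pu pl Fu Fl F p b : R) : pu - Fu <= eps / 3 -> - (pl - Fl) <= eps / 3 ->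
    Fu <= F + eps / 3 -> F - eps / 3 <= Fl -> b <= eps / 3 -> p <= pu + b -> pl <= p + b ->
    `|p - F| <= eps.
  by move=> *; rewrite ler_norml; apply/andP; split; lra.
move=> mxi mZ /(std_normal_probP mxi) cxi h; apply/std_normal_probP => // x eps e0.
have e3 : 0 < eps / 3 by rewrite divr_gt0.
have [delta d0 [hu hl]] := prod_Phi_shift x e3.
pose xu : 'cV[R]_k := \col_i (x i 0 + delta); pose xl : 'cV[R]_k := \col_i (x i 0 - delta).
have eu : \prod_(i < k) Phi (xu i 0) = \prod_(i < k) Phi (x i 0 + delta).
  by apply: eq_bigr => i _; rewrite mxE.
have el : \prod_(i < k) Phi (xl i 0) = \prod_(i < k) Phi (x i 0 - delta).
  by apply: eq_bigr => i _; rewrite mxE.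
have := cxi xu _ e3; have := cxi xl _ e3; rewrite eu el => cl cu.
have hw := h _ d0 _ e3.
near=> n.
have /ler_normlP[_ h1] : `|prob P [set t | forall i, xi n t i 0 <= xu i 0] - \prod_(i < k) Phi (x i 0 + delta)| <= eps / 3.
  by near: n.
have /ler_normlP[h2 _] : `|prob P [set t | forall i, xi n t i 0 <= xl i 0] - \prod_(i < k) Phi (x i 0 - delta)| <= eps / 3.
  by near: n.
have [B [mB pB hB]] : exists B, [/\ measurable B, prob P B <= eps / 3 &
    forall t, ~ B t -> forall i, `|Z n t i 0 - xi n t i 0| <= delta] by near: n.
have mO (W : nat -> T -> 'cV[R]_k) y : (forall n, random_mx (W n)) ->
    measurable [set t | forall i, W n t i 0 <= (y : 'cV[R]_k) i 0].
  by move=> mW; exact: measurable_lower_orthant.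
have u1 : prob P [set t | forall i, Z n t i 0 <= x i 0] <=
    prob P [set t | forall i, xi n t i 0 <= xu i 0] + prob P B.
  apply: le_trans (probU P (mO xi xu mxi) mB); apply: le_prob; [exact: mO|apply: measurableU => //; exact: mO|].
  move=> t /= Zt; have [Bt|/hB Bt] := pselect (B t); [by right|left=> i].
  by move: (Bt i) (Zt i); rewrite mxE => b1 b2; exact: shiftu b1 b2.
have l1 : prob P [set t | forall i, xi n t i 0 <= xl i 0] <=
    prob P [set t | forall i, Z n t i 0 <= x i 0] + prob P B.
  apply: le_trans (probU P (mO Z x mZ) mB); apply: le_prob; [exact: mO|apply: measurableU => //; exact: mO|].
  move=> t /= Zt; have [Bt|/hB Bt] := pselect (B t); [by right|left=> i].
  by move: (Bt i) (Zt i); rewrite mxE => b1 b2; exact: shiftl b1 b2.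
exact: combine h1 h2 hu hl pB u1 l1.
Unshelve. all: by end_near. Qed.

Lemma op1_cst (u : nat -> R) : u n @[n --> \oo] --> 0 -> op1 P (fun n _ => u n).
Proof.
move=> /cvgrPdist_le u0 eps e0; apply: whp_near.
by apply: filterS (u0 _ e0) => n h t; rewrite sub0r normrN in h.
Qed.

(** Tightness, from the tails of the limit. *)
Lemma normal_Op1 (Y : nat -> T -> R) : (forall n, measurable_fun setT (Y n)) ->
  (forall x, prob P [set t | Y n t <= x] @[n --> \oo] --> Phi x) -> Op1 P Y.
Proof.
move=> mY cY eta eta0; have e3 : 0 < eta / 3 by rewrite divr_gt0.
have [K K0 tK] := @Phi_tail R _ e3; exists K => //.
have /cvgrPdist_le/(_ _ e3) h1 := cY K.
have /cvgrPdist_le/(_ _ e3) h2 := cY (- K).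
apply: filterS2 h1 h2 => n /ler_normlP[_ h1] /ler_normlP[h2 _].
have m1 := measurable_ler_set (mY n) (measurable_cst K).
have m2 := measurable_ler_set (mY n) (measurable_cst (- K)).
exists (~` [set t | Y n t <= K] `|` [set t | Y n t <= - K]); split.
- by apply: measurableU => //; exact: measurableC.
- apply: le_trans (probU _ (measurableC m1) m2) _; rewrite probC//.
  move: h1 h2 tK; rewrite /=; lra.
- move=> t /not_orP[/contrapT /= h3 /negP]; rewrite -ltNge => h4.
  by rewrite ler_norml h3 andbT ltW.
Qed.

Lemma std_normal1P (Y : nat -> T -> R) : (forall n, measurable_fun setT (Y n)) ->
  cvg_std_normal P (fun n t => const_mx (Y n t) : 'cV[R]_1) ->
  forall x, prob P [set t | Y n t <= x] @[n --> \oo] --> Phi x.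
Proof.
move=> mY h x; have := h (const_mx x); rewrite big_ord1 mxE PhiE => /fine_cvg.
rewrite (_ : _ \o _ = (fun n => prob P [set t | Y n t <= x]))//.
apply/funext => n; rewrite /prob /=; congr (fine (P _)).
apply/seteqP; split => t /=; first by move=> /(_ 0); rewrite !mxE.
by move=> ? i; rewrite !mxE.
Qed.

End Slutsky.

(** * Perturbation of the sketched Gram matrix *)

Section Perturbation.
Context {R : realType}.

Lemma psd_lower_norm n (A : 'M[R]_n) lam (v : 'cV[R]_n) :
  lam * fdot v v <= fdot v (A *m v) -> lam * fnorm v <= fnorm (A *m v).
Proof.
move=> h; have [v0|v0] := eqVneq (fnorm v) 0; first by rewrite v0 mulr0 fnorm_ge0.
have vp : 0 < fnorm v by rewrite lt_def v0 fnorm_ge0.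
rewrite -(ler_pM2r vp) -mulrA -expr2 fnorm2 mulrC [leRHS]mulrC.
rewrite mulrC; apply: le_trans h _; apply: le_trans (ler_norm _) (fdot_CS _ _).
Qed.

Lemma unitmx_lower n (A : 'M[R]_n) lam : 0 < lam ->
  (forall v : 'cV[R]_n, lam * fnorm v <= fnorm (A *m v)) -> A \in unitmx.
Proof.
move=> lam0 h; rewrite -unitmx_tr -row_free_unit; apply: inj_row_free => v.
move=> /(congr1 trmx); rewrite trmx_mul trmxK trmx0 => Av.
have := h v^T; rewrite Av fnorm0 pmulr_rle0// => v0.
have /fnorm_eq0 : fnorm v^T = 0 by apply/eqP; rewrite eq_le v0 fnorm_ge0.
by move=> /(congr1 trmx); rewrite trmxK trmx0.
Qed.

Lemma fnorm_lower m n (A : 'M[R]_n) lam (M : 'M[R]_(n, m)) : 0 <= lam ->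
  (forall v : 'cV[R]_n, lam * fnorm v <= fnorm (A *m v)) ->
  lam * fnorm M <= fnorm (A *m M).
Proof.
move=> lam0 h; rewrite -(@ler_pXn2r _ 2)// ?nnegrE ?mulr_ge0 ?fnorm_ge0//.
rewrite exprMn !fnorm2 fdot_cols [leRHS]fdot_cols mulr_sumr ler_sum// => j _.
rewrite colM -!fnorm2 -exprMn lerXn2r ?nnegrE ?mulr_ge0 ?fnorm_ge0//.
Qed.

Lemma fnorm_inv_le m n (A : 'M[R]_n) lam (M : 'M[R]_(n, m)) : 0 < lam ->
  (forall v : 'cV[R]_n, lam * fnorm v <= fnorm (A *m v)) ->
  fnorm (invmx A *m M) <= fnorm M / lam.
Proof.
move=> lam0 h; have uA := unitmx_lower lam0 h.
rewrite ler_pdivlMr// mulrC; apply: le_trans (fnorm_lower _ (ltW lam0) h) _.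
by rewrite mulmxA mulmxV// mul1mx.
Qed.

(** Cauchy-Schwarz for the form of N, between v and N^-1 v. *)
Lemma psd_lower n (N : 'M[R]_n) lam (v : 'cV[R]_n) : is_psd N -> 0 < lam ->
  (forall v : 'cV[R]_n, lam * fnorm v <= fnorm (N *m v)) ->
  lam * fdot v v <= fdot v (N *m v).
Proof.
move=> Np lam0 h; have uN := unitmx_lower lam0 h.
pose w := invmx N *m v.
have Nw : N *m w = v by rewrite mulmxA mulmxV// mul1mx.
have [v0|v0] := eqVneq (fdot v v) 0; first by rewrite v0 mulr0; case/psdP : Np => _; apply.
have vp : 0 < fdot v v by rewrite lt_def v0 fdot_ge0.
have := psd_CS v w Np; rewrite Nw => hCS.
have wv : lam * fdot w v <= fdot v v.
  apply: (@le_trans _ _ (lam * fnorm w * fnorm v)).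
    by rewrite -mulrA ler_wpM2l ?(ltW lam0)//; apply: le_trans (ler_norm _) (fdot_CS _ _).
  by rewrite -[leRHS]fnorm2 expr2 ler_wpM2r ?fnorm_ge0// -[in leRHS]Nw.
have Nv0 : 0 <= fdot v (N *m v) by case/psdP : Np => _; apply.
rewrite -(ler_pM2r vp) -mulrA -expr2.
apply: (@le_trans _ _ (lam * (fdot v (N *m v) * fdot w v))); first by rewrite ler_wpM2l// ltW.
by rewrite mulrCA ler_wpM2l.
Qed.

(** If the squares of N and N0 are close, then N w = N0 z + r forces w to be
    close to z: indeed N (w - z) = (N0 - N) z + r. *)
Lemma sqrt_perturbation n (N0 N : 'M[R]_n) lam delta :
  is_psd N0 -> is_psd N -> 0 < lam ->
  (forall v : 'cV[R]_n, lam * fdot v v <= fdot v (N0 *m v)) ->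
  fnorm (N *m N - N0 *m N0) <= delta -> delta <= lam ^+ 2 / 2 ->
  N \in unitmx /\ forall w z r : 'cV[R]_n, N *m w = N0 *m z + r ->
    fnorm (w - z) <= 2 * delta / lam ^+ 2 * fnorm z + 2 / lam * fnorm r.
Proof.
move=> N0p Np lam0 N0l hd dl.
have D : fnorm (N0 - N) <= delta / lam.
  rewrite ler_pdivlMr// mulrC; apply: le_trans hd.
  by rewrite -[leRHS]fnormN opprB; exact: sqrt_lipschitz.
have Nl (v : 'cV[R]_n) : lam / 2 * fnorm v <= fnorm (N *m v).
  have h1 := psd_lower_norm (N0l v).
  have h2 : fnorm (N0 *m v) <= fnorm (N *m v) + fnorm ((N0 - N) *m v).
    by apply: le_trans (fnormD _ _); rewrite mulmxBl addrC subrK.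
  have h3 : fnorm ((N0 - N) *m v) <= lam / 2 * fnorm v.
    apply: le_trans (fnormM _ _) _; rewrite ler_wpM2r ?fnorm_ge0//.
    apply: le_trans D _; rewrite ler_pdivrMr//; apply: le_trans dl _.
    by rewrite expr2 mulrAC.
  lra.
have lam2 : 0 < lam / 2 by rewrite divr_gt0.
split; first exact: unitmx_lower lam2 Nl.
move=> w z r e.
have : lam / 2 * fnorm (w - z) <= delta / lam * fnorm z + fnorm r.
  apply: le_trans (Nl _) _.
  have -> : N *m (w - z) = (N0 - N) *m z + r by rewrite mulmxBr e mulmxBl addrAC.
  apply: le_trans (fnormD _ _) _; rewrite lerD2r.
  by apply: le_trans (fnormM _ _) _; rewrite ler_wpM2r ?fnorm_ge0.
rewrite -ler_pdivlMl// => h; apply: le_trans h _.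
by rewrite le_eqVlt; apply/orP; left; apply/eqP; field; rewrite gt_eqF.
Qed.

End Perturbation.

Section Polar.
Context {R : realType} {n q : nat}.
Implicit Types (X Q : 'M[R]_(n, q.+1)).

(** The polar decomposition X = Q R0, with R0 bounded below by lam and of
    condition number at most K. *)
Definition polar X Q (R0 : 'M[R]_q.+1) (lam K : R) : Prop :=
  [/\ X = Q *m R0, Q^T *m Q = 1%:M, is_psd R0 /\ 0 < lam,
      forall v : 'cV[R]_q.+1, lam * fdot v v <= fdot v (R0 *m v) &
      fnorm R0 <= K * lam].

(** From the singular values, Q = U V^T and R0 = V diag(l) V^T. *)
Lemma svd_polar X U (l : 'rV[R]_q.+1) V c : is_svd X U l V ->
  l 0 ord0 / l 0 ord_max <= c ->
  polar X (U *m V^T) (V *m diag_mx l *m V^T) (l 0 ord_max) (q.+1%:R * c) /\ V^T *m V = 1%:M.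
Proof.
move=> [-> UU VV l_dec l_gt0] lc; split=> //.
have VV' : V *m V^T = 1%:M by apply: mulmx1C.
have lge j : l 0 ord_max <= l 0 j by apply: l_dec; rewrite leq_ord.
have lle j : l 0 j <= l 0 ord0 by apply: l_dec.
have dform (v : 'cV[R]_q.+1) : fdot v (diag_mx l *m v) = \sum_i l 0 i * v i 0 ^+ 2.
  rewrite fdotE; apply: eq_bigr => i _; rewrite big_ord1 mul_diag_mx mxE.
  by rewrite expr2; ring.
split=> //.
- by rewrite -!mulmxA (mulmxA V^T) VV mul1mx.
- by rewrite trmx_mul trmxK -mulmxA (mulmxA U^T) UU mul1mx.
- split=> //; suff dp : is_psd (diag_mx l) by have := psd_congr V^T dp; rewrite trmxK.
  apply/psdP; split; first by rewrite tr_diag_mx.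
  move=> v; rewrite dform sumr_ge0// => i _; rewrite mulr_ge0 ?sqr_ge0//.
  by apply: le_trans (lge i); exact: ltW.
- move=> v; rewrite -!mulmxA fdotMr dform.
  have -> : fdot v v = fdot (V^T *m v) (V^T *m v) by rewrite fdot_isometry// trmxK.
  rewrite fdotE mulr_sumr ler_sum// => i _; rewrite big_ord1 -expr2.
  by rewrite ler_wpM2r ?sqr_ge0.
- rewrite -mulmxA fnorm_isometry// -[leLHS]fnormT trmx_mul trmxK fnorm_isometry//.
  rewrite fnormT; apply: le_trans (fnorm_le_sum _) _.
  apply: (@le_trans _ _ (\sum_(i < q.+1) l 0 ord0)).
    apply: ler_sum => i _; rewrite (bigD1 i)//= big1 ?addr0.
      rewrite mxE eqxx mulr1n ger0_norm//.
      by apply: le_trans (lge i); exact: ltW.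
    by move=> j ji; rewrite mxE eq_sym (negbTE ji) mulr0n normr0.
  rewrite sumr_const card_ord -[leLHS]mulr_natl -mulrA ler_wpM2l//.
  by rewrite -ler_pdivrMr.
Qed.

End Polar.

Section PartOneAlgebra.
Context {R : realType} {m n q : nat}.
Variables (S : 'M[R]_(m, n)) (X Q : 'M[R]_(n, q.+1)) (R0 : 'M[R]_q.+1) (lam K : R).
Hypothesis XQ : polar X Q R0 lam K.

Let F := (S *m Q)^T *m (S *m Q) - 1%:M.
Let G := sketch_gram S X.

Let R0T : R0^T = R0. Proof. by case: XQ => _ _ [[]]. Qed.
Let lam0 : 0 < lam. Proof. by case: XQ => _ _ []. Qed.

Lemma polar_lower (v : 'cV[R]_q.+1) : lam * fnorm v <= fnorm (R0 *m v).
Proof. by apply: psd_lower_norm; case: XQ. Qed.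

Lemma polar_unit : R0 \in unitmx.
Proof. exact: unitmx_lower lam0 polar_lower. Qed.

Lemma gram_polar : X^T *m X = R0 *m R0.
Proof.
by case: XQ => -> QQ _ _ _; rewrite trmx_mul R0T -mulmxA (mulmxA Q^T) QQ mul1mx.
Qed.

Lemma sketch_gram_polar : G = R0 *m (1%:M + F) *m R0.
Proof.
case: XQ => e _ _ _ _; rewrite /G /sketch_gram /F addrC subrK e.
by rewrite (mulmxA S) [(S *m Q *m R0)^T]trmx_mul R0T !mulmxA.
Qed.

Lemma sketch_gram_dist : fnorm (G - R0 *m R0) <= fnorm F * K ^+ 2 * lam ^+ 2.
Proof.
rewrite sketch_gram_polar mulmxDr mulmx1 mulmxDl addrAC subrr add0r.
apply: le_trans (fnormM _ _) _.
apply: (@le_trans _ _ (fnorm R0 * fnorm F * fnorm R0)).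
  by rewrite ler_wpM2r ?fnorm_ge0// fnormM.
have h : fnorm R0 <= K * lam by case: XQ.
have -> : fnorm F * K ^+ 2 * lam ^+ 2 = (K * lam) * fnorm F * (K * lam) by ring.
by rewrite ler_pM ?mulr_ge0 ?fnorm_ge0// ler_wpM2r ?fnorm_ge0.
Qed.

(** The constants of the general perturbation lemma are scale-free here because
    the condition number of R0 is at most K. *)
Lemma sqrt_gram_perturbation : fnorm F * K ^+ 2 <= 2^-1 ->
  sqrtmx G \in unitmx /\ forall w z r : 'cV[R]_q.+1, sqrtmx G *m w = R0 *m z + r ->
    fnorm (w - z) <= 2 * (fnorm F * K ^+ 2) * fnorm z + 2 / lam * fnorm r.
Proof.
move=> h; have Gp : is_psd G by exact: psd_gram.
have [] := @sqrt_perturbation _ _ R0 (sqrtmx G) lam (fnorm F * K ^+ 2 * lam ^+ 2).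
- by case: XQ => _ _ [].
- exact: sqrtmx_psd.
- exact: lam0.
- by case: XQ.
- by rewrite sqrtmx_sqr//; exact: sketch_gram_dist.
- by rewrite mulrC ler_wpM2l ?sqr_ge0.
- move=> u h'; split=> // w z r e; apply: le_trans (h' _ _ _ e) _.
  by rewrite (mulrA 2 _ (lam ^+ 2)) mulfK ?expf_neq0 ?gt_eqF.
Qed.

Lemma sketch_gram_unit : fnorm F * K ^+ 2 <= 2^-1 -> G \in unitmx.
Proof.
move=> /sqrt_gram_perturbation[uN _].
have Gp : is_psd G by exact: psd_gram.
by rewrite -(sqrtmx_sqr Gp) unitmx_mul uN.
Qed.

Lemma form_sketch_gram (u : 'cV[R]_q.+1) : fnorm F <= 2^-1 ->
  fdot u (G *m u) <= 2 * fdot (X *m u) (X *m u).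
Proof.
move=> f2; have e : fdot (X *m u) (X *m u) = fdot (R0 *m u) (R0 *m u).
  by case: XQ => -> QQ _ _ _; rewrite -!mulmxA fdot_isometry.
rewrite e sketch_gram_polar -!mulmxA fdotMr R0T mulmxDl mul1mx fdotDr.
have : fdot (R0 *m u) (F *m (R0 *m u)) <= fdot (R0 *m u) (R0 *m u).
  apply: le_trans (ler_norm _) _; apply: le_trans (fdot_CS _ _) _.
  rewrite -fnorm2 expr2 ler_wpM2l ?fnorm_ge0//.
  apply: le_trans (fnormM _ _) _; rewrite ler_piMl ?fnorm_ge0//.
  by apply: le_trans f2 _; rewrite invf_le1// ler1n.
lra.
Qed.

(** The normal equations of the sketched problem, with (S X)^T = R0 (S Q)^T. *)
Lemma beta_s_error (b0 : 'cV[R]_q.+1) (eps : 'cV[R]_n) : G \in unitmx ->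
  G *m (beta_s S X (X *m b0 + eps) - b0) = R0 *m ((S *m Q)^T *m (S *m eps)).
Proof.
move=> uG; rewrite mulmxBr /beta_s /ols -/(sketch_gram S X) -/G.
rewrite mulKVmx// mulmxDr [S *m (X *m b0)]mulmxA mulmxDr.
rewrite [_ *m (S *m X *m b0)]mulmxA -/(sketch_gram S X) -/G addrAC subrr add0r.
by case: XQ => -> _ _ _ _; rewrite (mulmxA S) [(S *m Q *m R0)^T]trmx_mul R0T -mulmxA.
Qed.

End PartOneAlgebra.

(** * Deterministic estimate for the sketched least squares estimator *)

Section PartOneEstimate.
Context {R : realType} {m n q : nat}.
Variables (S : 'M[R]_(m, n)) (X Q : 'M[R]_(n, q.+1)) (R0 : 'M[R]_q.+1) (lam K : R).
Hypothesis XQ : polar X Q R0 lam K.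

Let F := (S *m Q)^T *m (S *m Q) - 1%:M.
Let f := fnorm F * K ^+ 2.
Let G := sketch_gram S X.

Variables (b0 : 'cV[R]_q.+1) (eps : 'cV[R]_n) (s : R).
Let y := X *m b0 + eps.
Let zeta := (S *m Q)^T *m (S *m eps).
Let xi := (s / fnorm eps) *: zeta.
Let err := fdot (S *m eps) (S *m eps) / fnorm eps ^+ 2 - 1.
Let e1 := `|err| + 4 * fnorm xi ^+ 2 / s ^+ 2.
Let res := fnorm (sketch_residual S X y).

(** The vector w = G^(1/2) (beta_s - b0) satisfies G^(1/2) w = R0 zeta with
    G^(1/2) close to R0, so w is close to zeta. By Pythagoras the squared
    sketched residual is |S eps|^2 - |w|^2, which is close to |eps|^2. *)
Lemma part1_estimate : 0 < fnorm eps -> 0 < s -> f <= 2^-1 -> fnorm F <= 2^-1 -> e1 <= 4^-1 ->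
  fnorm ((s / res) *: (sqrtmx G *m (beta_s S X y - b0)) - xi) <= (4 * f + 2 * e1) * fnorm xi /\
  forall u : 'cV[R]_q.+1, fnorm ((s / res) *: (sqrtmx G *m u)) ^+ 2 <=
    4 * (s ^+ 2 * fdot (X *m u) (X *m u) / fnorm eps ^+ 2).
Proof.
move=> eta0 s0 f2 F2 e14.
set d := beta_s S X y - b0; set eta := fnorm eps in eta0 *.
have Gp : is_psd G by exact: psd_gram.
have Np := sqrtmx_psd Gp; have NN := sqrtmx_sqr Gp.
have uG : G \in unitmx := sketch_gram_unit XQ f2.
have [uN per] := sqrt_gram_perturbation XQ f2.
have Gd : G *m d = R0 *m zeta := beta_s_error XQ _ _ uG.
pose w := sqrtmx G *m d.
have wz : fnorm (w - zeta) <= 2 * f * fnorm zeta.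
  have := per w zeta 0; rewrite fnorm0 mulr0 !addr0; apply.
  by rewrite mulmxA NN.
have w2 : fnorm w <= 2 * fnorm zeta.
  have -> : w = (w - zeta) + zeta by rewrite subrK.
  apply: le_trans (fnormD _ _) _.
  have := ler_wpM2r (fnorm_ge0 zeta) f2; lra.
have zx : fnorm zeta = eta / s * fnorm xi.
  rewrite /xi fnormZ -/eta ger0_norm ?divr_ge0 ?ltW//.
  by field; rewrite !gt_eqF.
have resE : res ^+ 2 = fdot (S *m eps) (S *m eps) - fnorm w ^+ 2.
  rewrite /res !fnorm2.
  have -> : sketch_residual S X y = S *m eps - S *m X *m d.
    rewrite /sketch_residual /residual -/(beta_s S X y) /d /y mulmxDr mulmxBr opprB mulmxA.
    by rewrite [_ *m b0 + _]addrC -addrA.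
  have e2 : fdot (S *m X *m d) (S *m eps) = fdot w w.
    have -> : fdot w w = fdot d (G *m d) by rewrite /w fdotMl (proj1 Np) mulmxA NN.
    rewrite Gd /zeta; case: XQ => -> _ [[R0T _] _] _ _.
    by rewrite fdotMl (mulmxA S) [(S *m Q *m R0)^T]trmx_mul R0T -mulmxA.
  have e3 : fdot (S *m X *m d) (S *m X *m d) = fdot w w.
    rewrite fdotMl mulmxA -/(sketch_gram S X) -/G.
    by rewrite /w fdotMl (proj1 Np) mulmxA NN.
  rewrite fdotDl !fdotDr !fdotNl !fdotNr (fdotC (S *m eps) (_ *m d)) e2 e3; ring.
have eta2 : 0 < eta ^+ 2 by rewrite exprn_gt0.
have s2 : 0 < s ^+ 2 by rewrite exprn_gt0.
have w2' : fnorm w ^+ 2 <= 4 * fnorm xi ^+ 2 / s ^+ 2 * eta ^+ 2.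
  apply: (@le_trans _ _ ((2 * fnorm zeta) ^+ 2)).
    by rewrite lerXn2r ?nnegrE ?mulr_ge0 ?fnorm_ge0.
  rewrite zx le_eqVlt; apply/orP; left; apply/eqP; field; by rewrite gt_eqF.
pose r := res / eta.
have r0 : 0 <= r by rewrite divr_ge0 ?fnorm_ge0 ?ltW.
have r2 : `|r ^+ 2 - 1| <= e1.
  have -> : r ^+ 2 - 1 = err - fnorm w ^+ 2 / eta ^+ 2.
    by rewrite /r expr_div_n resE /err -/eta; field; rewrite gt_eqF.
  apply: le_trans (ler_normB _ _) _; rewrite /e1 lerD2l.
  by rewrite ger0_norm ?divr_ge0 ?sqr_ge0// ler_pdivrMr.
have e10 : 0 <= e1 by exact: le_trans (normr_ge0 _) r2.
have /andP[r21 r22] : 1 - e1 <= r ^+ 2 <= 1 + e1 by rewrite -ler_distl.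
have rhalf : 2^-1 <= r.
  rewrite -(@ler_pXn2r _ 2)// ?nnegrE ?invr_ge0//; apply: le_trans r21; rewrite expr2; lra.
have rp : 0 < r by apply: lt_le_trans rhalf; rewrite invr_gt0.
have resp : 0 < res.
  by rewrite lt_def fnorm_ge0 andbT; apply: contraTneq rp => e; rewrite /r e mul0r ltxx.
split.
  have -> : (s / res) *: w - xi = r^-1 *: ((s / eta) *: (w - zeta)) + (r^-1 - 1) *: xi.
    rewrite !scalerBr scalerA scalerBl scale1r -/xi addrA subrK.
    by congr (_ *: _ - _); rewrite /r; field; rewrite !gt_eqF.
  apply: le_trans (fnormD _ _) _; rewrite mulrDl; apply: lerD; rewrite fnormZ.
    rewrite [fnorm ((s / eta) *: _)]fnormZ (gtr0_norm (_ : 0 < r^-1)) ?invr_gt0// gtr0_norm ?divr_gt0//.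
    have rinv : r^-1 <= 2 by rewrite invf_ple ?posrE.
    have : s / eta * fnorm (w - zeta) <= 2 * f * fnorm xi.
      rewrite /xi fnormZ -/eta gtr0_norm ?divr_gt0// mulrCA ler_wpM2l//.
      by rewrite divr_ge0 ?ltW.
    have : 0 <= s / eta * fnorm (w - zeta) by rewrite mulr_ge0 ?fnorm_ge0// divr_ge0 ?ltW.
    set a := _ / _ * _ => a0 ab.
    apply: (@le_trans _ _ (2 * a)); first by rewrite ler_wpM2r.
    lra.
  rewrite ler_wpM2r ?fnorm_ge0//.
  have -> : r^-1 - 1 = (1 - r) / r by field; rewrite gt_eqF.
  rewrite normrM normfV (gtr0_norm rp) ler_pdivrMr//.
  have h1 : `|1 - r| <= `|r ^+ 2 - 1|.
    have -> : r ^+ 2 - 1 = (r + 1) * (r - 1) by ring.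
    rewrite normrM distrC ler_peMl// ger0_norm ?addr_ge0// lerDr.
    exact: r0.
  apply: le_trans h1 _; apply: le_trans r2 _.
  nra.
move=> u; rewrite fnormZ exprMn real_normK ?num_real// fnorm2.
have -> : fdot (sqrtmx G *m u) (sqrtmx G *m u) = fdot u (G *m u).
  by rewrite fdotMl (proj1 Np) mulmxA NN.
have h := form_sketch_gram XQ u F2.
have -> : 4 * (s ^+ 2 * fdot (X *m u) (X *m u) / eta ^+ 2) =
   (s / res) ^+ 2 * (4 * r ^+ 2 * fdot (X *m u) (X *m u)).
  by rewrite /r; field; rewrite !gt_eqF.
rewrite ler_wpM2l ?sqr_ge0//; apply: le_trans h _.
rewrite ler_wpM2r ?fdot_ge0//; lra.
Qed.

End PartOneEstimate.

(** * Deterministic estimate for the partially sketched estimator *)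

(** With h = R0 beta_pa and F = (S Q)^T S Q - 1 one has h = g - F h, where
    g = Q^T y = R0 ols. The matrix W is therefore close to
    W0 = R0^-1 (|g|^2 + a g g^T) R0^-1, and W^(-1/2) (beta_pa - ols) is close to
    - W0^(-1/2) R0^-1 F g. *)
Section PartTwoEstimate.
Context {R : realType} {m n q : nat}.
Variables (S : 'M[R]_(m, n)) (X Q : 'M[R]_(n, q.+1)) (R0 : 'M[R]_q.+1) (lam K : R).
Hypothesis XQ : polar X Q R0 lam K.
Variables (y : 'cV[R]_n) (a s : R).
Hypothesis a1 : 1 <= a.

Let F := (S *m Q)^T *m (S *m Q) - 1%:M.
Let f := fnorm F.
Let G := sketch_gram S X.
Let g : 'cV[R]_q.+1 := Q^T *m y.
Let gam := fnorm g.
Let b := beta_pa S X y.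
Let W := enorm (S *m X *m b) ^+ 2 *: invmx G + a *: (b *m b^T).
Let W0 := invmx R0 *m (gam ^+ 2 *: 1%:M + a *: (g *m g^T)) *m invmx R0.
Let N0 := sqrtmx W0.
Let c1 : R := fnorm (1%:M : 'M[R]_q.+1).

Hypothesis gam0 : 0 < gam.

Let R0T : R0^T = R0. Proof. by case: XQ => _ _ [[]]. Qed.
Let lam0 : 0 < lam. Proof. by case: XQ => _ _ []. Qed.
Let uR0 : R0 \in unitmx. Proof. exact: polar_unit XQ. Qed.
Let R0iT : (invmx R0)^T = invmx R0. Proof. by rewrite trmx_inv R0T. Qed.
Let R0K : fnorm R0 <= K * lam. Proof. by case: XQ. Qed.
Let a0 : 0 <= a. Proof. exact: le_trans a1. Qed.

Let XTy : X^T *m y = R0 *m g.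
Proof. by case: XQ => -> _ _ _ _; rewrite trmx_mul R0T /g mulmxA. Qed.

Lemma ols_polar : R0 *m ols X y = g.
Proof.
rewrite /ols (gram_polar XQ) XTy.
have u2 : R0 *m R0 \in unitmx by rewrite unitmx_mul uR0.
apply: (can_inj (mulKmx uR0)); rewrite mulmxA mulKVmx//.
Qed.

Lemma gam_polar : gam = fnorm (X *m ols X y).
Proof.
have e : X *m ols X y = Q *m g by case: XQ => {1}-> _ _ _ _; rewrite -mulmxA ols_polar.
by rewrite e fnorm_isometry//; case: XQ.
Qed.

Let fR0i k (M : 'M[R]_(q.+1, k)) : fnorm (invmx R0 *m M) <= fnorm M / lam.
Proof. exact: fnorm_inv_le lam0 (polar_lower XQ). Qed.

Let c1_ge1 : 1 <= c1.
Proof.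
rewrite /c1 -(@ler_pXn2r _ 2)// ?nnegrE ?fnorm_ge0// fnorm2 expr1n.
by rewrite /fdot trmx1 mulmx1 mxtrace1 ler1n.
Qed.

Let K1 : 1 <= K.
Proof.
have := polar_lower XQ (delta_mx 0 0).
have -> : fnorm (delta_mx 0 0 : 'cV[R]_q.+1) = 1.
  by rewrite /fnorm /fdot trmx_delta mul_delta_mx /mxtrace big_ord1 mxE !eqxx sqrtr1.
rewrite mulr1 => h; have := fnormM R0 (delta_mx 0 0 : 'cV[R]_q.+1).
have -> : fnorm (delta_mx 0 0 : 'cV[R]_q.+1) = 1.
  by rewrite /fnorm /fdot trmx_delta mul_delta_mx /mxtrace big_ord1 mxE !eqxx sqrtr1.
rewrite mulr1 => h'; have := le_trans (le_trans h h') R0K.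
by rewrite -{1}[lam]mul1r ler_pM2r.
Qed.

Let Sig0 := gam ^+ 2 *: 1%:M + a *: (g *m g^T).

Let Sig0_form (v : 'cV[R]_q.+1) : fdot v (Sig0 *m v) = gam ^+ 2 * fdot v v + a * fdot v g ^+ 2.
Proof.
rewrite mulmxDl -!scalemxAl mul1mx fdotDr !fdotZr -mulmxA.
have -> : g^T *m v = (fdot g v)%:M.
  by apply/matrixP => i j; rewrite !ord1 !mxE eqxx mulr1n /fdot /mxtrace big_ord1 mxE.
by rewrite mul_mx_scalar fdotZr (fdotC g) expr2.
Qed.

Let Sig0_psd : is_psd Sig0.
Proof.
apply: psdD; first by apply: psdZ; [exact: sqr_ge0|exact: psd1].
by apply: psdZ => //; rewrite -{1}[g]trmxK; exact: psd_gram.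
Qed.

Let W0_psd : is_psd W0.
Proof. by rewrite /W0 -{1}R0iT; exact: psd_congr. Qed.

Let N0N0 : N0 *m N0 = W0. Proof. exact: sqrtmx_sqr. Qed.
Let N0_psd : is_psd N0. Proof. exact: sqrtmx_psd. Qed.

Let lam2 := gam / (K * lam).
Let lam2_gt0 : 0 < lam2.
Proof. by rewrite divr_gt0// mulr_gt0// (lt_le_trans ltr01). Qed.

Let W0_form (v : 'cV[R]_q.+1) : fdot v (W0 *m v) =
  gam ^+ 2 * fnorm (invmx R0 *m v) ^+ 2 + a * fdot (invmx R0 *m v) g ^+ 2.
Proof.
have -> : W0 *m v = invmx R0 *m (Sig0 *m (invmx R0 *m v)) by rewrite /W0 !mulmxA.
by rewrite fnorm2 -Sig0_form [LHS]fdotMr R0iT.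
Qed.

Let N0_lower_norm (v : 'cV[R]_q.+1) : lam2 * fnorm v <= fnorm (N0 *m v).
Proof.
have lam2_ge0 := ltW lam2_gt0.
rewrite -(@ler_pXn2r _ 2)// ?nnegrE ?(mulr_ge0 lam2_ge0) ?fnorm_ge0//.
rewrite [leRHS]fnorm2 fdotMl (proj1 N0_psd) mulmxA N0N0 W0_form.
have h : fnorm v <= K * lam * fnorm (invmx R0 *m v).
  rewrite -{1}[v](mulKVmx uR0); apply: le_trans (fnormM _ _) _.
  by rewrite ler_wpM2r ?fnorm_ge0.
have kl : 0 < K * lam by rewrite mulr_gt0// (lt_le_trans ltr01).
have h2 : lam2 * fnorm v <= gam * fnorm (invmx R0 *m v).
  by rewrite /lam2 mulrAC ler_pdivrMr// -mulrA ler_pM2l// mulrC.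
apply: (@le_trans _ _ ((gam * fnorm (invmx R0 *m v)) ^+ 2)).
  by rewrite lerXn2r// nnegrE; [exact: (mulr_ge0 lam2_ge0 (fnorm_ge0 _))|
    exact: (mulr_ge0 (ltW gam0) (fnorm_ge0 _))].
by rewrite exprMn lerDl mulr_ge0// sqr_ge0.
Qed.

Let N0_lower (v : 'cV[R]_q.+1) : lam2 * fdot v v <= fdot v (N0 *m v).
Proof. exact: psd_lower N0_psd lam2_gt0 N0_lower_norm. Qed.

Let uN0 : N0 \in unitmx. Proof. exact: unitmx_lower lam2_gt0 N0_lower_norm. Qed.

(** The leading term, linear in the sketching error F. *)
Definition pa_limit : 'cV[R]_q.+1 := - (s *: (invmx N0 *m (invmx R0 *m (F *m g)))).
Let xi := pa_limit.

Let N0xi : N0 *m xi = - (s *: (invmx R0 *m (F *m g))).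
Proof. by rewrite /xi /pa_limit mulmxN -scalemxAr mulKVmx. Qed.

Let R0N0 : fnorm (R0 *m N0) <= gam * (c1 + a).
Proof.
have c0 : 0 <= c1 by exact: fnorm_ge0.
rewrite -(@ler_pXn2r _ 2)// ?nnegrE ?mulr_ge0 ?fnorm_ge0 ?addr_ge0 ?(ltW gam0)//.
have RR (Z : 'M[R]_q.+1) : R0 *m (invmx R0 *m Z *m invmx R0 *m R0) = Z.
  by rewrite mulmxKV// mulKVmx.
rewrite fnorm2 /fdot trmx_mul (proj1 N0_psd) R0T mxtrace_mulC -mulmxA (mulmxA N0) N0N0 /W0 RR.
rewrite linearD !linearZ /= (mxtrace_mulC g).
have -> : \tr (1%:M : 'M[R]_q.+1) = c1 ^+ 2 by rewrite fnorm2 /fdot trmx1 mulmx1.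
have -> : \tr (g^T *m g) = gam ^+ 2 by rewrite fnorm2.
rewrite exprMn [leLHS]addrC -[a * _]mulrC -mulrDr ler_wpM2l ?sqr_ge0//.
have : 0 <= c1 * a by rewrite mulr_ge0.
have : a <= a ^+ 2 by rewrite expr2 ler_peMr.
rewrite sqrrD; lra.
Qed.

Lemma part2_estimate : (6 * c1 + 6 * a) * f * K ^+ 2 <= 2^-1 -> f <= 8^-1 ->  0 < s ->
  fnorm (s *: (invsqrtmx W *m (b - ols X y)) - xi) <=
     (2 * ((6 * c1 + 6 * a) * K ^+ 2) + 4 * K * (c1 + a)) * f * fnorm xi /\
  forall u : 'cV[R]_q.+1, fnorm (s *: (invsqrtmx W *m u)) ^+ 2 <=
    6 * (s ^+ 2 * fdot (X *m u) (X *m u) / gam ^+ 2).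
Proof.
move=> fC f8 s0.
have f0 : 0 <= f by exact: fnorm_ge0.
have c0 : 0 <= c1 by exact: fnorm_ge0.
have IFl (v : 'cV[R]_q.+1) : 2^-1 * fnorm v <= fnorm ((1%:M + F) *m v).
  have h1 : fnorm v <= fnorm ((1%:M + F) *m v) + fnorm (F *m v).
    rewrite -[fnorm (F *m v)]fnormN; apply: le_trans (fnormD _ _).
    by rewrite mulmxDl mul1mx addrK.
  have h2 : fnorm (F *m v) <= 8^-1 * fnorm v.
    by apply: le_trans (fnormM _ _) _; rewrite ler_wpM2r ?fnorm_ge0.
  have := fnorm_ge0 v; lra.
have half0 : 0 < 2^-1 :> R by rewrite invr_gt0.
have uIF : 1%:M + F \in unitmx := unitmx_lower half0 IFl.
have GE : G = R0 *m (1%:M + F) *m R0 := sketch_gram_polar S XQ.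
have uG : G \in unitmx by rewrite GE !unitmx_mul uR0 uIF.
have Gp : is_psd G by exact: psd_gram.
pose h := R0 *m b.
have Gb : G *m b = R0 *m g by rewrite /b /beta_pa XTy mulKVmx.
have hE : (1%:M + F) *m h = g.
  by apply: (can_inj (mulKmx uR0)); rewrite -Gb GE /h !mulmxA.
have hgF : h - g = - (F *m h) by rewrite -hE mulmxDl mul1mx opprD addrA subrr add0r.
have h2 : fnorm h <= 2 * gam.
  by have := IFl h; rewrite hE -ler_pdivlMl// invrK.
have hg : fnorm (h - g) <= 2 * f * gam.
  rewrite hgF fnormN; apply: le_trans (fnormM _ _) _.
  by have := ler_wpM2l f0 h2; rewrite mulrCA mulrA.
pose J := R0 *m invmx G *m R0.
have JE : (1%:M + F) *m J = 1%:M.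
  apply: (can_inj (mulKmx uR0)); rewrite mulmx1 /J.
  have -> : R0 *m ((1%:M + F) *m (R0 *m invmx G *m R0)) = (R0 *m (1%:M + F) *m R0) *m (invmx G *m R0).
    by rewrite !mulmxA.
  by rewrite -GE mulKVmx.
have J2 : fnorm J <= 2 * c1.
  by have := fnorm_lower J (ltW half0) IFl; rewrite JE -/c1 -ler_pdivlMl// invrK.
have J1 : fnorm (J - 1%:M) <= 2 * f * c1.
  have -> : J - 1%:M = - (F *m J).
    by rewrite -[in LHS]JE mulmxDl mul1mx opprD addrA subrr add0r.
  rewrite fnormN; apply: le_trans (fnormM _ _) _.
  by have := ler_wpM2l f0 J2; rewrite mulrCA mulrA.
pose sW := enorm (S *m X *m b) ^+ 2.
have sWE : sW = fdot h g.
  rewrite /sW enormE fnorm2 fdotMl mulmxA -/(sketch_gram S X) -/G Gb.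
  by rewrite fdotMr R0T.
have sWg : `|sW - gam ^+ 2| <= 2 * f * gam ^+ 2.
  have -> : sW - gam ^+ 2 = fdot (h - g) g by rewrite sWE fnorm2 fdotDl fdotNl.
  apply: le_trans (fdot_CS _ _) _; rewrite -/gam expr2 mulrA.
  by rewrite ler_wpM2r ?(ltW gam0).
pose M := sW *: J + a *: (h *m h^T) - Sig0.
have Mle : fnorm M <= (6 * c1 + 6 * a) * f * gam ^+ 2.
  have -> : M = ((sW - gam ^+ 2) *: J + gam ^+ 2 *: (J - 1%:M)) +
      a *: ((h - g) *m h^T + g *m (h - g)^T).
    have -> : (h - g) *m h^T + g *m (h - g)^T = h *m h^T - g *m g^T.
      have -> : (h - g)^T = h^T - g^T by rewrite linearB.
      by rewrite mulmxBl mulmxBr addrA subrK.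
    have -> : (sW - gam ^+ 2) *: J + gam ^+ 2 *: (J - 1%:M) = sW *: J - gam ^+ 2 *: 1%:M.
      by rewrite scalerBl scalerBr addrA subrK.
    by rewrite /M /Sig0 scalerBr opprD addrACA.
  apply: le_trans (fnormD _ _) _.
  have -> : (6 * c1 + 6 * a) * f * gam ^+ 2 = 6 * c1 * f * gam ^+ 2 + a * (6 * f * gam ^+ 2) by ring.
  apply: lerD.
    apply: le_trans (fnormD _ _) _; rewrite !fnormZ (ger0_norm (sqr_ge0 _)).
    have p1 : `|sW - gam ^+ 2| * fnorm J <= (2 * f * gam ^+ 2) * (2 * c1).
      by rewrite ler_pM ?fnorm_ge0.
    have p2 : gam ^+ 2 * fnorm (J - 1%:M) <= gam ^+ 2 * (2 * f * c1).
      by rewrite ler_wpM2l ?sqr_ge0.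
    apply: le_trans (lerD p1 p2) _.
    by rewrite le_eqVlt; apply/orP; left; apply/eqP; ring.
  rewrite fnormZ ger0_norm// ler_wpM2l//.
  apply: le_trans (fnormD _ _) _.
  have p1 : fnorm ((h - g) *m h^T) <= (2 * f * gam) * (2 * gam).
    by apply: le_trans (fnormM _ _) _; rewrite fnormT ler_pM ?fnorm_ge0.
  have p2 : fnorm (g *m (h - g)^T) <= gam * (2 * f * gam).
    by apply: le_trans (fnormM _ _) _; rewrite fnormT ler_wpM2l ?(ltW gam0).
  apply: le_trans (lerD p1 p2) _.
  by rewrite le_eqVlt; apply/orP; left; apply/eqP; ring.
have WE : W - W0 = invmx R0 *m M *m invmx R0.
  rewrite /M /W0 -/Sig0 !mulmxBr !mulmxBl; congr (_ - _).
  rewrite mulmxDr mulmxDl /W -/sW; congr (_ + _).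
    rewrite -scalemxAr -scalemxAl; congr (_ *: _).
    by rewrite /J -mulmxA mulKmx// -mulmxA mulmxV// mulmx1.
  rewrite -scalemxAr -scalemxAl; congr (_ *: _).
  have hT : h^T = b^T *m R0 by rewrite /h [(R0 *m b)^T]trmx_mul R0T.
  have hh : h *m h^T = R0 *m (b *m b^T) *m R0 by rewrite hT /h !mulmxA.
  by rewrite hh -(mulmxA R0) mulKmx// mulmxK.
pose delta := (6 * c1 + 6 * a) * f * gam ^+ 2 / lam ^+ 2.
have Wd : fnorm (W - W0) <= delta.
  rewrite WE -mulmxA; apply: le_trans (fR0i _) _.
  rewrite -fnormT trmx_mul R0iT /delta [lam ^+ 2]expr2 invfM mulrA ler_wpM2r ?invr_ge0 ?(ltW lam0)//.
  by apply: le_trans (fR0i _) _; rewrite fnormT ler_wpM2r ?invr_ge0 ?(ltW lam0).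
(* With z = J x one has |x| <= 9/8 |z| and x . z >= 7/8 |z|^2, which gives more
   than the constant 2/9. *)
have Gi_form (v : 'cV[R]_q.+1) : 9^-1 * 2 * fnorm (invmx R0 *m v) ^+ 2 <= fdot v (invmx G *m v).
  pose x := invmx R0 *m v; pose z := J *m x.
  have zx : (1%:M + F) *m z = x by rewrite /z mulmxA JE mul1mx.
  have -> : fdot v (invmx G *m v) = fdot x z.
    by rewrite /z /J /x fdotMl R0iT -!mulmxA mulKVmx// mulKmx.
  have xz : fnorm x <= 9 / 8 * fnorm z.
    rewrite -zx mulmxDl mul1mx; apply: le_trans (fnormD _ _) _.
    have : fnorm (F *m z) <= 8^-1 * fnorm z.
      by apply: le_trans (fnormM _ _) _; rewrite ler_wpM2r ?fnorm_ge0.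
    lra.
  have zz : 7 / 8 * fnorm z ^+ 2 <= fdot x z.
    rewrite -zx mulmxDl mul1mx fdotDl fnorm2.
    have : - fdot (F *m z) z <= 8^-1 * fdot z z.
      apply: le_trans (ler_norm _) _; rewrite normrN; apply: le_trans (fdot_CS _ _) _.
      rewrite -fnorm2 expr2 mulrA ler_wpM2r ?fnorm_ge0//.
      by apply: le_trans (fnormM _ _) _; rewrite ler_wpM2r ?fnorm_ge0.
    lra.
  have x2 : fnorm x ^+ 2 <= (9 / 8) ^+ 2 * fnorm z ^+ 2.
    by rewrite -exprMn lerXn2r ?nnegrE ?mulr_ge0 ?fnorm_ge0.
  have := sqr_ge0 (fnorm z); rewrite -/x; lra.
have Wp : is_psd W.
  apply: psdD.
    apply: psdZ; first exact: sqr_ge0.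
    apply/psdP; split; first by rewrite trmx_inv (proj1 Gp).
    move=> v; apply: le_trans (Gi_form v).
    by apply: mulr_ge0; [apply: mulr_ge0 => //; rewrite invr_ge0|exact: sqr_ge0].
  by apply: psdZ => //; rewrite -{1}[b]trmxK; exact: psd_gram.
pose N := sqrtmx W.
have NN : N *m N = W by exact: sqrtmx_sqr.
have Np : is_psd N by exact: sqrtmx_psd.
have Kp : 0 < K by exact: lt_le_trans ltr01 K1.
have lam22 : lam2 ^+ 2 = gam ^+ 2 / (K ^+ 2 * lam ^+ 2).
  by rewrite /lam2 expr_div_n exprMn.
have d2 : delta <= lam2 ^+ 2 / 2.
  rewrite lam22 /delta.
  have -> : (6 * c1 + 6 * a) * f * gam ^+ 2 / lam ^+ 2 =
    ((6 * c1 + 6 * a) * f * K ^+ 2) * (gam ^+ 2 / (K ^+ 2 * lam ^+ 2)).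
    by field; rewrite !gt_eqF.
  rewrite [leRHS]mulrC; apply: ler_wpM2r => //.
  by apply: divr_ge0; [exact: sqr_ge0|apply: mulr_ge0; exact: sqr_ge0].
have hd : fnorm (N *m N - N0 *m N0) <= delta by rewrite NN N0N0.
have [uN per] := sqrt_perturbation N0_psd Np lam2_gt0 N0_lower hd d2.
have FFh : F *m (F *m h) = F *m g - F *m h.
  by rewrite -mulmxBr; congr (_ *m _); rewrite -[LHS]opprK -hgF opprB.
split.
  set A := s *: _.
  pose r := s *: (invmx R0 *m (F *m (F *m h))).
  have NA : N *m A = N0 *m xi + r.
    rewrite /A -scalemxAr /invsqrtmx -/N mulKVmx// N0xi /r -scalerN -scalerDr.
    congr (_ *: _); apply: (can_inj (mulKmx uR0)).
    rewrite mulmxBr -/h ols_polar hgF mulmxDr mulmxN !mulKVmx//.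
    by rewrite FFh addrA addNr add0r.
  apply: le_trans (per _ _ _ NA) _.
  have Fh : fnorm (F *m h) <= 2 * fnorm (F *m g).
    have e : F *m h = F *m g - F *m (F *m h) by rewrite FFh opprB addrCA subrr addr0.
    have e1 : fnorm (F *m h) <= fnorm (F *m g) + 8^-1 * fnorm (F *m h).
      rewrite {1}e; apply: le_trans (fnormB _ _) _; rewrite lerD2l.
      by apply: le_trans (fnormM _ _) _; rewrite ler_wpM2r ?fnorm_ge0.
    have := fnorm_ge0 (F *m h); lra.
  have sFg : s * fnorm (F *m g) <= gam * (c1 + a) * fnorm xi.
    have -> : s * fnorm (F *m g) = fnorm (R0 *m (N0 *m xi)).
      by rewrite N0xi mulmxN fnormN -scalemxAr mulKVmx// fnormZ gtr0_norm.
    rewrite mulmxA; apply: le_trans (fnormM _ _) _.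
    by rewrite ler_wpM2r ?fnorm_ge0.
  have rle : fnorm r <= f / lam * (2 * (gam * (c1 + a) * fnorm xi)).
    rewrite /r fnormZ gtr0_norm//.
    apply: (@le_trans _ _ (s * (f * (2 * fnorm (F *m g)) / lam))).
      rewrite ler_wpM2l ?(ltW s0)//; apply: le_trans (fR0i _) _.
      rewrite ler_wpM2r ?invr_ge0 ?(ltW lam0)//; apply: le_trans (fnormM _ _) _.
      by rewrite ler_wpM2l.
    have -> : s * (f * (2 * fnorm (F *m g)) / lam) = f / lam * (2 * (s * fnorm (F *m g))) by ring.
    by rewrite ler_wpM2l ?divr_ge0 ?(ltW lam0)// ler_wpM2l.
  have -> : (2 * ((6 * c1 + 6 * a) * K ^+ 2) + 4 * K * (c1 + a)) * f * fnorm xi =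
     2 * delta / lam2 ^+ 2 * fnorm xi + 2 / lam2 * (f / lam * (2 * (gam * (c1 + a) * fnorm xi))).
    by rewrite lam22 /lam2 /delta; field; rewrite !gt_eqF.
  by rewrite lerD2l ler_wpM2l// divr_ge0// ltW.
move=> u; rewrite fnormZ exprMn real_normK ?num_real//.
have -> : 6 * (s ^+ 2 * fdot (X *m u) (X *m u) / gam ^+ 2) =
    s ^+ 2 * (6 * fdot (X *m u) (X *m u) / gam ^+ 2) by ring.
rewrite ler_wpM2l ?sqr_ge0//.
have -> : fdot (X *m u) (X *m u) = fnorm (R0 *m u) ^+ 2.
  by rewrite fnorm2; case: XQ => -> QQ _ _ _; rewrite -!mulmxA fdot_isometry.
pose w := invmx N *m u; pose x := invmx N *m w.
have Wx : W *m x = u by rewrite -NN -mulmxA /x mulKVmx// /w mulKVmx.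
have NiT : (invmx N)^T = invmx N by rewrite trmx_inv (proj1 Np).
have wE : fnorm w ^+ 2 = fdot u x by rewrite fnorm2 {1}/w fdotMl NiT.
have ux : fdot u x <= fnorm (R0 *m u) * fnorm (invmx R0 *m x).
  have -> : fdot u x = fdot (R0 *m u) (invmx R0 *m x).
    by rewrite fdotMl R0T mulKVmx.
  by apply: le_trans (ler_norm _) (fdot_CS _ _).
have ux2 : 6^-1 * (gam ^+ 2 * fnorm (invmx R0 *m x) ^+ 2) <= fdot u x.
  rewrite -[in leRHS]Wx fdotC /W -/sW mulmxDl fdotDr -!scalemxAl !fdotZr.
  have p1 : 3 / 4 * gam ^+ 2 <= sW.
    have := sWg; rewrite ler_norml => /andP[+ _].
    have : 2 * f * gam ^+ 2 <= 4^-1 * gam ^+ 2 by rewrite ler_wpM2r ?sqr_ge0//; lra.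
    lra.
  have p2 := Gi_form x.
  have p3 : 0 <= a * fdot x (b *m b^T *m x).
    rewrite mulr_ge0//; have : is_psd (b *m b^T) by rewrite -{1}[b]trmxK; exact: psd_gram.
    by case/psdP => _; apply.
  have p4 : 3 / 4 * gam ^+ 2 * (9^-1 * 2 * fnorm (invmx R0 *m x) ^+ 2) <= sW * fdot x (invmx G *m x).
    apply: ler_pM p1 p2; first by apply: mulr_ge0; [lra|exact: sqr_ge0].
    by apply: mulr_ge0; [lra|exact: sqr_ge0].
  apply: le_trans (ler_wpDr p3 p4).
  by rewrite le_eqVlt; apply/orP; left; apply/eqP; field.
rewrite -/N /invsqrtmx -/N -/w wE ler_pdivlMr ?exprn_gt0//.
set P1 := fnorm (R0 *m u) in ux *; set P2 := fnorm (invmx R0 *m x) in ux ux2.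
have P10 : 0 <= P1 by exact: fnorm_ge0. have P20 : 0 <= P2 by exact: fnorm_ge0.
have g2 : 0 < gam ^+ 2 by rewrite exprn_gt0.
have [->|P2n] := eqVneq (fdot u x) 0; first by rewrite mul0r mulr_ge0// sqr_ge0.
have uxp : 0 < fdot u x.
  by rewrite lt_def P2n -wE sqr_ge0.
rewrite -(ler_pM2l uxp).
apply: (@le_trans _ _ (P1 ^+ 2 * P2 ^+ 2 * gam ^+ 2)).
  by rewrite mulrA ler_wpM2r ?(ltW g2)// -expr2 -exprMn lerXn2r ?nnegrE ?mulr_ge0// ltW.
have -> : P1 ^+ 2 * P2 ^+ 2 * gam ^+ 2 = 6 * P1 ^+ 2 * (6^-1 * (gam ^+ 2 * P2 ^+ 2)) by field.
by rewrite [leRHS]mulrC ler_wpM2l// mulr_ge0// sqr_ge0.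
Qed.

(** The studentization matches the normalization of the one-dimensional limit
    theorem: with g0 = g / |g|, the image v of a unit vector c satisfies
    |v|^2 + a (v . g0)^2 = |c|^2 = 1, by the definition of W0. *)
Definition pa_dir (c : 'cV[R]_q.+1) : 'cV[R]_q.+1 :=
  - (gam *: (invmx R0 *m (invmx N0 *m c))).

Lemma pa_dir_norm (c : 'cV[R]_q.+1) : fnorm c = 1 ->
  fnorm (pa_dir c) ^+ 2 * (1 + a * fdot ((fnorm (pa_dir c))^-1 *: pa_dir c) (gam^-1 *: g) ^+ 2) = 1.
Proof.
move=> c_1; set v := pa_dir c.
have e : fnorm v ^+ 2 + a * fdot v (gam^-1 *: g) ^+ 2 = 1.
  have := W0_form (invmx N0 *m c).
  have N0iT : (invmx N0)^T = invmx N0 by rewrite trmx_inv (proj1 N0_psd).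
  rewrite fdotMl N0iT -N0N0 -(mulmxA N0) mulKVmx// mulKmx// -fnorm2 c_1 expr1n => ->.
  rewrite /v /pa_dir fnormN fnormZ fdotNl fdotZl fdotZr sqrrN gtr0_norm// exprMn.
  by rewrite mulrA divff ?gt_eqF// mul1r.
rewrite fdotZl exprMn mulrDr mulr1 -[in RHS]e; congr (_ + _).
have v0 : fnorm v != 0.
  apply: contra_eq_neq e => v0; rewrite v0 (fnorm_eq0 v0) /fdot trmx0 mul0mx mxtrace0.
  by rewrite expr0n /= mulr0 addr0 eq_sym oner_eq0.
by rewrite exprVn; field.
Qed.

Lemma pa_limit_proj (c : 'cV[R]_q.+1) :
  fdot c pa_limit = s * fdot (pa_dir c) (F *m (gam^-1 *: g)).
Proof.
have N0iT : (invmx N0)^T = invmx N0 by rewrite trmx_inv (proj1 N0_psd).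
rewrite /pa_limit /pa_dir fdotNr fdotNl fdotZr mulrN fdotZl -scalemxAr fdotZr.
rewrite (mulrA gam) divff ?gt_eqF// mul1r; congr (- (_ * _)).
by rewrite fdotMl R0iT fdotMl N0iT.
Qed.

End PartTwoEstimate.

(** * Limit theorems for a fixed data sequence *)

Lemma limn_esup_bounded {R : realType} (u : nat -> R) :
  (limn_esup (fun n => (u n)%:E) < +oo)%E -> exists c : R, \forall n \near \oo, u n <= c.
Proof.
move=> /ereal_inf_lt[_ [V hV <-] sup_lt].
exists (fine (ereal_sup [set (u n)%:E | n in V])).
apply: filterS hV => n Vn.
have le_sup : ((u n)%:E <= ereal_sup [set (u n)%:E | n in V])%E.
  by apply: ereal_sup_ubound; exists n.
rewrite -lee_fin fineK// fin_numElt sup_lt andbT.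
by apply: lt_le_trans le_sup; rewrite ltNyr.
Qed.

Section SketchedForms.
Context {d : measure_display} {T : measurableType d} {R : realType}.
Variable P : probability T R.
Context {q : nat}.
Variables (m : nat -> nat) (S : forall n, T -> 'M[R]_(m n, n)) (tau : nat -> R).
Variables (alpha : R) (frakP : vseq R -> vseq R -> Prop).
Hypothesis m_oo : m n @[n --> \oo] --> \oo.
Hypothesis mS : forall n, random_mx (S n).
Hypothesis tau0 : \forall n \near \oo, 0 < tau n.
Hypothesis taum : tau n / (m n)%:R @[n --> \oo] --> (0 : R).
Hypothesis alpha0 : 0 <= alpha.
Hypothesis onedim : cond_1dim P S tau alpha frakP.

Definition rate n : R := Num.sqrt (m n)%:R / Num.sqrt (tau n).

Lemma rate_gt0 : \forall n \near \oo, 0 < rate n.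
Proof.
have m1 : \forall n \near \oo, (1 <= m n)%N by exact: m_oo (nbhs_infty_ge 1).
by apply: filterS2 tau0 m1 => n t0 m0; rewrite divr_gt0 ?sqrtr_gt0// ltr0n.
Qed.

Lemma rate_inv_cvg0 : (rate n)^-1 @[n --> \oo] --> (0 : R).
Proof.
have h : Num.sqrt (tau n / (m n)%:R) @[n --> \oo] --> (0 : R).
  by rewrite -[X in _ --> X]sqrtr0; apply: continuous_cvg taum; exact: sqrt_continuous.
apply: cvg_trans h; apply: near_eq_cvg; apply: filterS tau0 => n t0.
by rewrite /rate invf_div sqrtrM ?(ltW t0)// sqrtrV.
Qed.

Let err n t (a a' : vseq R) := bilin_error (S n t) (a n) (a' n).

Lemma measurable_bilin_error n (a a' : 'cV[R]_n) :
  measurable_fun setT (fun t => bilin_error (S n t) a a').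
Proof.
rewrite /bilin_error; under eq_fun do rewrite !edotE.
apply: measurable_funB; last exact: measurable_cst.
by apply: measurable_fdot; apply: randomM => //; exact: random_cst.
Qed.

Lemma bilin_normal (a a' : vseq R) (Y : nat -> T -> R) :
  unit_vseq a -> unit_vseq a' -> frakP a a' ->
  (\forall n \near \oo, forall t, Y n t =
     rate n / Num.sqrt (1 + (alpha + 1) * edot (a n) (a' n) ^+ 2) * err n t a a') ->
  forall x, prob P [set t | Y n t <= x] @[n --> \oo] --> Phi x.
Proof.
move=> ua ua' faa hY x.
have mZ n : measurable_fun setT (fun t => rate n /
    Num.sqrt (1 + (alpha + 1) * edot (a n) (a' n) ^+ 2) * err n t a a').
  by apply: measurable_funM; [exact: measurable_cst|exact: measurable_bilin_error].
have h := @std_normal1P _ _ _ P _ mZ (onedim ua ua' faa) x.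
apply: cvg_trans h; apply: near_eq_cvg; apply: filterS hY => n hn.
by congr (prob P _); apply/seteqP; split => t /=; rewrite hn.
Qed.

(** The rate tends to infinity and the normalization is at most
    (1 + (alpha + 1))^(1/2), by Cauchy-Schwarz. *)
Lemma bilin_op1 (a a' : vseq R) : unit_vseq a -> unit_vseq a' -> frakP a a' ->
  op1 P (fun n t => err n t a a').
Proof.
move=> ua ua' faa.
pose w n := Num.sqrt (1 + (alpha + 1) * edot (a n) (a' n) ^+ 2).
have YO : Op1 P (fun n t => rate n / w n * err n t a a').
  apply: normal_Op1; last by apply: bilin_normal ua ua' faa _; exact: nearW.
  by move=> n; apply: measurable_funM; [exact: measurable_cst|exact: measurable_bilin_error].
have c0 : 0 <= Num.sqrt (1 + (alpha + 1)) by exact: sqrtr_ge0.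
have vc : (rate n)^-1 * Num.sqrt (1 + (alpha + 1)) @[n --> \oo] --> (0 : R).
  by rewrite -[X in _ --> X](mul0r (Num.sqrt (1 + (alpha + 1)))); apply: cvgMr_tmp; exact: rate_inv_cvg0.
apply: op1_le (op1M (op1_cst P vc) YO); apply: whp_near.
apply: filterS3 rate_gt0 ua ua' => n r0 an an' t.
have e1 : edot (a n) (a' n) ^+ 2 <= 1.
  rewrite edotE; apply: le_trans (fdot_CS2 _ _) _.
  by rewrite -!fnorm2 -!enormE an an' !expr1n mulr1.
have w0 : 0 < 1 + (alpha + 1) * edot (a n) (a' n) ^+ 2.
  by rewrite ltr_wpDr// mulr_ge0 ?sqr_ge0// addr_ge0.
have wp : 0 < w n by rewrite sqrtr_gt0.
have wle : w n <= Num.sqrt (1 + (alpha + 1)).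
  by rewrite ler_sqrt ?addr_ge0// lerD2l ler_piMr// addr_ge0.
have rw : 0 <= rate n / w n by rewrite divr_ge0// ltW.
have rc : 0 <= (rate n)^-1 * Num.sqrt (1 + (alpha + 1)) by rewrite mulr_ge0// invr_ge0 ltW.
rewrite [in leRHS]normrM (ger0_norm rc) [in leRHS]normrM (ger0_norm rw).
rewrite mulrA ler_peMl//.
have -> : (rate n)^-1 * Num.sqrt (1 + (alpha + 1)) * (rate n / w n) = Num.sqrt (1 + (alpha + 1)) / w n.
  by field; rewrite !gt_eqF.
by rewrite ler_pdivlMr// mul1r.
Qed.

End SketchedForms.

Section UnitVectors.
Context {R : realType} {k : nat}.

Definition unitize (v : 'cV[R]_k.+1) : 'cV[R]_k.+1 :=
  if v == 0 then delta_mx 0 0 else (fnorm v)^-1 *: v.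

Lemma fnorm_delta (i : 'I_k.+1) : fnorm (delta_mx i 0 : 'cV[R]_k.+1) = 1.
Proof. by rewrite /fnorm /fdot trmx_delta mul_delta_mx /mxtrace big_ord1 mxE !eqxx sqrtr1. Qed.

Lemma fnorm_unitize (v : 'cV[R]_k.+1) : fnorm (unitize v) = 1.
Proof.
rewrite /unitize; case: eqVneq => [_|v0]; first exact: fnorm_delta.
have n0 : fnorm v != 0 by apply: contra_neq v0; exact: fnorm_eq0.
by rewrite fnormZ ger0_norm ?invr_ge0 ?fnorm_ge0// mulVf.
Qed.

Lemma unitizeE (v : 'cV[R]_k.+1) : fnorm v != 0 -> unitize v = (fnorm v)^-1 *: v.
Proof. by rewrite /unitize; have [->|//] := eqVneq v 0; rewrite fnorm0 eqxx. Qed.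

Lemma fdot_delta (v : 'cV[R]_k.+1) (i : 'I_k.+1) : fdot (delta_mx i 0) v = v i 0.
Proof. by rewrite /fdot trmx_delta -rowE /mxtrace big_ord1 mxE. Qed.

Definition quad_form (F : 'M[R]_k.+1) (b : 'cV[R]_k.+1) : R := fdot b (F *m b).

(** Polarization. Unit vectors are used because the conditions on the sketch
    concern unit vectors only. *)
Lemma fnorm_le_forms (F : 'M[R]_k.+1) : F^T = F ->
  fnorm F <= \sum_i \sum_j
    (`|2 * quad_form F (unitize (delta_mx i 0 + delta_mx j 0))| +
     (`|quad_form F (delta_mx i 0)| + `|quad_form F (delta_mx j 0)|)).
Proof.
move=> FT; apply: le_trans (fnorm_le_sum _) _; rewrite /quad_form; apply: ler_sum => i _; apply: ler_sum => j _.
have Fij a b : fdot (delta_mx a 0 : 'cV[R]_k.+1) (F *m delta_mx b 0) = F a b.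
  by rewrite fdot_delta -colE mxE.
have Fji : F j i = F i j by rewrite -{1}FT mxE.
set v := delta_mx i 0 + delta_mx j 0 : 'cV[R]_k.+1.
have v2 : fnorm v ^+ 2 <= 4.
  rewrite (_ : 4 = 2 ^+ 2); last by ring.
  rewrite lerXn2r ?nnegrE ?fnorm_ge0//; apply: le_trans (fnormD _ _) _.
  by rewrite !fnorm_delta.
have v0 : fnorm v != 0.
  apply/eqP => /fnorm_eq0 /(congr1 (fun w : 'cV[R]_k.+1 => w i 0)).
  rewrite !mxE !eqxx andbT => /eqP; rewrite paddr_eq0 ?oner_eq0//.
have e : fnorm v ^+ 2 * fdot (unitize v) (F *m unitize v) = F i i + F j j + 2 * F i j.
  rewrite unitizeE// -scalemxAr fdotZl fdotZr.
  transitivity (fdot v (F *m v)); first by field.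
  rewrite /v mulmxDr fdotDl !fdotDr !Fij Fji; ring.
rewrite !Fij; set z := fdot (unitize v) _ in e *.
have -> : F i j = (fnorm v ^+ 2 / 4) * (2 * z) - (F i i + F j j) / 2.
  have -> : fnorm v ^+ 2 / 4 * (2 * z) = (fnorm v ^+ 2 * z) / 2 by field.
  by rewrite e; field.
have w0 : 0 <= fnorm v ^+ 2 / 4 by rewrite divr_ge0// sqr_ge0.
have w1 : fnorm v ^+ 2 / 4 <= 1 by rewrite ler_pdivrMr// mul1r.
apply: le_trans (ler_normB _ _) _; apply: lerD.
  by rewrite normrM (ger0_norm w0) ler_piMl.
rewrite normrM; apply: (@le_trans _ _ `|F i i + F j j|); last exact: ler_normD.
by rewrite ler_piMr// ger0_norm ?invr_ge0// invf_le1// ler1n.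
Qed.

End UnitVectors.

Section NormalApproximation.
Context {d : measure_display} {T : measurableType d} {R : realType}.
Variable P : probability T R.
Context {q : nat}.
Variable xi : nat -> T -> 'cV[R]_q.+1.
Hypothesis mxi : forall n, random_mx (xi n).
Hypothesis xi_proj : forall c : 'cV[R]_q.+1, fnorm c = 1 ->
  forall x, prob P [set t | fdot c (xi n t) <= x] @[n --> \oo] --> Phi x.

Lemma fnorm_Op1 : Op1 P (fun n t => fnorm (xi n t)).
Proof.
have h : Op1 P (fun n t => \sum_(i < q.+1) `|xi n t i 0|).
  apply: Op1_sum => i.
  have h : Op1 P (fun n t => fdot (delta_mx i 0) (xi n t)).
    apply: normal_Op1; last by apply: xi_proj; exact: fnorm_delta.
    by move=> n; apply: measurable_fdot => //; exact: random_cst.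
  by apply: Op1_le h => n t; rewrite fdot_delta normr_id.
apply: Op1_le h => n t; rewrite ger0_norm ?fnorm_ge0//; apply: le_trans (ler_norm _).
by apply: le_trans (fnorm_le_sum _) _; apply: ler_sum => i _; rewrite big_ord1.
Qed.

(** A relative error o_P(1) is an absolute error o_P(1), by tightness. *)
Lemma normal_relative_error (A : nat -> T -> 'cV[R]_q.+1) (delta : nat -> T -> R) :
  (forall n, random_mx (A n)) -> op1 P delta ->
  whp P (fun n t => fnorm (A n t - xi n t) <= delta n t * fnorm (xi n t)) ->
  cvg_std_normal P A.
Proof.
move=> mA d0 h; apply: (slutsky mxi mA).
  by apply: cramer_wold => // c c1; apply: xi_proj; rewrite -enormE.
move=> eps e0; have h2 := op1M d0 fnorm_Op1 e0.
apply: whpS (whpI h h2) => n t [h3 h4] i.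
apply: le_trans (le_trans (ler_norm _) h4); apply: le_trans h3.
by apply: le_trans (fnorm_entry _ i 0); rewrite !mxE.
Qed.

End NormalApproximation.

Lemma psd_invmx {R : realType} {k : nat} (G : 'M[R]_k) : is_psd G -> is_psd (invmx G).
Proof.
move=> Gp; have [uG|uG] := boolP (G \in unitmx); last by rewrite /invmx (negbTE uG).
have := psd_congr (invmx G) Gp; rewrite trmx_inv (proj1 Gp).
by rewrite mulVmx// mul1mx.
Qed.

Lemma residual_polar {R : realType} {n q : nat} (X Q : 'M[R]_(n, q.+1)) (R0 : 'M[R]_q.+1)
    (lam K : R) (y : 'cV[R]_n) :
  polar X Q R0 lam K -> Q^T *m residual X y = 0.
Proof.
move=> XQ; have uR0 := polar_unit XQ.
rewrite /residual mulmxBr; apply/eqP; rewrite subr_eq0; apply/eqP.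
case: (XQ) => e QQ _ _ _; rewrite {1}e (mulmxA Q^T) (mulmxA Q^T) QQ mul1mx.
by rewrite (ols_polar XQ).
Qed.

Section RandomEstimators.
Context {d : measure_display} {T : measurableType d} {R : realType}.
Context {m n q : nat}.
Variables (S : T -> 'M[R]_(m, n)) (X : T -> 'M[R]_(n, q.+1)) (y : T -> 'cV[R]_n).
Variables (u : T -> 'cV[R]_q.+1) (s : R).
Hypotheses (mS : random_mx S) (mX : random_mx X) (my : random_mx y) (mu : random_mx u).

Lemma measurable_enorm k (v : T -> 'cV[R]_k) : random_mx v ->
  measurable_fun setT (fun t => enorm (v t)).
Proof. by move=> mv; under eq_fun do rewrite enormE; exact: measurable_fnorm. Qed.

Lemma random_ols k r (A : T -> 'M[R]_(k, r)) (z : T -> 'cV[R]_k) :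
  random_mx A -> random_mx z -> random_mx (fun t => ols (A t) (z t)).
Proof.
move=> mA mz; have mAT := randomT mA.
by apply: randomM; [apply: random_invmx|]; exact: randomM.
Qed.

Lemma random_residual k r (A : T -> 'M[R]_(k, r)) (z : T -> 'cV[R]_k) :
  random_mx A -> random_mx z -> random_mx (fun t => residual (A t) (z t)).
Proof. by move=> mA mz; apply: randomB => //; apply: randomM => //; exact: random_ols. Qed.

Lemma random_sketch_gram : random_mx (fun t => sketch_gram (S t) (X t)).
Proof. by apply: randomM; [apply: randomT|]; exact: randomM. Qed.

Lemma random_beta_s : random_mx (fun t => beta_s (S t) (X t) (y t)).
Proof. by apply: random_ols; exact: randomM. Qed.

Lemma random_beta_pa : random_mx (fun t => beta_pa (S t) (X t) (y t)).
Proof.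
apply: randomM; first by apply: random_invmx; exact: random_sketch_gram.
by apply: randomM => //; exact: randomT.
Qed.

Lemma random_studentized_s : random_mx (fun t =>
  (s / enorm (sketch_residual (S t) (X t) (y t))) *: (sqrtmx (sketch_gram (S t) (X t)) *m u t)).
Proof.
apply: randomZ.
  apply: measurable_funM; first exact: measurable_cst.
  apply: measurable_invr; apply: measurable_enorm; apply: random_residual; exact: randomM.
apply: randomM => //; apply: random_sqrtmx; last exact: random_sketch_gram.
by move=> t; exact: psd_gram.
Qed.

Lemma random_studentized_pa (a : R) : 0 <= a -> random_mx (fun t =>
  s *: (invsqrtmx (enorm (S t *m X t *m beta_pa (S t) (X t) (y t)) ^+ 2 *:
          invmx (sketch_gram (S t) (X t)) +
        a *: (beta_pa (S t) (X t) (y t) *m (beta_pa (S t) (X t) (y t))^T)) *m u t)).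
Proof.
move=> a0; have mb := random_beta_pa; have mG := random_sketch_gram.
apply: randomZ; first exact: measurable_cst.
apply: randomM => //; apply: random_invsqrtmx.
  move=> t; apply: psdD.
    by apply: psdZ; [exact: sqr_ge0|apply: psd_invmx; exact: psd_gram].
  by apply: psdZ => //; rewrite -{1}[beta_pa _ _ _]trmxK; exact: psd_gram.
apply: randomD; apply: randomZ.
- apply: measurable_funX; apply: measurable_enorm.
  by apply: randomM => //; exact: randomM.
- exact: random_invmx.
- exact: measurable_cst.
- by apply: randomM => //; exact: randomT.
Qed.

End RandomEstimators.

Section FixedDesign.
Context {d : measure_display} {T : measurableType d} {R : realType}.
Variable P : probability T R.
Context {q : nat}.
Variables (m : nat -> nat) (S : forall n, T -> 'M[R]_(m n, n)) (tau : nat -> R).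
Variables (alpha : R) (frakP : vseq R -> vseq R -> Prop).
Hypothesis m_oo : m n @[n --> \oo] --> \oo.
Hypothesis mS : forall n, random_mx (S n).
Hypothesis tau0 : \forall n \near \oo, 0 < tau n.
Hypothesis taum : tau n / (m n)%:R @[n --> \oo] --> (0 : R).
Hypothesis alpha0 : 0 <= alpha.
Hypothesis onedim : cond_1dim P S tau alpha frakP.
Variables (X U : forall n, 'M[R]_(n, q.+1)) (l : nat -> 'rV[R]_q.+1) (V : nat -> 'M[R]_q.+1).
Hypothesis svd : \forall n \near \oo, is_svd (X n) (U n) (l n) (V n).
Variable c : R.
Hypothesis condc : \forall n \near \oo, l n 0 ord0 / l n 0 ord_max <= c.

Let Q n := U n *m (V n)^T.
Let R0 n := V n *m diag_mx (l n) *m (V n)^T.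
Let lam n := l n 0 ord_max.
Let K := q.+1%:R * c.

Lemma near_polar : \forall n \near \oo, polar (X n) (Q n) (R0 n) (lam n) K.
Proof. by apply: filterS2 svd condc => n h1 h2; case: (svd_polar h1 h2). Qed.

(** The unit vector b' with U b' = Q b; it is a unit vector even for the n
    where V is not orthogonal. *)
Definition svd_dir (b : nat -> 'cV[R]_q.+1) n :=
  if (V n)^T *m V n == 1%:M then (V n)^T *m b n else b n.

Lemma svd_dir_unit (b : nat -> 'cV[R]_q.+1) :
  (forall n, fnorm (b n) = 1) -> forall n, enorm (svd_dir b n) = 1.
Proof.
move=> b1 n; rewrite enormE /svd_dir; case: ifPn => // /eqP VV.
by rewrite fnorm_isometry// trmxK; exact: mulmx1C.
Qed.

Lemma svd_dirE : \forall n \near \oo, forall b, U n *m svd_dir b n = Q n *m b n.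
Proof.
by apply: filterS svd => n [_ _ VV _ _] b; rewrite /svd_dir VV eqxx mulmxA.
Qed.

Lemma svd_dir_unit_vseq (b : nat -> 'cV[R]_q.+1) : (forall n, fnorm (b n) = 1) ->
  unit_vseq (fun n => U n *m svd_dir b n).
Proof.
move=> b1; apply: filterS svd => n [_ UU _ _ _].
by rewrite enormE fnorm_isometry// -enormE svd_dir_unit.
Qed.

Lemma bilin_errorQ : \forall n \near \oo, forall (A : 'M[R]_(m n, n)) b b',
  bilin_error A (U n *m svd_dir b n) (U n *m svd_dir b' n) =
  fdot (b n) (((A *m Q n)^T *m (A *m Q n) - 1%:M) *m b' n).
Proof.
apply: filterS2 near_polar svd_dirE => n [_ QQ _ _ _] h A b b'.
rewrite /bilin_error !edotE !h mulmxBl mul1mx fdotDr fdotNr; congr (_ - _).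
  by rewrite !mulmxA fdotMl !mulmxA.
by rewrite fdot_isometry.
Qed.

Hypothesis PU : forall b : nat -> 'cV[R]_q.+1, (forall n, enorm (b n) = 1) ->
  frakP (fun n => U n *m b n) (fun n => U n *m b n).

(** Each quadratic form of the sketching error is o_P(1) by the one-dimensional
    limit theorem for (U b, U b), and finitely many forms control the norm. *)
Lemma gram_op1 :
  op1 P (fun n t => fnorm ((S n t *m Q n)^T *m (S n t *m Q n) - 1%:M)).
Proof.
pose F n t := (S n t *m Q n)^T *m (S n t *m Q n) - 1%:M.
have quad (b : 'cV[R]_q.+1) : fnorm b = 1 -> op1 P (fun n t => quad_form (F n t) b).
  move=> b1; pose bb (_ : nat) := b.
  have ub : forall n, fnorm (bb n) = 1 by [].
  have h := bilin_op1 m_oo mS tau0 taum alpha0 onedim (svd_dir_unit_vseq ub)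
    (svd_dir_unit_vseq ub) (PU (svd_dir_unit ub)).
  apply: op1_le h; apply: whp_near; apply: filterS bilin_errorQ => n e t.
  by rewrite e /quad_form.
have op1_norm Y : op1 P Y -> op1 P (fun n t => `|Y n t|).
  by apply: op1_le; apply: whp_near; apply: nearW => n t; rewrite normr_id.
pose H n t := \sum_(i < q.+1) \sum_(j < q.+1)
  (`|2 * quad_form (F n t) (unitize (delta_mx i 0 + delta_mx j 0))| +
   (`|quad_form (F n t) (delta_mx i 0)| + `|quad_form (F n t) (delta_mx j 0)|)).
have hH : op1 P H.
  apply: op1_sum => i; apply: op1_sum => j; apply: op1D; last apply: op1D.
  - by apply/op1_norm/op1Z/quad; exact: fnorm_unitize.
  - by apply/op1_norm/quad; exact: fnorm_delta.
  - by apply/op1_norm/quad; exact: fnorm_delta.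
apply: op1_le hH; apply: whp_near; apply: nearW => n t.
rewrite ger0_norm ?fnorm_ge0//; apply: le_trans (ler_norm _).
by apply: fnorm_le_forms; rewrite linearB /= trmx_mul trmxK trmx1.
Qed.

Section PartOneFixed.
Variables (frakp : vseq R -> vseq R -> Prop) (y : vseq R).
Hypothesis bounded : cond_bounded P S tau frakp.

Let eps n := residual (X n) (y n).
Let eps1 : vseq R := fun n => normalized_residual (X n) (y n).
Hypothesis eps_neq0 : \forall n \near \oo, eps n != 0.
Hypothesis PUr : forall b : nat -> 'cV[R]_q.+1, (forall n, enorm (b n) = 1) ->
  frakP (fun n => U n *m b n) eps1.
Hypothesis prr : frakp eps1 eps1.

Let eps_gt0 : \forall n \near \oo, 0 < fnorm (eps n).
Proof.
apply: filterS eps_neq0 => n h; rewrite lt_def fnorm_ge0 andbT.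
by apply: contra_neq h; exact: fnorm_eq0.
Qed.

Let eps1_unit : unit_vseq eps1.
Proof.
apply: filterS eps_gt0 => n h.
by rewrite /eps1 /normalized_residual !enormE fnormZ ger0_norm ?invr_ge0 ?ltW// mulVf ?gt_eqF.
Qed.

Let Qeps : \forall n \near \oo, (Q n)^T *m eps n = 0.
Proof. by apply: filterS near_polar => n h; exact: (residual_polar (y n) h). Qed.

Let F n t := (S n t *m Q n)^T *m (S n t *m Q n) - 1%:M.
(** The leading term of the studentized error; its projection on b is the
    bilinear error of (Q b, eps / |eps|), two orthogonal unit vectors. *)
Let xi n t := (rate m tau n / fnorm (eps n)) *: ((S n t *m Q n)^T *m (S n t *m eps n)).

Let mSQ n : random_mx (fun t => S n t *m Q n).
Proof. by apply: randomM => //; exact: random_cst. Qed.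

Let mxi n : random_mx (xi n).
Proof.
apply: randomZ; first exact: measurable_cst.
by apply: randomM; [exact: randomT|apply: randomM => //; exact: random_cst].
Qed.

Let xi_proj (b : 'cV[R]_q.+1) : fnorm b = 1 ->
  forall x, prob P [set t | fdot b (xi n t) <= x] @[n --> \oo] --> Phi x.
Proof.
move=> b1 x; pose bb (_ : nat) := b; have ub n : fnorm (bb n) = 1 by [].
apply: (bilin_normal mS onedim (svd_dir_unit_vseq ub) eps1_unit (PUr (svd_dir_unit ub))).
near=> n.
have Q0 : (Q n)^T *m eps n = 0 by near: n.
have UQ : forall b, U n *m svd_dir b n = Q n *m b n by near: n; exact: svd_dirE.
move=> t.
have e0 : fdot (Q n *m b) (eps1 n) = 0.
  by rewrite /eps1 /normalized_residual fdotZr fdotMl -/(eps n) Q0 /fdot mulmx0 mxtrace0 mulr0.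
rewrite /bilin_error !edotE UQ e0 expr0n /= mulr0 addr0 sqrtr1 divr1 subr0.
rewrite /xi fdotZr -mulrA; congr (_ * _).
rewrite /eps1 /normalized_residual -/(eps n) enormE -scalemxAr fdotZr; congr (_ * _).
by rewrite (mulmxA (S n t)) [RHS]fdotMl.
Unshelve. all: by end_near. Qed.

Let err n t := fdot (S n t *m eps n) (S n t *m eps n) / fnorm (eps n) ^+ 2 - 1.

(** The condition on quadratic forms gives O_P(1) after multiplication by the
    rate, which tends to infinity. *)
Let err_op1 : op1 P err.
Proof.
have h := bounded eps1_unit eps1_unit prr.
pose w n t := bilin_error (S n t) (eps1 n) (eps1 n).
have w_op1 : op1 P w.
  move=> e e0 eta eta0; have [M hM] := h _ eta0.
  have /cvgrPdist_le/(_ (e / (`|M| + 1))) := rate_inv_cvg0 tau0 taum.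
  have M1 : 0 < `|M| + 1 by rewrite ltr_wpDl.
  move=> /(_ (divr_gt0 e0 M1)) hr.
  near=> n.
  have s0 : 0 < rate m tau n by near: n; exact: rate_gt0.
  have mB : measurable [set t | M < `|rate m tau n * w n t|].
    apply: measurable_ltr_set; first exact: measurable_cst.
    apply: measurableT_comp => //; apply: measurable_funM; first exact: measurable_cst.
    exact: measurable_bilin_error.
  exists [set t | M < `|rate m tau n * w n t|]; split=> //.
    by rewrite -lee_fin -probE// ltW//; near: n.
  move=> t /= /negP; rewrite -leNgt normrM (gtr0_norm s0) => h1.
  have h2 : (rate m tau n)^-1 <= e / (`|M| + 1).
    have : `|0 - (rate m tau n)^-1| <= e / (`|M| + 1) by near: n.
    by rewrite sub0r normrN ger0_norm ?invr_ge0 ?(ltW s0).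
  have -> : `|w n t| = (rate m tau n)^-1 * (rate m tau n * `|w n t|) by rewrite mulKf ?gt_eqF.
  have h3 : rate m tau n * `|w n t| <= `|M| + 1.
    by apply: le_trans h1 _; apply: le_trans (ler_norm _) _; rewrite lerDl.
  apply: le_trans (ler_pM _ _ h2 h3) _; rewrite ?invr_ge0 ?mulr_ge0 ?(ltW s0)//.
  by rewrite mulfVK ?gt_eqF.
apply: op1_le w_op1; apply: whp_near; apply: filterS2 eps1_unit eps_gt0 => n u e0 t.
have u1 : fdot (eps1 n) (eps1 n) = 1 by rewrite -fnorm2 -enormE u expr1n.
rewrite /err /w /bilin_error !edotE u1 /eps1 /normalized_residual -/(eps n) -scalemxAr fdotZl fdotZr enormE.
by rewrite expr2 invfM mulrC mulrA.
Unshelve. all: by end_near. Qed.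

(** The second part bounds the same studentization applied to any vector u; it
    is used for the estimation error of the full-data estimator. *)
Lemma beta_s_normal :
  cvg_std_normal P (fun n t =>
    (rate m tau n / enorm (sketch_residual (S n t) (X n) (y n))) *:
    (sqrtmx (sketch_gram (S n t) (X n)) *m
      (beta_s (S n t) (X n) (y n) - ols (X n) (y n)))) /\
  whp P (fun n t => forall u : 'cV[R]_q.+1,
    fnorm ((rate m tau n / enorm (sketch_residual (S n t) (X n) (y n))) *:
      (sqrtmx (sketch_gram (S n t) (X n)) *m u)) ^+ 2 <=
    4 * (rate m tau n ^+ 2 * fdot (X n *m u) (X n *m u) / fnorm (residual (X n) (y n)) ^+ 2)).
Proof.
have F_op1 : op1 P (fun n t => fnorm (F n t)) by exact: gram_op1.
have xi_Op1 := fnorm_Op1 mxi xi_proj.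
pose e1 n t := `|err n t| + 4 * fnorm (xi n t) ^+ 2 / rate m tau n ^+ 2.
have e1_op1 : op1 P e1.
  apply: op1D.
    by apply: op1_le err_op1; apply: whp_near; apply: nearW => n t; rewrite normr_id.
  have r2 : 4 * (rate m tau n)^-1 * (rate m tau n)^-1 @[n --> \oo] --> (0 : R).
    rewrite -[X in _ --> X](mulr0 (4 * 0)); apply: cvgM; last exact: rate_inv_cvg0.
    by apply: cvgM; [exact: cvg_cst|exact: rate_inv_cvg0].
  apply: op1_le (op1M (op1M (op1_cst P r2) xi_Op1) xi_Op1).
  apply: whp_near; apply: nearW => n t; rewrite le_eqVlt; apply/orP; left; apply/eqP; congr `|_|.
  by rewrite -exprVn; ring.
pose delta n t := 4 * (fnorm (F n t) * K ^+ 2) + 2 * e1 n t.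
have delta_op1 : op1 P delta.
  apply: op1D; last exact: op1Z.
  have h := op1Z (4 * K ^+ 2) F_op1.
  apply: op1_le h; apply: whp_near; apply: nearW => n t.
  by rewrite le_eqVlt; apply/orP; left; apply/eqP; congr `|_|; ring.
have half0 : 0 < 2^-1 :> R by rewrite invr_gt0.
have quarter0 : 0 < 4^-1 :> R by rewrite invr_gt0.
have good : whp P (fun n t => fnorm (F n t) * K ^+ 2 <= 2^-1 /\ fnorm (F n t) <= 2^-1 /\ e1 n t <= 4^-1).
  apply: whpI; last apply: whpI.
  - apply: whpS (op1Z (K ^+ 2) F_op1 half0) => n t h.
    by rewrite mulrC; apply: le_trans (ler_norm _) h.
  - by apply: whpS (F_op1 _ half0) => n t h; apply: le_trans (ler_norm _) h.
  - by apply: whpS (e1_op1 _ quarter0) => n t h; apply: le_trans (ler_norm _) h.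
pose A n t := (rate m tau n / enorm (sketch_residual (S n t) (X n) (y n))) *:
    (sqrtmx (sketch_gram (S n t) (X n)) *m (beta_s (S n t) (X n) (y n) - ols (X n) (y n))).
have est : whp P (fun n t => fnorm (A n t - xi n t) <= delta n t * fnorm (xi n t) /\
  forall u : 'cV[R]_q.+1,
    fnorm ((rate m tau n / enorm (sketch_residual (S n t) (X n) (y n))) *:
      (sqrtmx (sketch_gram (S n t) (X n)) *m u)) ^+ 2 <=
    4 * (rate m tau n ^+ 2 * fdot (X n *m u) (X n *m u) / fnorm (residual (X n) (y n)) ^+ 2)).
  apply: whp_imp good; near=> n.
  have pol : polar (X n) (Q n) (R0 n) (lam n) K by near: n; exact: near_polar.
  have e0 : 0 < fnorm (eps n) by near: n.
  have s0 : 0 < rate m tau n by near: n; exact: rate_gt0.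
  move=> t [h1 [h2 h3]].
  have := part1_estimate pol (ols (X n) (y n)) e0 s0 h1 h2 h3.
  have -> : X n *m ols (X n) (y n) + eps n = y n by rewrite /eps /residual addrC subrK.
  by rewrite /A enormE.
split; last by apply: whpS est => n t [].
apply: (normal_relative_error mxi xi_proj _ delta_op1); last by apply: whpS est => n t [].
move=> n; apply: random_studentized_s => //.
by apply: randomB; [apply: random_beta_s => //|]; exact: random_cst.
Unshelve. all: by end_near. Qed.

End PartOneFixed.

Section PartTwoFixed.
Variable y : vseq R.
Hypothesis Xy_neq0 : \forall n \near \oo, (X n)^T *m y n != 0.
Hypothesis PUU : forall b b' : nat -> 'cV[R]_q.+1,
  (forall n, enorm (b n) = 1) -> (forall n, enorm (b' n) = 1) ->
  frakP (fun n => U n *m b n) (fun n => U n *m b' n).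

Let a := alpha + 1.
Let a1 : 1 <= a. Proof. by rewrite /a lerDr. Qed.
Let g n := (Q n)^T *m y n.

Let g_gt0 : \forall n \near \oo, 0 < fnorm (g n).
Proof.
apply: filterS2 Xy_neq0 near_polar => n h [e _ [[R0T _] _] _ _].
rewrite lt_def fnorm_ge0 andbT; apply: contra_neq h => /fnorm_eq0.
by rewrite /g => g0; rewrite e trmx_mul R0T -mulmxA g0 mulmx0.
Qed.

Let F n t := (S n t *m Q n)^T *m (S n t *m Q n) - 1%:M.
Let xi n t := pa_limit (S n t) (Q n) (R0 n) (y n) a (rate m tau n).

Let mxi n : random_mx (xi n).
Proof.
have mSQ : random_mx (fun t => S n t *m Q n) by apply: randomM => //; exact: random_cst.
apply: randomN; apply: randomZ; first exact: measurable_cst.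
apply: randomM; first exact: random_cst.
apply: randomM; first exact: random_cst.
apply: randomM; last exact: random_cst.
by apply: randomB; [apply: randomM => //; exact: randomT|exact: random_cst].
Qed.

(** The projection on c is a bilinear error in the directions of v = pa_dir c and
    g, multiplied by |v|, and pa_dir_norm says that |v| is exactly the
    normalization of the one-dimensional limit theorem. *)
Let xi_proj (c0 : 'cV[R]_q.+1) : fnorm c0 = 1 ->
  forall x, prob P [set t | fdot c0 (xi n t) <= x] @[n --> \oo] --> Phi x.
Proof.
move=> c1 x.
pose v n := pa_dir (Q n) (R0 n) (y n) a c0.
pose b n := unitize (v n); pose b' n := unitize (g n).
have ub n : fnorm (b n) = 1 by exact: fnorm_unitize.
have ub' n : fnorm (b' n) = 1 by exact: fnorm_unitize.
apply: (bilin_normal mS onedim (svd_dir_unit_vseq ub) (svd_dir_unit_vseq ub')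
  (PUU (svd_dir_unit ub) (svd_dir_unit ub'))).
near=> n.
have pol : polar (X n) (Q n) (R0 n) (lam n) K by near: n; exact: near_polar.
have gn0 : 0 < fnorm (g n) by near: n.
have UQ : forall b, U n *m svd_dir b n = Q n *m b n by near: n; exact: svd_dirE.
have bE : forall (A : 'M[R]_(m n, n)) b b',
  bilin_error A (U n *m svd_dir b n) (U n *m svd_dir b' n) =
  fdot (b n) (((A *m Q n)^T *m (A *m Q n) - 1%:M) *m b' n).
  by near: n; exact: bilin_errorQ.
move=> t; rewrite bE edotE !UQ.
have QQ : (Q n)^T *m Q n = 1%:M by case: pol.
rewrite fdot_isometry// /xi (pa_limit_proj _ pol _ a1 gn0) -/(v n).
have := pa_dir_norm pol a1 gn0 c1; rewrite -/(v n).
have v0 : fnorm (v n) != 0.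
  apply: contra_eq_neq (pa_dir_norm pol a1 gn0 c1) => v0.
  by rewrite -/(v n) v0 expr0n /= mul0r eq_sym oner_eq0.
have vp : 0 < fnorm (v n) by rewrite lt_def v0 fnorm_ge0.
rewrite -[(fnorm (v n))^-1 *: v n]unitizeE// -[(fnorm _)^-1 *: ((Q n)^T *m y n)]unitizeE ?gt_eqF// => e.
rewrite -/(g n) -/(b n) -/(b' n) in e *.
set w := 1 + _ in e *.
have -> : (Num.sqrt w)^-1 = fnorm (v n).
  have w0 : 0 < w by rewrite -(pmulr_rgt0 w (exprn_gt0 2 vp)) e.
  have -> : w = (fnorm (v n))^-1 ^+ 2.
    by apply: (mulfI (expf_neq0 2 v0)); rewrite e exprVn divff// expf_neq0.
  by rewrite sqrtr_sqr ger0_norm ?invr_ge0 ?ltW// invrK.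
have -> : v n = fnorm (v n) *: b n by rewrite /b unitizeE// scalerA divff// scale1r.
rewrite fdotZl fnormZ ub mulr1 ger0_norm; last exact: ltW.
by rewrite mulrA.
Unshelve. all: by end_near. Qed.

Lemma beta_pa_normal :
  let W n t := enorm (S n t *m X n *m beta_pa (S n t) (X n) (y n)) ^+ 2 *:
      invmx (sketch_gram (S n t) (X n)) +
    (alpha + 1) *: (beta_pa (S n t) (X n) (y n) *m (beta_pa (S n t) (X n) (y n))^T) in
  cvg_std_normal P (fun n t => rate m tau n *:
    (invsqrtmx (W n t) *m (beta_pa (S n t) (X n) (y n) - ols (X n) (y n)))) /\
  whp P (fun n t => forall u : 'cV[R]_q.+1,
    fnorm (rate m tau n *: (invsqrtmx (W n t) *m u)) ^+ 2 <=
    6 * (rate m tau n ^+ 2 * fdot (X n *m u) (X n *m u) /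
      fnorm (X n *m ols (X n) (y n)) ^+ 2)).
Proof.
move=> W.
have F_op1 : op1 P (fun n t => fnorm (F n t)) by exact: gram_op1.
pose c1 := fnorm (1%:M : 'M[R]_q.+1).
pose k := 2 * ((6 * c1 + 6 * a) * K ^+ 2) + 4 * K * (c1 + a).
have good : whp P (fun n t => (6 * c1 + 6 * a) * fnorm (F n t) * K ^+ 2 <= 2^-1 /\
    fnorm (F n t) <= 8^-1).
  apply: whpI.
  - have half0 : 0 < 2^-1 :> R by rewrite invr_gt0.
    apply: whpS (op1Z ((6 * c1 + 6 * a) * K ^+ 2) F_op1 half0) => n t h.
    by rewrite mulrAC; apply: le_trans (ler_norm _) h.
  - have e0 : 0 < 8^-1 :> R by rewrite invr_gt0.
    by apply: whpS (F_op1 _ e0) => n t h; apply: le_trans (ler_norm _) h.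
pose A n t := rate m tau n *:
    (invsqrtmx (W n t) *m (beta_pa (S n t) (X n) (y n) - ols (X n) (y n))).
have est : whp P (fun n t => fnorm (A n t - xi n t) <= k * fnorm (F n t) * fnorm (xi n t) /\
  forall u : 'cV[R]_q.+1, fnorm (rate m tau n *: (invsqrtmx (W n t) *m u)) ^+ 2 <=
    6 * (rate m tau n ^+ 2 * fdot (X n *m u) (X n *m u) /
      fnorm (X n *m ols (X n) (y n)) ^+ 2)).
  apply: whp_imp good; near=> n.
  have pol : polar (X n) (Q n) (R0 n) (lam n) K by near: n; exact: near_polar.
  have gn0 : 0 < fnorm (g n) by near: n.
  have s0 : 0 < rate m tau n by near: n; exact: rate_gt0.
  move=> t [h1 h2]; rewrite -(gam_polar pol).
  exact: (part2_estimate pol a1 gn0 h1 h2 s0).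
split; last by apply: whpS est => n t [].
apply: (normal_relative_error mxi xi_proj _ (op1Z k F_op1)); last by apply: whpS est => n t [].
move=> n; apply: random_studentized_pa => //; last exact: addr_ge0.
by apply: randomB; [apply: random_beta_pa => //|]; exact: random_cst.
Unshelve. all: by end_near. Qed.

End PartTwoFixed.

End FixedDesign.

(** * Moments and independence *)

Section Moments.
Context {d : measure_display} {T : measurableType d} {R : realType}.
Variable P : probability T R.

Implicit Types f g : T -> R.

(** Expectation as a real number, for integrable functions. *)
Definition integ (f : T -> R) : Prop := P.-integrable setT (EFin \o f).
Definition avg (f : T -> R) : R := fine (\int[P]_t (f t)%:E)%E.

Lemma integ_measurable f : integ f -> measurable_fun setT f.
Proof. by move=> /integrableP[/measurable_EFinP]. Qed.

Lemma avgE f : integ f -> (\int[P]_t (f t)%:E = (avg f)%:E)%E.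
Proof. by move=> h; rewrite /avg fineK//; exact: integrable_fin_num. Qed.

Lemma integ_le f g : measurable_fun setT f -> (forall t, `|f t| <= g t) -> integ g -> integ f.
Proof.
move=> mf fg; apply: le_integrable => //; first exact/measurable_EFinP.
by move=> t _ /=; rewrite lee_fin; apply: le_trans (ler_norm _).
Qed.

Lemma integ_cst c : integ (fun=> c).
Proof.
exact: (finite_measure_integrable_cst P c).
Qed.

Lemma integD f g : integ f -> integ g -> integ (fun t => f t + g t).
Proof. by move=> hf hg; apply: eq_integrable (integrableD measurableT hf hg). Qed.

Lemma integZ c f : integ f -> integ (fun t => c * f t).
Proof. by move=> hf; apply: eq_integrable (integrableZl measurableT c hf). Qed.

Lemma integB f g : integ f -> integ g -> integ (fun t => f t - g t).
Proof.
move=> hf hg; have := integD hf (integZ (-1) hg).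
by congr integ; apply/funext => t; rewrite mulN1r.
Qed.

Lemma integ_sum (I : Type) (s : seq I) (F : I -> T -> R) :
  (forall i, integ (F i)) -> integ (fun t => \sum_(i <- s) F i t).
Proof.
move=> h; elim: s => [|i s IH].
  by rewrite (_ : (fun t => _) = fun=> 0); [exact: integ_cst|apply/funext => t; rewrite big_nil].
rewrite (_ : (fun t => _) = fun t => F i t + \sum_(j <- s) F j t); first exact: integD.
by apply/funext => t; rewrite big_cons.
Qed.

Lemma avg_cst c : avg (fun=> c) = c.
Proof. by rewrite /avg integral_cst//= probability_setT mule1. Qed.

Lemma avgD f g : integ f -> integ g -> avg (fun t => f t + g t) = avg f + avg g.
Proof.
move=> hf hg; apply: EFin_inj; rewrite EFinD -!avgE//; last exact: integD.
by under eq_integral do rewrite EFinD; exact: integralD.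
Qed.

Lemma avgZ c f : integ f -> avg (fun t => c * f t) = c * avg f.
Proof.
move=> hf; apply: EFin_inj; rewrite EFinM -!avgE//; last exact: integZ.
by under eq_integral do rewrite EFinM; exact: integralZl.
Qed.

Lemma avgB f g : integ f -> integ g -> avg (fun t => f t - g t) = avg f - avg g.
Proof.
move=> hf hg; rewrite -[- avg g]mulN1r -(avgZ _ hg) -avgD//; last exact: integZ.
by congr avg; apply/funext => t; rewrite mulN1r.
Qed.

Lemma avg_sum (I : Type) (s : seq I) (F : I -> T -> R) :
  (forall i, integ (F i)) -> avg (fun t => \sum_(i <- s) F i t) = \sum_(i <- s) avg (F i).
Proof.
move=> h; elim: s => [|i s IH].
  rewrite big_nil (_ : (fun t => _) = fun=> 0); first exact: avg_cst.
  by apply/funext => t; rewrite big_nil.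
rewrite big_cons -IH -avgD//; last exact: integ_sum.
by congr avg; apply/funext => t; rewrite big_cons.
Qed.

Lemma avg_ge0 f : (forall t, 0 <= f t) -> 0 <= avg f.
Proof. by move=> f0; apply: fine_ge0; apply: integral_ge0 => t _; rewrite lee_fin. Qed.

Lemma le_avg f g : integ f -> integ g -> (forall t, f t <= g t) -> avg f <= avg g.
Proof.
move=> hf hg fg; rewrite -subr_ge0 -avgB//.
by apply: avg_ge0 => t; rewrite subr_ge0.
Qed.

Lemma avg_markov f c : integ f -> (forall t, 0 <= f t) -> 0 < c ->
  prob P [set t | c <= f t] <= avg f / c.
Proof.
move=> hf f0 c0; have mf := integ_measurable hf.
have mA : measurable [set t | c <= f t] by exact: measurable_ler_set.
rewrite ler_pdivlMr//.
have mi : measurable_fun setT (\1_[set t | c <= f t] : T -> R) by exact: measurable_indic.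
have i1 : integ (\1_[set t | c <= f t] : T -> R).
  apply: integ_le (integ_cst 1) => // t; rewrite indicE.
  by case: (_ \in _); rewrite ?normr1 ?normr0.
have -> : prob P [set t | c <= f t] = avg (\1_[set t | c <= f t]).
  by rewrite /prob /avg integral_indic// setIT.
rewrite mulrC -avgZ//; apply: le_avg => //; first exact: integZ.
move=> t; rewrite indicE; have [|_] := boolP (t \in _); last by rewrite mulr0.
by rewrite inE mulr1.
Qed.

Lemma integ_nonneg f (v : R) : measurable_fun setT f -> (forall t, 0 <= f t) ->
  (\int[P]_t (f t)%:E = v%:E)%E -> integ f /\ avg f = v.
Proof.
move=> mf f0 e; split; last by rewrite /avg e.
apply/integrableP; split; first exact/measurable_EFinP.
rewrite (_ : (\int[_]_(_ in _) _)%E = v%:E) ?ltry// -e.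
by apply: eq_integral => t _ /=; rewrite ger0_norm.
Qed.

Lemma integM_sqr f g : measurable_fun setT f -> measurable_fun setT g ->
  integ (fun t => f t ^+ 2) -> integ (fun t => g t ^+ 2) -> integ (fun t => f t * g t).
Proof.
move=> mf mg hf hg.
apply: integ_le (integD hf hg); first exact: measurable_funM.
move=> t; have := sqr_ge0 (f t - g t); have := sqr_ge0 (f t + g t).
rewrite sqrrB sqrrD ler_norml => h1 h2.
have := sqr_ge0 (f t); have := sqr_ge0 (g t); lra.
Qed.

Lemma integ_of_sqr f : measurable_fun setT f -> integ (fun t => f t ^+ 2) -> integ f.
Proof.
move=> mf h; have h1 : integ (fun t : T => (1 : R) ^+ 2) by exact: integ_cst.
have := integM_sqr mf (@measurable_cst _ _ _ _ setT (1 : R)) h h1.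
by congr integ; apply/funext => t; rewrite /cst mulr1.
Qed.

End Moments.

Section IndependentPair.
Context {d : measure_display} {T : measurableType d} {R : realType}.
Variable P : probability T R.

(** Fubini for the joint law, which is the product of the marginal ones. *)
Lemma indep_avgM (X Y : T -> R) (g h : R -> R) :
  measurable_fun setT X -> measurable_fun setT Y ->
  (forall A B : set R, measurable A -> measurable B ->
    P [set t | A (X t) /\ B (Y t)] = (P [set t | A (X t)] * P [set t | B (Y t)])%E) ->
  measurable_fun setT g -> measurable_fun setT h ->
  integ P (fun t => g (X t)) -> integ P (fun t => h (Y t)) ->
  avg P (fun t => g (X t) * h (Y t)) = avg P (fun t => g (X t)) * avg P (fun t => h (Y t)).
Proof.
move=> mX mY ind mg mh ig ih.
pose X' : {mfun T >-> R} := HB.pack (X : T -> R) (isMeasurableFun.Build _ _ _ _ _ mX).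
pose Y' : {mfun T >-> R} := HB.pack (Y : T -> R) (isMeasurableFun.Build _ _ _ _ _ mY).
pose muX := distribution P X'; pose muY := distribution P Y'.
have mXY : measurable_fun setT (fun t => (X' t, Y' t)) by exact: measurable_fun_pair.
pose XY : {mfun T >-> (R * R)%type} :=
  HB.pack (fun t => (X' t, Y' t)) (isMeasurableFun.Build _ _ _ _ _ mXY).
pose f (z : R * R) : \bar R := (g z.1 * h z.2)%:E.
have mf1 : measurable_fun setT (fun z : R * R => g z.1).
  by apply: (@measurableT_comp _ _ _ _ _ _ g setT fst).
have mf2 : measurable_fun setT (fun z : R * R => h z.2).
  by apply: (@measurableT_comp _ _ _ _ _ _ h setT snd).
have mf : measurable_fun setT f by apply/measurable_EFinP; exact: measurable_funM.
have law A : measurable A -> distribution P XY A = (muX \x muY)%E A.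
  move=> mA; apply: esym; apply: (product_measure_unique (m1 := muX) (m2 := muY)) => //.
have hX : (\int[muX]_x `|(g x)%:E| < +oo)%E.
  rewrite /muX ge0_integral_distribution//.
    by have /integrableP[_] := ig.
  by apply: measurableT_comp => //; exact/measurable_EFinP.
have hY : (\int[muY]_x `|(h x)%:E| < +oo)%E.
  rewrite /muY ge0_integral_distribution//.
    by have /integrableP[_] := ih.
  by apply: measurableT_comp => //; exact/measurable_EFinP.
have iXY : (muX \x muY)%E.-integrable setT f.
  apply/integrable12ltyP => //.
  rewrite (_ : (fun x => _) = (fun x => `|(g x)%:E| * \int[muY]_y `|(h y)%:E|)%E); last first.
    apply/funext => x; rewrite -ge0_integralZl//; last first.
      by apply: measurableT_comp => //; exact/measurable_EFinP.
    by apply: eq_integral => y _; rewrite /f /= normrM EFinM.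
  rewrite ge0_integralZr//; last by apply: integral_ge0.
    have fX : (\int[muX]_x `|(g x)%:E|)%E \is a fin_num.
      by rewrite ge0_fin_numE// integral_ge0.
    by apply: lte_mul_pinfty => //; exact: integral_ge0.
  by apply: measurableT_comp => //; exact/measurable_EFinP.
have igX : muX.-integrable setT (EFin \o g).
  by apply/integrableP; split => //; exact/measurable_EFinP.
have ihY : muY.-integrable setT (EFin \o h).
  by apply/integrableP; split => //; exact/measurable_EFinP.
have eX : (\int[muX]_x (g x)%:E = (avg P (fun t => g (X t)))%:E)%E.
  by rewrite -avgE// /muX integral_distribution//; exact/measurable_EFinP.
have eY : (\int[muY]_x (h x)%:E = (avg P (fun t => h (Y t)))%:E)%E.
  by rewrite -avgE// /muY integral_distribution//; exact/measurable_EFinP.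
have iP : P.-integrable setT (f \o XY).
  apply/integrableP; split; first exact: measurableT_comp.
  have -> : (\int[P]_t `|(f \o XY) t| = \int[distribution P XY]_z `|f z|)%E.
    by rewrite ge0_integral_distribution//; exact: measurableT_comp.
  rewrite (eq_measure_integral (muX \x muY)%E); last by move=> A mA _; exact: law.
  by have /integrableP[] := iXY.
apply: EFin_inj; rewrite {1}/avg fineK.
  rewrite -[LHS]/(\int[P]_t (f \o XY) t)%E -(integral_distribution mf iP).
  rewrite (eq_measure_integral (muX \x muY)%E); last by move=> A mA _; exact: law.
  rewrite -(integral12_prod_meas1 iXY) /fubini_F.
  under eq_integral => x _ do rewrite /f /=.
  transitivity (\int[muX]_x ((g x)%:E * (avg P (fun t => h (Y t)))%:E))%E.
    apply: eq_integral => x _; rewrite -eY -integralZl//.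
  by rewrite integralZr// eX -EFinM.
exact: integrable_fin_num iP.
Qed.

End IndependentPair.

(** * Independent identically distributed errors *)

Section IidErrors.
Context {d : measure_display} {T : measurableType d} {R : realType}.
Variable P : probability T R.
Context {n : nat}.
Variable e : T -> 'cV[R]_n.
Hypothesis me : random_mx e.
Hypothesis iid : iid_entries P e.

Let mei i : measurable_fun setT (fun t => e t i 0). Proof. exact: me. Qed.

(** The other events of the product rule are taken to be the whole line. *)
Lemma iid_pair (i j : 'I_n) (A B : set R) : i != j -> measurable A -> measurable B ->
  P [set t | A (e t i 0) /\ B (e t j 0)] =
  (P [set t | A (e t i 0%R)] * P [set t | B (e t j 0%R)])%E.
Proof.
move=> ij mA mB.
pose C k := if k == i then A else if k == j then B else setT.
have mC k : measurable (C k) by rewrite /C; case: ifP => // _; case: ifP.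
have := proj1 iid C mC; rewrite (bigD1 i)//= (bigD1 j)/=; last by rewrite eq_sym.
rewrite big1 ?mule1; last first.
  move=> k /andP[ki kj]; rewrite /C (negbTE ki) (negbTE kj).
  by rewrite (_ : [set t | _] = setT) ?probability_setT//; apply/seteqP; split.
rewrite {2 3}/C eqxx eq_sym (negbTE ij) eqxx => <-; congr (P _).
apply/seteqP; split => t /=.
  by move=> [At Bt] k; rewrite /C; case: eqVneq => [->//|_]; case: eqVneq => [->|].
by move=> h; have := h i; have := h j; rewrite /C !eqxx eq_sym (negbTE ij).
Qed.

Lemma iid_integral (g : R -> R) (i j : 'I_n) : measurable_fun setT g -> (forall x, 0 <= g x) ->
  (\int[P]_t (g (e t i 0%R))%:E = \int[P]_t (g (e t j 0%R))%:E)%E.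
Proof.
move=> mg g0.
pose X k : {mfun T >-> R} := HB.pack (fun t => e t k 0 : R) (isMeasurableFun.Build _ _ _ _ _ (mei k)).
have h k : (\int[P]_t (g (e t k 0%R))%:E = \int[distribution P (X k)]_x (g x)%:E)%E.
  by rewrite ge0_integral_distribution//; exact/measurable_EFinP.
rewrite !h; apply: eq_measure_integral => A mA _; exact: (proj2 iid).
Qed.

Lemma iid_avg (g : R -> R) (i j : 'I_n) : measurable_fun setT g -> (forall x, 0 <= g x) ->
  avg P (fun t => g (e t i 0)) = avg P (fun t => g (e t j 0)).
Proof. by move=> mg g0; rewrite /avg (iid_integral i j mg g0). Qed.

(** Orthogonality of the centered variables g (e_i). *)
Lemma iid_linear_sqr (g : R -> R) (v : R) (a : 'I_n -> R) : measurable_fun setT g ->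
  (forall i, integ P (fun t => g (e t i 0) ^+ 2)) ->
  (forall i, avg P (fun t => g (e t i 0) ^+ 2) = v) ->
  (forall i, avg P (fun t => g (e t i 0)) = 0) ->
  integ P (fun t => (\sum_i a i * g (e t i 0)) ^+ 2) /\
  avg P (fun t => (\sum_i a i * g (e t i 0)) ^+ 2) = v * \sum_i a i ^+ 2.
Proof.
move=> mg ig2 vg g0.
have mge i : measurable_fun setT (fun t => g (e t i 0)) by exact: measurableT_comp.
have ig i : integ P (fun t => g (e t i 0)) by exact: integ_of_sqr.
have igg i j : integ P (fun t => g (e t i 0) * g (e t j 0)) by exact: integM_sqr.
have sqrE : (fun t => (\sum_i a i * g (e t i 0)) ^+ 2) =
    (fun t => \sum_i \sum_j a i * a j * (g (e t i 0) * g (e t j 0))).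
  apply/funext => t; rewrite expr2 mulr_suml; apply: eq_bigr => i _.
  by rewrite mulr_sumr; apply: eq_bigr => j _; ring.
have i1 i j : integ P (fun t => a i * a j * (g (e t i 0) * g (e t j 0))) by exact: integZ.
have i2 i : integ P (fun t => \sum_j a i * a j * (g (e t i 0) * g (e t j 0))) by exact: integ_sum.
rewrite sqrE; split; first exact: integ_sum.
rewrite avg_sum// mulr_sumr; apply: eq_bigr => i _; rewrite avg_sum//.
rewrite (bigD1 i)//= big1 ?addr0.
  rewrite avgZ//; under eq_fun do rewrite -expr2.
  by rewrite vg mulrC expr2.
move=> j ji; rewrite avgZ// (@indep_avgM _ _ _ P) ?g0 ?mulr0//.
by move=> A B mA mB; apply: iid_pair => //; rewrite eq_sym.
Qed.

Variable v : R.
Hypothesis mean0 : forall i, ('E_P[fun t => e t i 0%R] = 0)%E.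
Hypothesis var : forall i, ('V_P[fun t => e t i 0%R] = v%:E)%E.

Lemma iid_moments i : [/\ integ P (fun t => e t i 0 ^+ 2),
  avg P (fun t => e t i 0 ^+ 2) = v & avg P (fun t => e t i 0) = 0].
Proof.
have [h1 h2] : integ P (fun t => e t i 0 ^+ 2) /\ avg P (fun t => e t i 0 ^+ 2) = v.
  apply: integ_nonneg; [exact: measurable_funX|by move=> t; exact: sqr_ge0|].
  rewrite -(var i) /variance covariance.unlock mean0 /= expectation.unlock.
  apply: eq_integral => t _; congr EFin.
  by rewrite -[RHS]/((e t i 0 - 0) * (e t i 0 - 0)) subr0 expr2.
split=> //; have := mean0 i; rewrite expectation.unlock => h.
by rewrite /avg h.
Qed.

Lemma iid_form_sqr (a : 'I_n -> R) :
  integ P (fun t => (\sum_i a i * e t i 0) ^+ 2) /\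
  avg P (fun t => (\sum_i a i * e t i 0) ^+ 2) = v * \sum_i a i ^+ 2.
Proof. by apply: (iid_linear_sqr (g := id)) => // i; have [] := iid_moments i. Qed.

(** The fitted noise is the image of e by the hat matrix H, a symmetric
    idempotent of trace q, so that its mean squared norm is v |H|^2 = v q. *)
Lemma fitted_noise_bound q (X : 'M[R]_(n, q)) (K : R) : X^T *m X \in unitmx -> 0 < K ->
  prob P [set t | K <= fnorm (X *m ols X (e t)) ^+ 2] <= v * q%:R / K.
Proof.
move=> uX K0; set G := X^T *m X in uX.
pose H := X *m invmx G *m X^T.
have GT : G^T = G by rewrite /G trmx_mul trmxK.
have HT : H^T = H by rewrite /H !trmx_mul trmxK trmx_inv GT mulmxA.
have HH : H *m H = H.
  by rewrite /H -!mulmxA (mulmxA X^T) -/G (mulmxA G) mulmxV// mul1mx.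
have H2 : fdot H H = q%:R.
  rewrite /fdot HT HH /H mxtrace_mulC mulmxA -/G mulmxV//.
  exact: mxtrace1.
have E t : fnorm (X *m ols X (e t)) ^+ 2 = \sum_i (\sum_j H i j * e t j 0) ^+ 2.
  have -> : X *m ols X (e t) = H *m e t by rewrite /ols /H !mulmxA.
  rewrite fnorm2 fdotE; apply: eq_bigr => i _; rewrite big_ord1 -expr2 mxE.
  by [].
have iE i := proj1 (iid_form_sqr (H i)).
under eq_fun do rewrite E.
apply: le_trans (avg_markov (integ_sum _ iE) _ K0) _.
  by move=> t; apply: sumr_ge0 => i _; exact: sqr_ge0.
rewrite avg_sum// ler_pM2r ?invr_gt0// -H2 fdotE mulr_sumr.
apply: ler_sum => i _; rewrite (proj2 (iid_form_sqr (H i))).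
by rewrite le_eqVlt; apply/orP; left; apply/eqP; congr (_ * _); apply: eq_bigr => j _; rewrite expr2.
Qed.

Definition tail_moment (c : R) i : R := avg P (fun t => e t i 0 ^+ 2 * (c < `|e t i 0|)%R%:R).

Let m_ind (c : R) : measurable_fun setT (fun x : R => (`|x| <= c)%R%:R : R).
Proof.
apply: (proj1 (bm_le _ (Y := fun x : R => `|x|) _)).
exact: measurableT_comp.
Qed.

Let m_indC (c : R) : measurable_fun setT (fun x : R => (c < `|x|)%R%:R : R).
Proof.
rewrite (_ : (fun x : R => _) = (fun x : R => 1 - (`|x| <= c)%R%:R)).
  by apply: measurable_funB; [exact: measurable_cst|exact: m_ind].
by apply/funext => x; rewrite ltNge; case: (`|x| <= c); rewrite ?subrr ?subr0.
Qed.

Lemma measurable_tail c : measurable_fun setT (fun x : R => x ^+ 2 * (c < `|x|)%R%:R).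
Proof. by apply: measurable_funM; [exact: measurable_funX|exact: m_indC]. Qed.

Lemma integ_tail (b : T -> bool) i : measurable_fun setT (fun t => (b t)%:R : R) ->
  integ P (fun t => e t i 0 ^+ 2 * (b t)%:R).
Proof.
move=> mb; have [h _ _] := iid_moments i; apply: integ_le h.
  by apply: measurable_funM => //; exact: measurable_funX.
move=> t; rewrite normrM ger0_norm ?sqr_ge0// ler_piMr ?sqr_ge0//.
by case: (b t); rewrite ?normr1 ?normr0.
Qed.

(** A weak law of large numbers by truncation: the truncated squares zeta (e_i)
    are at most eta^2 n, hence the variance of their sum is at most
    n (eta^2 n) v, while their mean is at least 3 v / 4. *)
Lemma norm_lower_bound (eta : R) : (0 < n)%N -> 0 < v -> 0 < eta ->
  (forall i, tail_moment (eta * Num.sqrt n%:R) i <= v / 4) ->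
  prob P [set t | fnorm (e t) ^+ 2 < n%:R * (v / 2)] <= 16 * eta ^+ 2 / v.
Proof.
move=> n0 v0 eta0 tail.
have n0' : 0 < n%:R :> R by rewrite ltr0n.
set c := eta * Num.sqrt n%:R in tail.
have c2 : c ^+ 2 = eta ^+ 2 * n%:R by rewrite exprMn sqr_sqrtr// ltW.
have c0 : 0 <= c by rewrite mulr_ge0 ?sqrtr_ge0// ltW.
pose zeta (x : R) := x ^+ 2 * (`|x| <= c)%R%:R.
have mzeta : measurable_fun setT zeta.
  by apply: measurable_funM; [exact: measurable_funX|exact: m_ind].
have zeta0 x : 0 <= zeta x by rewrite mulr_ge0 ?sqr_ge0.
have zeta_le x : zeta x <= x ^+ 2.
  by rewrite ler_piMr ?sqr_ge0//; case: (`|x| <= c).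
have zetac x : zeta x <= c ^+ 2.
  rewrite /zeta; case: (leP `|x| c) => h; last by rewrite mulr0 sqr_ge0.
  by rewrite mulr1 -real_normK ?num_real// lerXn2r ?nnegrE.
have izeta i : integ P (fun t => zeta (e t i 0)).
  apply: integ_tail; have := measurableT_comp (m_ind c) (mei i); exact.
pose i0 := Ordinal n0.
pose mu := avg P (fun t => zeta (e t i0 0)).
have muE i : avg P (fun t => zeta (e t i 0)) = mu by exact: iid_avg.
have mu_ge : 3 / 4 * v <= mu.
  have [h1 h2 _] := iid_moments i0.
  have it : integ P (fun t => e t i0 0 ^+ 2 * (c < `|e t i0 0|)%R%:R).
    by apply: integ_tail; have := measurableT_comp (m_indC c) (mei i0); exact.
  have : v = mu + tail_moment c i0.
    rewrite -h2 /mu /tail_moment -avgD//; congr avg; apply/funext => t.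
    by rewrite /zeta ltNge; case: (`|e t i0 0| <= c); rewrite ?mulr0 ?mulr1 ?addr0 ?add0r.
  have := tail i0; lra.
have mu_le : mu <= v.
  by have [h1 h2 _] := iid_moments i0; rewrite -h2; apply: le_avg => // t; exact: zeta_le.
pose g x := zeta x - mu.
have mg : measurable_fun setT g by apply: measurable_funB => //; exact: measurable_cst.
have izeta2 i : integ P (fun t => zeta (e t i 0) ^+ 2).
  apply: integ_le (integZ (c ^+ 2) (izeta i)).
    by apply: measurable_funX; exact: measurableT_comp.
  by move=> t; rewrite ger0_norm ?sqr_ge0// expr2 ler_wpM2r.
have g2E x : g x ^+ 2 = zeta x ^+ 2 - ((2 * mu) * zeta x - mu ^+ 2).
  by rewrite /g; ring.
have ilin i : integ P (fun t => (2 * mu) * zeta (e t i 0) - mu ^+ 2).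
  by apply: integB; [exact: integZ|exact: integ_cst].
have ig2 i : integ P (fun t => g (e t i 0) ^+ 2).
  by under eq_fun do rewrite g2E; exact: integB.
have g0 i : avg P (fun t => g (e t i 0)) = 0.
  by rewrite avgB//; [rewrite muE avg_cst subrr|exact: integ_cst].
pose w := avg P (fun t => g (e t i0 0) ^+ 2).
have wE i : avg P (fun t => g (e t i 0) ^+ 2) = w.
  apply: (iid_avg (g := fun x => g x ^+ 2)); first exact: measurable_funX.
  by move=> x; exact: sqr_ge0.
have w_le : w <= c ^+ 2 * v.
  rewrite /w; under eq_fun do rewrite g2E.
  rewrite avgB// avgB//; [|exact: integZ|exact: integ_cst].
  rewrite avgZ// muE avg_cst.
  have : avg P (fun t => zeta (e t i0 0) ^+ 2) <= c ^+ 2 * mu.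
    rewrite -[mu](muE i0) -avgZ//; apply: le_avg => //; first exact: integZ.
    by move=> t; rewrite expr2 ler_wpM2r.
  have : c ^+ 2 * mu <= c ^+ 2 * v by rewrite ler_wpM2l ?sqr_ge0.
  have := sqr_ge0 mu; rewrite expr2; lra.
have [iS aS] := iid_linear_sqr (fun=> 1) mg ig2 wE g0.
set Sg := (fun t => _ ^+ 2) in iS aS.
pose k := n%:R * (v / 4).
have k0 : 0 < k by rewrite mulr_gt0// divr_gt0.
have k2 : 0 < k ^+ 2 by rewrite exprn_gt0.
have mk := avg_markov iS (fun t => sqr_ge0 _) k2.
have me2 : measurable_fun setT (fun t => fnorm (e t) ^+ 2).
  by apply: measurable_funX; exact: measurable_fnorm.
apply: (@le_trans _ _ (prob P [set t | k ^+ 2 <= Sg t])).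
  apply: le_prob; [exact: measurable_ltr_set|exact: measurable_ler_set (integ_measurable iS)|].
  move=> t /= et; rewrite /Sg.
  have es : \sum_i zeta (e t i 0) <= fnorm (e t) ^+ 2.
    rewrite fnorm2 fdotE; apply: ler_sum => i _; rewrite big_ord1 -expr2; exact: zeta_le.
  have -> : \sum_i 1 * g (e t i 0) = \sum_i zeta (e t i 0) - n%:R * mu.
    under eq_bigr do rewrite mul1r.
    by rewrite sumrB sumr_const card_ord -[X in _ - X]mulr_natl.
  have h : k <= n%:R * mu - \sum_i zeta (e t i 0).
    have : n%:R * (3 / 4 * v) <= n%:R * mu by rewrite ler_wpM2l// ltW.
    rewrite /k; move: et es; lra.
  rewrite -[leRHS]sqrrN opprB lerXn2r// nnegrE; [exact: ltW|exact: le_trans (ltW k0) h].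
apply: le_trans mk _; rewrite aS.
have -> : \sum_(i < n) (1 : R) ^+ 2 = n%:R.
  by under eq_bigr do rewrite expr1n; rewrite sumr_const card_ord.
rewrite ler_pdivrMr//.
have -> : 16 * eta ^+ 2 / v * k ^+ 2 = (c ^+ 2 * v) * n%:R.
  by rewrite c2 /k; field; rewrite gt_eqF.
by rewrite ler_wpM2r// ltW.
Qed.

End IidErrors.

(** * Consequences of the Lindeberg-Feller condition *)

(** The rows of (X^T X)^(-1/2) X^T are orthonormal. *)
Lemma whitened_design_norm {R : realType} {n q : nat} (X : 'M[R]_(n, q.+1)) : X^T *m X \in unitmx ->
  \sum_(i < n) enorm (col i (invsqrtmx (X^T *m X) *m X^T)) ^+ 2 = q.+1%:R.
Proof.
move=> uX; set G := X^T *m X in uX *.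
have Gp : is_psd G by exact: psd_gram.
have NN := sqrtmx_sqr Gp; have [NT _] := sqrtmx_psd Gp.
have uN : sqrtmx G \in unitmx by move: uX; rewrite -{1}NN unitmx_mul => /andP[].
have -> : \sum_(i < n) enorm (col i (invsqrtmx G *m X^T)) ^+ 2 = fnorm (invsqrtmx G *m X^T) ^+ 2.
  rewrite fnorm2 fdotE exchange_big; apply: eq_bigr => i _.
  rewrite enormE fnorm2 fdotE; apply: eq_bigr => j _.
  by rewrite big_ord1 mxE.
rewrite fnorm2 -[_ *m X^T]trmxK /fdot trmxK mxtrace_mulC trmx_mul trmxK.
rewrite /invsqrtmx trmx_inv NT -mulmxA (mulmxA X^T) -/G -{2}NN mulmxK// mulVmx//.
exact: mxtrace1.
Qed.

Section Lindeberg.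
Context {d : measure_display} {T : measurableType d} {R : realType}.
Variable P : probability T R.
Variable e : forall n, T -> 'cV[R]_n.
Hypothesis me : forall n, random_mx (e n).
Hypothesis iid : forall n, iid_entries P (e n).
Variable v : R.
Hypothesis mean0 : forall n i, ('E_P[fun t => e n t i 0%R] = 0)%E.
Hypothesis var : forall n i, ('V_P[fun t => e n t i 0%R] = v%:E)%E.
Context {q : nat}.
Variable X : forall n, 'M[R]_(n, q.+1).
Hypothesis uX : \forall n \near \oo, (X n)^T *m X n \in unitmx.

(** The laws of the errors may depend on n, so that a uniform bound on their
    tails is needed; the Lindeberg-Feller condition provides it. Indeed the
    weights |a_i|^2 sum to q + 1, at least half of their mass is carried by
    indices with |a_i|^2 >= (q + 1) / (2 n), and for those indices
    |e_i| > eta sqrt n forces |a_i| |e_i| > eta sqrt ((q + 1) / 2). *)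
Lemma lindeberg_tail (eta : R) : lindeberg_feller P e X -> 0 < v -> 0 < eta ->
  \forall n \near \oo, forall i, tail_moment P (e n) (eta * Num.sqrt n%:R) i <= v / 4.
Proof.
move=> lf v0 eta0; pose p : R := q.+1%:R.
have p0 : 0 < p by rewrite ltr0n.
pose eta' := eta * Num.sqrt (p / 2).
have p20 : 0 < p / 2 by rewrite divr_gt0.
have eta'0 : 0 < eta' by rewrite mulr_gt0// sqrtr_gt0.
pose w n i := enorm (col i (invsqrtmx ((X n)^T *m X n) *m (X n)^T)).
pose Ti n i := avg P (fun t => e n t i 0 ^+ 2 * (eta' < w n i * `|e n t i 0|)%R%:R).
have mei n i : measurable_fun setT (fun t => e n t i 0) by exact: me.
have mind n i : measurable_fun setT (fun t => (eta' < w n i * `|e n t i 0|)%R%:R : R).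
  rewrite (_ : (fun t => _) = (fun t => 1 - (w n i * `|e n t i 0| <= eta')%R%:R)).
    apply: measurable_funB; first exact: measurable_cst.
    apply: (proj1 (bm_le _ (Y := fun t => w n i * `|e n t i 0|) _)).
    by apply: measurable_funM; [exact: measurable_cst|exact: measurableT_comp].
  by apply/funext => t; rewrite ltNge; case: (_ <= eta'); rewrite ?subrr ?subr0.
have iT n i : integ P (fun t => e n t i 0 ^+ 2 * (eta' < w n i * `|e n t i 0|)%R%:R).
  exact: (integ_tail (@me n) (@mean0 n) (@var n) i (mind n i)).
have lfr : \sum_(i < n) w n i ^+ 2 * Ti n i @[n --> \oo] --> (0 : R).
  have /fine_cvg := lf _ eta'0.
  rewrite (_ : fine \o _ = (fun n => \sum_(i < n) w n i ^+ 2 * Ti n i))//.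
  apply/funext => n /=.
  rewrite (eq_bigr (fun i => (w n i ^+ 2 * Ti n i)%:E)) ?sumEFin// => i _.
  by rewrite expectation.unlock [RHS]EFinM /Ti -(avgE (iT n i)).
have b0 : 0 < p / 2 * (v / 4) by rewrite mulr_gt0// divr_gt0.
have /cvgrPdist_le/(_ _ b0) lfe := lfr.
near=> n.
have n0 : (0 < n)%N by near: n; exists 1%N.
have n0' : 0 < n%:R :> R by rewrite ltr0n.
have un : (X n)^T *m X n \in unitmx by near: n.
have lfn : `|0 - \sum_(i < n) w n i ^+ 2 * Ti n i| <= p / 2 * (v / 4) by near: n.
move=> i; set c := eta * _.
have mtail j : measurable_fun setT (fun t => (c < `|e n t j 0|)%R%:R : R).
  rewrite (_ : (fun t => _) = (fun t => 1 - (`|e n t j 0| <= c)%R%:R)).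
    apply: measurable_funB; first exact: measurable_cst.
    apply: (proj1 (bm_le _ (Y := fun t => `|e n t j 0|) _)).
    exact: measurableT_comp.
  by apply/funext => t; rewrite ltNge; case: (_ <= c); rewrite ?subrr ?subr0.
have itl j : integ P (fun t => e n t j 0 ^+ 2 * (c < `|e n t j 0|)%R%:R).
  exact: (integ_tail (@me n) (@mean0 n) (@var n) j (mtail j)).
have tE j : tail_moment P (e n) c j = tail_moment P (e n) c i.
  apply: (iid_avg (@me n) (iid n) j i (g := fun x => x ^+ 2 * (c < `|x|)%R%:R)).
    exact: measurable_tail.
  by move=> x; rewrite mulr_ge0 ?sqr_ge0.
set tl := tail_moment P (e n) c i in tE *.
have tl0 : 0 <= tl by apply: avg_ge0 => t; rewrite mulr_ge0 ?sqr_ge0.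
have term j : (w n j ^+ 2 - p / 2 / n%:R) * tl <= w n j ^+ 2 * Ti n j.
  have w0 : 0 <= w n j by exact: sqrtr_ge0.
  have T0 : 0 <= Ti n j by apply: avg_ge0 => t; rewrite mulr_ge0 ?sqr_ge0.
  have [h|h] := leP (p / 2 / n%:R) (w n j ^+ 2); last first.
    apply: (@le_trans _ _ 0); last by rewrite mulr_ge0 ?sqr_ge0.
    by rewrite mulr_le0_ge0// subr_le0 ltW.
  apply: (@le_trans _ _ (w n j ^+ 2 * tl)).
    by rewrite ler_wpM2r// gerBl divr_ge0 ?ltW.
  rewrite ler_wpM2l ?sqr_ge0// -(tE j); apply: le_avg => // t.
  rewrite ler_wpM2l ?sqr_ge0// ler_nat.
  have [h1|//] := ltP c `|e n t j 0|.
  suff -> : eta' < w n j * `|e n t j 0| by [].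
  have wl : Num.sqrt (p / 2 / n%:R) <= w n j.
    by rewrite -[leRHS](ger0_norm w0) -sqrtr_sqr ler_sqrt ?sqr_ge0.
  have wp : 0 < Num.sqrt (p / 2 / n%:R) by rewrite sqrtr_gt0 divr_gt0.
  have -> : eta' = Num.sqrt (p / 2 / n%:R) * c.
    rewrite /eta' /c mulrCA -sqrtrM ?divr_ge0 ?ltW//.
    by rewrite mulfVK ?gt_eqF.
  apply: (@lt_le_trans _ _ (Num.sqrt (p / 2 / n%:R) * `|e n t j 0|)).
    by rewrite ltr_pM2l.
  by rewrite ler_wpM2r.
have sumT : p / 2 * tl <= \sum_(j < n) w n j ^+ 2 * Ti n j.
  apply: le_trans (ler_sum _ (fun j _ => term j)).
  rewrite -mulr_suml sumrB whitened_design_norm// sumr_const card_ord.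
  rewrite -[X in _ - X]mulr_natl mulrCA mulfV ?gt_eqF// mulr1.
  by rewrite ler_wpM2r// -/p; lra.
have : p / 2 * tl <= p / 2 * (v / 4).
  apply: le_trans sumT _; apply: le_trans (ler_norm _) _.
  by rewrite -normrN -sub0r.
by rewrite ler_pM2l.
Unshelve. all: by end_near. Qed.

Lemma error_norm_whp : lindeberg_feller P e X -> 0 < v ->
  whp P (fun n t => n%:R * (v / 2) <= fnorm (e n t) ^+ 2).
Proof.
move=> lf v0.
have mA n : measurable [set t | n%:R * (v / 2) <= fnorm (e n t) ^+ 2].
  apply: measurable_ler_set; first exact: measurable_cst.
  by apply: measurable_funX; exact: measurable_fnorm.
apply/(whp_meas P mA) => eps eps0.
pose eta := Num.sqrt (eps * v / 16).
have ev : 0 < eps * v / 16 by rewrite divr_gt0// mulr_gt0.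
have eta0 : 0 < eta by rewrite sqrtr_gt0.
near=> n.
have n0 : (0 < n)%N by near: n; exists 1%N.
have tl : forall i, tail_moment P (e n) (eta * Num.sqrt n%:R) i <= v / 4.
  by near: n; exact: lindeberg_tail.
have := norm_lower_bound (@me n) (iid n) (@mean0 n) (@var n) n0 v0 eta0 tl.
rewrite /eta sqr_sqrtr ?(ltW ev)//.
have -> : 16 * (eps * v / 16) / v = eps by field; rewrite gt_eqF.
rewrite (_ : [set t | _] = ~` [set t | n%:R * (v / 2) <= fnorm (e n t) ^+ 2])//.
by apply/seteqP; split => t /=; rewrite ltNge => /negP.
Unshelve. all: by end_near. Qed.

End Lindeberg.

(** * The error of the full-data estimator *)

(** The dominated convergence of the freezing lemmas, with a constant for the
    random matrix that is not fixed. *)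
Lemma ae_near_whp {d : measure_display} {T : measurableType d} {R : realType}
    (P : probability T R) (A : nat -> set T) : (forall n, measurable (A n)) ->
  {ae P, forall t, \forall n \near \oo, A n t} -> whp P (fun n t => A n t).
Proof.
move=> mA h.
pose b n t : 'M[R]_1 := const_mx (\1_(A n) t).
pose c (n : nat) (t : T) : 'M[R]_1 := 0.
have bE n t : (0 < b n t 0 0) <-> A n t.
  rewrite mxE indicE; have [|nAt] := boolP (t \in A n); first by rewrite inE; split.
  by split; [rewrite ltxx|move=> At; move: nAt; rewrite mem_set].
have mb n : random_mx (b n).
  by move=> i j; under eq_fun do rewrite mxE; exact: measurable_indic.
have ind n : indep_mx P (c n) (b n).
  move=> C D _ _; have [c0|c0] := pselect (C 0).
    by rewrite (_ : c n @^-1` C = setT) ?setTI ?probability_setT ?mul1e//; apply/seteqP; split.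
  by rewrite (_ : c n @^-1` C = set0) ?set0I ?measure0 ?mul0e//; apply/seteqP; split.
have := @freezing_whp R d T P (fun=> 1%N) (fun=> 1%N) (fun=> 1%N) (fun=> 1%N) c b
  (fun _ _ z => 0 < z 0 0) (fun n => random_cst _) mb ind.
move=> H; apply: whpS (H _ _) => [n t|n d' T' A' B' _ mB'|].
- by move=> /bE.
- by apply: measurable_ltr_set; [exact: measurable_cst|exact: mB'].
- apply: filterS h => t ht; apply: whp_near; apply: filterS ht => n Ant _.
  exact/bE.
Qed.

Lemma ae_exists {d : measure_display} {T : measurableType d} {R : realType}
    (P : probability T R) (Q : T -> Prop) : {ae P, forall t, Q t} -> exists t, Q t.
Proof.
move=> [N [mN PN hN]]; apply: contrapT => nQ.
have NT : N = setT by apply/seteqP; split => // t _; apply: hN => Qt; apply: nQ; exists t.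
by move: PN; rewrite NT probability_setT => /eqP; rewrite onee_eq0.
Qed.

Lemma measurable_unitmx {d : measure_display} {T : measurableType d} {R : realType} k (A : T -> 'M[R]_k) : random_mx A ->
  measurable [set t | A t \in unitmx].
Proof.
move=> mA; rewrite (_ : [set t | _] = [set t | 0 < `|\det (A t)|]).
  apply: measurable_ltr_set; first exact: measurable_cst.
  by apply: measurableT_comp => //; exact: measurable_det.
by apply/seteqP; split => t /=; rewrite unitmxE unitfE normr_gt0.
Qed.

Section DataTerms.
Context {d : measure_display} {T : measurableType d} {R : realType}.
Variable P : probability T R.
Context {q : nat}.
Variables (m : nat -> nat) (tau : nat -> R).
Variables (X : forall n, T -> 'M[R]_(n, q.+1)) (e : forall n, T -> 'cV[R]_n).
Variables (bstar : 'cV[R]_q.+1) (v : R).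
Hypothesis m_oo : m n @[n --> \oo] --> \oo.
Hypothesis tau0 : \forall n \near \oo, 0 < tau n.
Hypothesis mX : forall n, random_mx (X n).
Hypothesis me : forall n, random_mx (e n).
Hypothesis eX : forall n, indep_mx P (e n) (X n).
Hypothesis iid : forall n, iid_entries P (e n).
Hypothesis mean0 : forall n i, ('E_P[fun t => e n t i 0%R] = 0)%E.
Hypothesis var : forall n i, ('V_P[fun t => e n t i 0%R] = v%:E)%E.
Hypothesis uX : {ae P, forall t, \forall n \near \oo, (X n t)^T *m X n t \in unitmx}.

Local Notation y n t := (X n t *m bstar + e n t).
Let Qn n t := fnorm (X n t *m ols (X n t) (e n t)) ^+ 2.

Lemma unit_whp : whp P (fun n t => (X n t)^T *m X n t \in unitmx).
Proof.
apply: (ae_near_whp (A := fun n => [set t | (X n t)^T *m X n t \in unitmx])) => //.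
by move=> n; apply: measurable_unitmx; apply: randomM => //; exact: randomT.
Qed.

Lemma ols_model n t : (X n t)^T *m X n t \in unitmx ->
  ols (X n t) (y n t) = bstar + ols (X n t) (e n t).
Proof. by move=> u; rewrite /ols mulmxDr mulmxDr (mulmxA (_^T)) mulKmx. Qed.

(** Conditionally on X the bound for a fixed design applies, and it does not
    depend on the design. *)
Lemma fitted_noise_Op1 : Op1 P Qn.
Proof.
move=> eta eta0; have eta2 : 0 < eta / 2 by rewrite divr_gt0.
pose K := `|v| * q.+1%:R / (eta / 2) + 1.
have K0 : 0 < K.
  by rewrite ltr_wpDl//; apply: divr_ge0; [apply: mulr_ge0|exact: ltW].
exists K => //; have := unit_whp eta2; apply: filterS => n [B [mB pB hB]].
pose phi (a : 'M[R]_(n, 1)) (x : 'M[R]_(n, q.+1)) :=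
  x^T *m x \in unitmx /\ K <= fnorm (x *m ols x a) ^+ 2.
have mphi : measurable_event phi.
  move=> d' T' A' B' mA' mB'; apply: measurableI.
    by apply: measurable_unitmx; apply: randomM => //; exact: randomT.
  apply: measurable_ler_set; first exact: measurable_cst.
  by apply: measurable_funX; apply: measurable_fnorm; apply: randomM => //; exact: random_ols.
exists (B `|` [set t | phi (e n t) (X n t)]); split.
- by apply: measurableU => //; exact: mphi.
- apply: le_trans (probU P mB _) _; first exact: mphi.
  rewrite (splitr eta); apply: lerD => //.
  apply: freezing_le => // t.
  have [u|u] := boolP ((X n t)^T *m X n t \in unitmx); last first.
    rewrite (_ : [set s | _] = set0) ?/prob ?measure0 ?ltW//.
    by apply/seteqP; split => s //= -[]; rewrite (negbTE u).
  apply: (@le_trans _ _ (v * q.+1%:R / K)).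
    rewrite (_ : [set s | _] = [set s | K <= fnorm (X n t *m ols (X n t) (e n s)) ^+ 2]).
      exact: (fitted_noise_bound (@me n) (iid n) (@mean0 n) (@var n)).
    by apply/seteqP; split => s /=; [case|split].
  rewrite ler_pdivrMr// mulrDr mulr1 mulrCA mulfV ?gt_eqF// mulr1.
  by rewrite ler_wpDr ?(ltW eta2)// ler_wpM2r// ler_norm.
- move=> t /not_orP[/hB u hphi]; rewrite /Qn ger0_norm ?sqr_ge0//.
  by rewrite leNgt; apply/negP => h; apply: hphi; split => //; exact: ltW.
Qed.

Let sqr_triangle k (a b : 'cV[R]_k) : fnorm (a + b) ^+ 2 <= 2 * fnorm a ^+ 2 + 2 * fnorm b ^+ 2.
Proof.
have := sqr_ge0 (fnorm (a - b)).
rewrite !fnorm2 !fdotDl !fdotDr !fdotNl !fdotNr (fdotC b a); lra.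
Qed.

Lemma residual_model n t : (X n t)^T *m X n t \in unitmx ->
  residual (X n t) (y n t) = e n t - X n t *m ols (X n t) (e n t).
Proof.
move=> u; rewrite /residual ols_model// mulmxDr opprD addrACA subrr add0r.
by [].
Qed.

(** The numerator is O_P(1) times the squared rate, and the squared residual is
    at least of order n. *)
Lemma noise_ratio_s_op1 : 0 < v ->
  {ae P, forall t, lindeberg_feller P e (fun n => X n t)} ->
  (m n)%:R / (n%:R * tau n) @[n --> \oo] --> (0 : R) ->
  op1 P (fun n t => rate m tau n ^+ 2 *
    fnorm (X n t *m (ols (X n t) (y n t) - bstar)) ^+ 2 /
    fnorm (residual (X n t) (y n t)) ^+ 2).
Proof.
move=> v0 lf mntau.
have [t0 [ut lft]] : exists t, (\forall n \near \oo, (X n t)^T *m X n t \in unitmx) /\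
    lindeberg_feller P e (fun n => X n t).
  have : {ae P, forall t, (\forall n \near \oo, (X n t)^T *m X n t \in unitmx) /\
    lindeberg_feller P e (fun n => X n t)} by apply: filterS2 uX lf.
  exact: ae_exists.
have he := error_norm_whp me iid mean0 var ut lft v0.
move=> eps eps0 eta eta0; have eta2 : 0 < eta / 2 by rewrite divr_gt0.
have [K K0 hK] := fitted_noise_Op1 eta2.
have hu := whpI unit_whp he eta2.
have b0 : 0 < eps * v / (8 * K) by rewrite divr_gt0 ?mulr_gt0.
have /cvgrPdist_le/(_ _ b0) hr := mntau.
have [N hN] : exists N : nat, 8 * K / v <= N%:R.
  exists (Num.bound (8 * K / v)); rewrite ltW// archi_boundP//.
  by apply: divr_ge0; [apply: mulr_ge0 => //|]; exact: ltW.
near=> n.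
have [B [mB pB hB]] : exists B, [/\ measurable B, prob P B <= eta / 2 &
    forall t, ~ B t -> `|Qn n t| <= K] by near: n.
have [B' [mB' pB' hB']] : exists B, [/\ measurable B, prob P B <= eta / 2 &
    forall t, ~ B t -> (X n t)^T *m X n t \in unitmx /\ n%:R * (v / 2) <= fnorm (e n t) ^+ 2].
  by near: n.
have taun : 0 < tau n by near: n.
have n0 : 0 < n%:R :> R by rewrite ltr0n; near: n; exists 1%N.
have nK : 8 * K <= n%:R * v.
  rewrite -ler_pdivrMr//; apply: le_trans hN _; rewrite ler_nat.
  by near: n; exists N.
have rn : (m n)%:R / (n%:R * tau n) <= eps * v / (8 * K).
  have : `|0 - (m n)%:R / (n%:R * tau n)| <= eps * v / (8 * K) by near: n.
  by rewrite sub0r normrN; apply: le_trans; exact: ler_norm.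
have r2 : rate m tau n ^+ 2 = (m n)%:R / tau n.
  by rewrite /rate expr_div_n !sqr_sqrtr// ltW.
exists (B `|` B'); split; first exact: measurableU.
  by apply: le_trans (probU P mB mB') _; rewrite (splitr eta) lerD.
move=> t /not_orP[/hB Qt /hB'[u en]].
rewrite residual_model// ols_model// addrAC subrr add0r -/(Qn n t).
rewrite ger0_norm ?sqr_ge0// in Qt.
set r := fnorm (e n t - _) ^+ 2.
have hr2 : n%:R * v / 8 <= r.
  have : fnorm (e n t) ^+ 2 <= 2 * r + 2 * Qn n t.
    have := sqr_triangle (e n t - X n t *m ols (X n t) (e n t)) (X n t *m ols (X n t) (e n t)).
    by rewrite subrK.
  have -> : n%:R * v / 8 = (n%:R * (v / 2)) / 4 by field.
  have e4 : n%:R * (v / 2) = (n%:R * v) / 2 by field.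
  move: en; rewrite e4 => en he2; lra.
have nv0 : 0 < n%:R * v / 8 by rewrite divr_gt0// mulr_gt0.
have r0 : 0 < r by exact: lt_le_trans hr2.
have Q0 : 0 <= Qn n t by exact: sqr_ge0.
rewrite ger0_norm; last by apply: divr_ge0; [apply: mulr_ge0 => //; exact: sqr_ge0|exact: ltW].
rewrite r2 ler_pdivrMr//.
apply: (@le_trans _ _ ((m n)%:R / tau n * K)).
  by rewrite ler_wpM2l// divr_ge0// ltW.
apply: (@le_trans _ _ (eps * (n%:R * v / 8))); last by rewrite ler_pM2l.
have -> : (m n)%:R / tau n * K = ((m n)%:R / (n%:R * tau n)) * (n%:R * K).
  by field; rewrite !gt_eqF.
have -> : eps * (n%:R * v / 8) = (eps * v / (8 * K)) * (n%:R * K).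
  by field; rewrite gt_eqF.
by rewrite ler_wpM2r// mulr_ge0// ltW.
Unshelve. all: by end_near. Qed.

(** The ratio is +oo where the signal X bstar vanishes, so those points belong to
    the exceptional set. *)
Lemma signal_whp :
  cvg_in_prob0 P (fun n t => (m n)%:R%:E / (tau n * enorm (X n t *m bstar) ^+ 2)%:E)%E ->
  forall eps : R, 0 < eps -> whp P (fun n t => rate m tau n ^+ 2 <= eps * fnorm (X n t *m bstar) ^+ 2).
Proof.
move=> h eps eps0 eta eta0; have /fine_cvgP[_ /cvgrPdist_le/(_ _ eta0) he] := h _ eps0.
have m1 : \forall n \near \oo, (1 <= m n)%N by exact: m_oo (nbhs_infty_ge 1).
near=> n.
have taun : 0 < tau n by near: n.
have mn : 0 < (m n)%:R :> R by rewrite ltr0n; near: n.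
pose B := [set t | eps * fnorm (X n t *m bstar) ^+ 2 < rate m tau n ^+ 2].
have mB : measurable B.
  apply: measurable_ltr_set; last exact: measurable_cst.
  apply: measurable_funM; first exact: measurable_cst.
  apply: measurable_funX; apply: measurable_fnorm; apply: randomM => //; exact: random_cst.
exists B; split => //; last by move=> t /negP; rewrite -leNgt.
have r2 : rate m tau n ^+ 2 = (m n)%:R / tau n.
  by rewrite /rate expr_div_n !sqr_sqrtr// ltW.
have BE : B = [set t | (eps%:E < `|(m n)%:R%:E / (tau n * enorm (X n t *m bstar) ^+ 2)%:E|)%E].
  apply/seteqP; split => t; rewrite /B /= enormE r2.
    have [s0|s0] := eqVneq (fnorm (X n t *m bstar) ^+ 2) 0.
      rewrite s0 !mulr0 => _; rewrite inver eqxx gt0_muley ?lte_fin//=; exact: ltry.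
    have sp : 0 < fnorm (X n t *m bstar) ^+ 2 by rewrite lt_def s0 sqr_ge0.
    have tp : 0 < tau n * fnorm (X n t *m bstar) ^+ 2 by rewrite mulr_gt0.
    rewrite inver gt_eqF// -EFinM abse_EFin lte_fin => lt.
    rewrite ger0_norm ?divr_ge0 ?ltW// ltr_pdivlMr//.
    by move: lt; rewrite ltr_pdivlMr// -mulrA [_ ^+ 2 * _]mulrC.
  have [s0|s0] := eqVneq (fnorm (X n t *m bstar) ^+ 2) 0.
    by rewrite s0 !mulr0 divr_gt0.
  have sp : 0 < fnorm (X n t *m bstar) ^+ 2 by rewrite lt_def s0 sqr_ge0.
  have tp : 0 < tau n * fnorm (X n t *m bstar) ^+ 2 by rewrite mulr_gt0.
  rewrite inver gt_eqF// -EFinM abse_EFin lte_fin.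
  rewrite ger0_norm ?divr_ge0 ?ltW// ltr_pdivlMr// => lt.
  by rewrite ltr_pdivlMr// -mulrA [_ ^+ 2 * _]mulrC.
rewrite BE; apply: le_trans (ler_norm _) _; rewrite -normrN -sub0r.
by near: n.
Unshelve. all: by end_near. Qed.

Hypothesis taum : tau n / (m n)%:R @[n --> \oo] --> (0 : R).

(** The squared rate is negligible with respect to |X bstar|^2 and tends to
    infinity, so |X ols| is of the order of |X bstar|. *)
Lemma noise_ratio_pa_op1 :
  (forall eps : R, 0 < eps -> whp P (fun n t => rate m tau n ^+ 2 <= eps * fnorm (X n t *m bstar) ^+ 2)) ->
  op1 P (fun n t => rate m tau n ^+ 2 *
    fnorm (X n t *m (ols (X n t) (y n t) - bstar)) ^+ 2 /
    fnorm (X n t *m ols (X n t) (y n t)) ^+ 2) /\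
  whp P (fun n t => 0 < fnorm (X n t *m ols (X n t) (y n t))).
Proof.
move=> sig.
suff H eps : 0 < eps -> whp P (fun n t => `|rate m tau n ^+ 2 *
    fnorm (X n t *m (ols (X n t) (y n t) - bstar)) ^+ 2 /
    fnorm (X n t *m ols (X n t) (y n t)) ^+ 2| <= eps /\
    0 < fnorm (X n t *m ols (X n t) (y n t))).
  split; first by move=> eps eps0; apply: whpS (H _ eps0) => n t [].
  by apply: whpS (H _ ltr01) => n t [].
move=> eps0 eta eta0; have eta2 : 0 < eta / 2 by rewrite divr_gt0.
have [K K0 hK] := fitted_noise_Op1 eta2.
have k4 : 0 < eps / (4 * K) by rewrite divr_gt0// mulr_gt0.
have hu := whpI unit_whp (sig _ k4) eta2.
have rc := rate_inv_cvg0 tau0 taum.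
have e1 : 0 < (Num.sqrt eps + 1)^-1 by rewrite invr_gt0 ltr_wpDl// sqrtr_ge0.
have /cvgrPdist_le/(_ _ e1) hr := rc.
near=> n.
have [B [mB pB hB]] : exists B, [/\ measurable B, prob P B <= eta / 2 &
    forall t, ~ B t -> `|Qn n t| <= K] by near: n.
have [B' [mB' pB' hB']] : exists B, [/\ measurable B, prob P B <= eta / 2 &
    forall t, ~ B t -> (X n t)^T *m X n t \in unitmx /\
      rate m tau n ^+ 2 <= eps / (4 * K) * fnorm (X n t *m bstar) ^+ 2].
  by near: n.
have s0 : 0 < rate m tau n by near: n; exact: rate_gt0.
have r2 : eps <= rate m tau n ^+ 2.
  have : `|0 - (rate m tau n)^-1| <= (Num.sqrt eps + 1)^-1 by near: n.
  rewrite sub0r normrN ger0_norm ?invr_ge0 ?(ltW s0)// lef_pV2 ?posrE// ?ltr_wpDl ?sqrtr_ge0// => h.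
  rewrite -[leLHS]sqr_sqrtr ?(ltW eps0)// lerXn2r ?nnegrE ?sqrtr_ge0 ?(ltW s0)//.
  by apply: le_trans h; rewrite lerDl.
exists (B `|` B'); split; first exact: measurableU.
  by apply: le_trans (probU P mB mB') _; rewrite (splitr eta) lerD.
move=> t /not_orP[/hB Qt /hB'[u sn]].
rewrite ols_model//; have -> : bstar + ols (X n t) (e n t) - bstar = ols (X n t) (e n t) by rewrite addrAC subrr add0r.
rewrite -/(Qn n t) mulmxDr.
rewrite ger0_norm ?sqr_ge0// in Qt.
set g2 := fnorm (X n t *m bstar) ^+ 2 in sn.
set r := fnorm (_ + _).
have g2r : g2 <= 2 * r ^+ 2 + 2 * Qn n t.
  have := sqr_triangle (X n t *m bstar + X n t *m ols (X n t) (e n t)) (- (X n t *m ols (X n t) (e n t))).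
  by rewrite addrK fnormN.
have K4 : 4 * K <= g2.
  have : eps <= eps / (4 * K) * g2 by exact: le_trans sn.
  by rewrite mulrAC ler_pdivlMr ?mulr_gt0// ler_pM2l.
have g4 : g2 / 4 <= r ^+ 2 by move: g2r K4 Qt; lra.
have g0 : 0 < g2 by apply: lt_le_trans K4; rewrite mulr_gt0.
have rp : 0 < r ^+ 2 by apply: lt_le_trans g4; rewrite divr_gt0.
split; last by rewrite lt_def fnorm_ge0 andbT; apply: contraTneq rp => ->; rewrite expr0n /= ltxx.
have Q0 : 0 <= Qn n t by exact: sqr_ge0.
rewrite ger0_norm; last by apply: divr_ge0; [apply: mulr_ge0 => //; exact: sqr_ge0|exact: ltW].
rewrite ler_pdivrMr//.
apply: (@le_trans _ _ (eps / (4 * K) * g2 * K)).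
  by rewrite ler_pM ?sqr_ge0.
have -> : eps / (4 * K) * g2 * K = eps * (g2 / 4) by field; rewrite gt_eqF.
by rewrite ler_pM2l.
Unshelve. all: by end_near. Qed.

End DataTerms.

(** * Unconditional limit theorems *)

Lemma is_svd_gram_unit {R : realType} {n q : nat} (X : 'M[R]_(n, q.+1)) U (l : 'rV[R]_q.+1) V :
  is_svd X U l V -> X^T *m X \in unitmx.
Proof.
move=> h; have [XQ _] := svd_polar h (lexx _).
by rewrite (gram_polar XQ) unitmx_mul (polar_unit XQ).
Qed.

Section Assembly.
Context {R : realType} {d : measure_display} {T : measurableType d}.
Variable P : probability T R.
Context {q : nat}.
Variables (m : nat -> nat) (tau : nat -> R) (alpha : R).
Variables (frakp frakP : vseq R -> vseq R -> Prop).
Variables (S : forall n, T -> 'M[R]_(m n, n)) (X : forall n, T -> 'M[R]_(n, q.+1)).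
Variables (e : forall n, T -> 'cV[R]_n) (U : forall n, T -> 'M[R]_(n, q.+1)).
Variables (l : nat -> T -> 'rV[R]_q.+1) (V : nat -> T -> 'M[R]_q.+1).
Variables (bstar : 'cV[R]_q.+1) (sigma_o : R).
Local Notation y n t := (X n t *m bstar + e n t).
Hypothesis m_oo : m n @[n --> \oo] --> \oo.
Hypothesis mX : forall n, random_mx (X n).
Hypothesis me : forall n, random_mx (e n).
Hypothesis eX : forall n, indep_mx P (e n) (X n).
Hypothesis iid : forall n, iid_entries P (e n).
Hypothesis mean0 : forall n i, ('E_P[fun t => e n t i 0%R] = 0)%E.
Hypothesis var : forall n i, ('V_P[fun t => e n t i 0%R] = (sigma_o ^+ 2)%:E)%E.
Hypothesis mS : forall n, random_mx (S n).
Hypothesis SD : forall n, indep_mx P (S n) (fun t => row_mx (X n t) (y n t)).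
Hypothesis alpha0 : 0 <= alpha.
Hypothesis tau0 : \forall n \near \oo, 0 < tau n.
Hypothesis taum : tau n / (m n)%:R @[n --> \oo] --> (0 : R).
Hypothesis onedim : cond_1dim P S tau alpha frakP.
Hypothesis cd : {ae P, forall t, cond_data frakP (fun n => X n t) (fun n => y n t)
  (fun n => U n t) (fun n => l n t) (fun n => V n t)}.

Let my n : random_mx (fun t => y n t).
Proof. by apply: randomD => //; apply: randomM => //; exact: random_cst. Qed.

Let mD n : random_mx (fun t => row_mx (X n t) (y n t)).
Proof. exact: random_row_mx. Qed.

Let uX : {ae P, forall t, \forall n \near \oo, (X n t)^T *m X n t \in unitmx}.
Proof.
by apply: filterS cd => t [svd _ _ _]; apply: filterS svd => n; exact: is_svd_gram_unit.
Qed.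

(** With variance zero the errors vanish almost surely, and so does the
    residual. *)
Lemma noise_variance_gt0 : 0 < sigma_o ^+ 2.
Proof.
rewrite lt_def sqr_ge0 andbT; apply/eqP => s0.
have e0 n i : {ae P, forall t, e n t i 0 = 0}.
  have mei : measurable_fun setT (fun t => (e n t i 0 ^+ 2)%:E).
    by apply/measurable_EFinP; apply: measurable_funX; exact: me.
  have [ie ve _] := iid_moments (@me n) (@mean0 n) (@var n) i.
  have : ae_eq P setT (fun t => (e n t i 0 ^+ 2)%:E) (cst 0%E).
    apply/(ae_eq_integral_abs P measurableT mei).
    rewrite (eq_integral (fun t => (e n t i 0 ^+ 2)%:E)).
      by rewrite avgE// ve s0.
    by move=> t _; rewrite gee0_abs// lee_fin sqr_ge0.
  apply: filterS => t /(_ I) [] /eqP; rewrite sqrf_eq0 => /eqP.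
  by [].
have ae0 : {ae P, forall t, forall n, e n t = 0}.
  apply: ae_foralln => n.
  have : {ae P, forall t, forall k : nat, forall i : 'I_n, val i = k -> e n t i 0 = 0}.
    apply: ae_foralln => k; have [kn|kn] := ltnP k n.
      apply: filterS (e0 n (Ordinal kn)) => t h i ik.
      by rewrite (_ : i = Ordinal kn)//; exact: val_inj.
    by apply: aeW => t i ik; have := ltn_ord i; rewrite ik ltnNge kn.
  by apply: filterS => t h; apply/matrixP => i j; rewrite ord1 mxE (h i i).
have : {ae P, forall t, False}.
  near=> t.
  have h1 : forall n, e n t = 0 by near: t.
  have [svd _ r0 _] : cond_data frakP (fun n => X n t) (fun n => y n t)
    (fun n => U n t) (fun n => l n t) (fun n => V n t) by near: t.
  have [n [svdn rn]] : exists n, is_svd (X n t) (U n t) (l n t) (V n t) /\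
      residual (X n t) (y n t) != 0.
    by have [N _ hN] := filterI svd r0; exists N; apply: hN => /=.
  have u := is_svd_gram_unit svdn.
  move: rn; rewrite residual_model// h1 sub0r oppr_eq0.
  by rewrite /ols !mulmx0 eqxx.
by case/ae_exists.
Unshelve. all: by end_near. Qed.

Let op1_of_sqr (Y : nat -> T -> 'cV[R]_q.+1) (rho : nat -> T -> R) (c : R) : 0 < c ->
  whp P (fun n t => fnorm (Y n t) ^+ 2 <= c * rho n t) -> op1 P rho ->
  forall eps, 0 < eps -> whp P (fun n t => forall i, `|Y n t i 0| <= eps).
Proof.
move=> c0 h hr eps eps0.
have e2 : 0 < eps ^+ 2 / c by rewrite divr_gt0// exprn_gt0.
apply: whpS (whpI h (hr _ e2)) => n t [h1 h2] i.
apply: le_trans (fnorm_entry _ _ _) _.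
rewrite -(@ler_pXn2r _ 2)// ?nnegrE ?fnorm_ge0 ?(ltW eps0)//.
apply: le_trans h1 _; rewrite mulrC -ler_pdivlMr//.
by apply: le_trans h2; exact: ler_norm.
Qed.

(** The studentized error is the sum of a term centered at ols, which has the
    limit N(0, I), and of the bias ols - bstar, which is negligible. *)
Let scaled_difference (s : R) (N : 'M[R]_q.+1) (a b c : 'cV[R]_q.+1) i :
  (s *: (N *m (a - c))) i 0 - (s *: (N *m (a - b))) i 0 = (s *: (N *m (b - c))) i 0.
Proof.
have -> : a - c = (a - b) + (b - c) by rewrite addrA subrK.
by rewrite mulmxDr scalerDr [in LHS]mxE addrAC subrr add0r.
Qed.

Section PartOne.
Hypothesis bounded : cond_bounded P S tau frakp.
Hypothesis lf : {ae P, forall t, lindeberg_feller P e (fun n => X n t)}.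
Hypothesis prr : {ae P, forall t,
  frakp (fun n => normalized_residual (X n t) (y n t))
        (fun n => normalized_residual (X n t) (y n t))}.
Hypothesis mntau : (m n)%:R / (n%:R * tau n) @[n --> \oo] --> (0 : R).

(** The studentized vector, with an arbitrary u in place of the error. *)
Let stat n (A : 'M[R]_(m n, n)) (D : 'M[R]_(n, q.+1 + 1)) (u : 'cV[R]_q.+1) : 'cV[R]_q.+1 :=
  (rate m tau n / enorm (sketch_residual A (lsubmx D) (rsubmx D))) *:
  (sqrtmx (sketch_gram A (lsubmx D)) *m u).
Let center n (A : 'M[R]_(m n, n)) (D : 'M[R]_(n, q.+1 + 1)) : 'cV[R]_q.+1 :=
  stat A D (beta_s A (lsubmx D) (rsubmx D) - ols (lsubmx D) (rsubmx D)).
Let bias n (A : 'M[R]_(m n, n)) (D : 'M[R]_(n, q.+1 + 1)) : 'cV[R]_q.+1 :=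
  stat A D (ols (lsubmx D) (rsubmx D) - bstar).
Let ratio n (D : 'M[R]_(n, q.+1 + 1)) : R :=
  rate m tau n ^+ 2 * fnorm (lsubmx D *m (ols (lsubmx D) (rsubmx D) - bstar)) ^+ 2 /
  fnorm (residual (lsubmx D) (rsubmx D)) ^+ 2.

Let fixed_data : {ae P, forall t,
  cvg_std_normal P (fun n s => center (S n s) (row_mx (X n t) (y n t))) /\
  whp P (fun n s => fnorm (bias (S n s) (row_mx (X n t) (y n t))) ^+ 2 <=
    4 * ratio (row_mx (X n t) (y n t)))}.
Proof.
apply: filterS2 cd prr => t [svd sup r0 PU] prrt.
have [c hc] := limn_esup_bounded sup.
have PU1 b hb := proj1 (PU b hb); have PU2 b hb := proj2 (PU b hb).
have [h1 h2] := beta_s_normal m_oo mS tau0 taum alpha0 onedim svd hc PU1 bounded r0 PU2 prrt.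
split.
  rewrite (_ : (fun n s => _) = (fun n s =>
    (rate m tau n / enorm (sketch_residual (S n s) (X n t) (y n t))) *:
    (sqrtmx (sketch_gram (S n s) (X n t)) *m
      (beta_s (S n s) (X n t) (y n t) - ols (X n t) (y n t)))))//.
  by apply/funext => n; apply/funext => s; rewrite /center /stat row_mxKl row_mxKr.
apply: whpS h2 => n s /(_ (ols (X n t) (y n t) - bstar)).
by rewrite /bias /stat /ratio row_mxKl row_mxKr -fnorm2.
Qed.

Let random_stat n d' (T' : measurableType d') (A' : T' -> 'M[R]_(m n, n))
    (D' : T' -> 'M[R]_(n, q.+1 + 1)) (u : T' -> 'cV[R]_q.+1) :
  random_mx A' -> random_mx D' -> random_mx u -> random_mx (fun t => stat (A' t) (D' t) (u t)).
Proof.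
move=> mA mD' mu; apply: random_studentized_s => //; [exact: random_lsubmx|exact: random_rsubmx].
Qed.

Let random_center n d' (T' : measurableType d') (A' : T' -> 'M[R]_(m n, n))
    (D' : T' -> 'M[R]_(n, q.+1 + 1)) :
  random_mx A' -> random_mx D' -> random_mx (fun t => center (A' t) (D' t)).
Proof.
move=> mA mD'; have mX' := random_lsubmx mD'; have my' := random_rsubmx mD'.
by apply: random_stat => //; apply: randomB; [exact: random_beta_s|exact: random_ols].
Qed.

Let random_bias n d' (T' : measurableType d') (A' : T' -> 'M[R]_(m n, n))
    (D' : T' -> 'M[R]_(n, q.+1 + 1)) :
  random_mx A' -> random_mx D' -> random_mx (fun t => bias (A' t) (D' t)).
Proof.
move=> mA mD'; have mX' := random_lsubmx mD'; have my' := random_rsubmx mD'.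
by apply: random_stat => //; apply: randomB; [exact: random_ols|exact: random_cst].
Qed.

Let measurable_ratio n d' (T' : measurableType d') (D' : T' -> 'M[R]_(n, q.+1 + 1)) :
  random_mx D' -> measurable_fun setT (fun t => ratio (D' t)).
Proof.
move=> mD'; have mX' := random_lsubmx mD'; have my' := random_rsubmx mD'.
apply: measurable_funM.
  apply: measurable_funM; first exact: measurable_cst.
  apply: measurable_funX; apply: measurable_fnorm; apply: randomM => //.
  by apply: randomB; [exact: random_ols|exact: random_cst].
apply: measurable_invr; apply: measurable_funX; apply: measurable_fnorm.
exact: random_residual.
Qed.

Lemma beta_s_studentized : cvg_std_normal P (fun n t =>
  (rate m tau n / enorm (sketch_residual (S n t) (X n t) (y n t))) *:
  (sqrtmx (sketch_gram (S n t) (X n t)) *m (beta_s (S n t) (X n t) (y n t) - bstar))).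
Proof.
have hA : cvg_std_normal P (fun n t => center (S n t) (row_mx (X n t) (y n t))).
  apply: (freezing_std_normal (z := center)) => //.
  by apply: filterS fixed_data => t [].
have hB : whp P (fun n t => fnorm (bias (S n t) (row_mx (X n t) (y n t))) ^+ 2 <=
    4 * ratio (row_mx (X n t) (y n t))).
  apply: (freezing_whp (phi := fun n A D => fnorm (bias A D) ^+ 2 <= 4 * ratio D)) => //.
    move=> n d' T' A' B' mA' mB'; apply: measurable_ler_set.
      by apply: measurable_funX; apply: measurable_fnorm; exact: random_bias.
    by apply: measurable_funM; [exact: measurable_cst|exact: measurable_ratio].
  by apply: filterS fixed_data => t [].
have hr : op1 P (fun n t => ratio (row_mx (X n t) (y n t))).
  rewrite (_ : (fun n t => ratio _) = (fun n t => rate m tau n ^+ 2 *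
    fnorm (X n t *m (ols (X n t) (y n t) - bstar)) ^+ 2 /
    fnorm (residual (X n t) (y n t)) ^+ 2)).
    exact: (noise_ratio_s_op1 bstar tau0 mX me eX iid mean0 var uX noise_variance_gt0 lf mntau).
  by apply/funext => n; apply/funext => t; rewrite /ratio row_mxKl row_mxKr.
have four : 0 < 4 :> R by [].
apply: (slutsky _ _ hA) => [n|n|eps eps0].
- exact: random_center.
- apply: random_studentized_s => //.
  by apply: randomB; [exact: random_beta_s|exact: random_cst].
- apply: whpS (op1_of_sqr four hB hr eps0) => n t h i.
  by have := h i; rewrite /bias /center /stat row_mxKl row_mxKr scaled_difference.
Qed.

End PartOne.

Section PartTwo.
Hypothesis PUU : {ae P, forall t, forall b b' : nat -> 'cV[R]_q.+1,
  (forall n, enorm (b n) = 1) -> (forall n, enorm (b' n) = 1) ->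
  frakP (fun n => U n t *m b n) (fun n => U n t *m b' n)}.
Hypothesis signal : cvg_in_prob0 P (fun n t =>
  (m n)%:R%:E / (tau n * enorm (X n t *m bstar) ^+ 2)%:E)%E.

Let weight n (A : 'M[R]_(m n, n)) (x : 'M[R]_(n, q.+1)) (z : 'cV[R]_n) : 'M[R]_q.+1 :=
  enorm (A *m x *m beta_pa A x z) ^+ 2 *: invmx (sketch_gram A x) +
  (alpha + 1) *: (beta_pa A x z *m (beta_pa A x z)^T).

(** For a fixed design the limit theorem needs X^T y <> 0, which holds with
    probability tending to 1 only; elsewhere y is replaced. *)
Let response n (D : 'M[R]_(n, q.+1 + 1)) : 'cV[R]_n :=
  if 0 < fnorm ((lsubmx D)^T *m rsubmx D) then rsubmx D else lsubmx D *m delta_mx 0 0.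

Let stat n (A : 'M[R]_(m n, n)) (D : 'M[R]_(n, q.+1 + 1)) (u : 'cV[R]_q.+1) : 'cV[R]_q.+1 :=
  rate m tau n *: (invsqrtmx (weight A (lsubmx D) (response D)) *m u).
Let center n (A : 'M[R]_(m n, n)) (D : 'M[R]_(n, q.+1 + 1)) : 'cV[R]_q.+1 :=
  stat A D (beta_pa A (lsubmx D) (response D) - ols (lsubmx D) (response D)).
Let bias n (A : 'M[R]_(m n, n)) (D : 'M[R]_(n, q.+1 + 1)) : 'cV[R]_q.+1 :=
  stat A D (ols (lsubmx D) (response D) - bstar).
Let ratio n (D : 'M[R]_(n, q.+1 + 1)) : R :=
  rate m tau n ^+ 2 * fnorm (lsubmx D *m (ols (lsubmx D) (response D) - bstar)) ^+ 2 /
  fnorm (lsubmx D *m ols (lsubmx D) (response D)) ^+ 2.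

Let responseE n t : 0 < fnorm ((X n t)^T *m (y n t)) ->
  response (row_mx (X n t) (y n t)) = y n t.
Proof. by rewrite /response row_mxKl row_mxKr => ->. Qed.

Let fixed_data : {ae P, forall t,
  cvg_std_normal P (fun n s => center (S n s) (row_mx (X n t) (y n t))) /\
  whp P (fun n s => fnorm (bias (S n s) (row_mx (X n t) (y n t))) ^+ 2 <=
    6 * ratio (row_mx (X n t) (y n t)))}.
Proof.
apply: filterS2 cd PUU => t [svd sup r0 PU] PUUt.
have [c hc] := limn_esup_bounded sup.
have PU1 b hb := proj1 (PU b hb).
pose y' n := response (row_mx (X n t) (y n t)).
have y'0 : \forall n \near \oo, (X n t)^T *m y' n != 0.
  apply: filterS svd => n /is_svd_gram_unit u.
  rewrite /y' /response row_mxKl row_mxKr; case: ifPn => [h|_].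
    by apply: contraTneq h => ->; rewrite fnorm0 ltxx.
  rewrite mulmxA; apply/eqP => h0.
  have /eqP := mulKmx u (delta_mx 0 0 : 'cV[R]_q.+1); rewrite h0 mulmx0 eq_sym.
  by apply/negP; apply: contra_neq (oner_neq0 R) => h; rewrite -(fnorm_delta (0 : 'I_q.+1)) h fnorm0.
have [h1 h2] := beta_pa_normal m_oo mS tau0 taum alpha0 onedim svd hc PU1 y'0 PUUt.
split.
  rewrite (_ : (fun n s => _) = (fun n s =>
    rate m tau n *: (invsqrtmx (weight (S n s) (X n t) (y' n)) *m
      (beta_pa (S n s) (X n t) (y' n) - ols (X n t) (y' n)))))//.
  by apply/funext => n; apply/funext => s; rewrite /center /stat row_mxKl.
apply: whpS h2 => n s /(_ (ols (X n t) (y' n) - bstar)).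
by rewrite /bias /stat /ratio row_mxKl -fnorm2.
Qed.

Let random_response n d' (T' : measurableType d') (D' : T' -> 'M[R]_(n, q.+1 + 1)) :
  random_mx D' -> random_mx (fun t => response (D' t)).
Proof.
move=> mD'; have mX' := random_lsubmx mD'; have my' := random_rsubmx mD'.
apply: random_if => //; last by apply: randomM => //; exact: random_cst.
apply: measurable_fun_ltr; first exact: measurable_cst.
by apply: measurable_fnorm; apply: randomM => //; exact: randomT.
Qed.

Let random_center n d' (T' : measurableType d') (A' : T' -> 'M[R]_(m n, n))
    (D' : T' -> 'M[R]_(n, q.+1 + 1)) :
  random_mx A' -> random_mx D' -> random_mx (fun t => center (A' t) (D' t)).
Proof.
move=> mA mD'; have mX' := random_lsubmx mD'; have my' := random_response mD'.
apply: random_studentized_pa => //; last exact: addr_ge0.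
by apply: randomB; [exact: random_beta_pa|exact: random_ols].
Qed.

Let random_bias n d' (T' : measurableType d') (A' : T' -> 'M[R]_(m n, n))
    (D' : T' -> 'M[R]_(n, q.+1 + 1)) :
  random_mx A' -> random_mx D' -> random_mx (fun t => bias (A' t) (D' t)).
Proof.
move=> mA mD'; have mX' := random_lsubmx mD'; have my' := random_response mD'.
apply: random_studentized_pa => //; last exact: addr_ge0.
by apply: randomB; [exact: random_ols|exact: random_cst].
Qed.

Let measurable_ratio n d' (T' : measurableType d') (D' : T' -> 'M[R]_(n, q.+1 + 1)) :
  random_mx D' -> measurable_fun setT (fun t => ratio (D' t)).
Proof.
move=> mD'; have mX' := random_lsubmx mD'; have my' := random_response mD'.
apply: measurable_funM.
  apply: measurable_funM; first exact: measurable_cst.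
  apply: measurable_funX; apply: measurable_fnorm; apply: randomM => //.
  by apply: randomB; [exact: random_ols|exact: random_cst].
apply: measurable_invr; apply: measurable_funX; apply: measurable_fnorm.
by apply: randomM => //; exact: random_ols.
Qed.

Lemma beta_pa_studentized : cvg_std_normal P (fun n t =>
  rate m tau n *: (invsqrtmx
    (enorm (S n t *m X n t *m beta_pa (S n t) (X n t) (y n t)) ^+ 2 *:
       invmx (sketch_gram (S n t) (X n t)) +
     (alpha + 1) *: (beta_pa (S n t) (X n t) (y n t) *m (beta_pa (S n t) (X n t) (y n t))^T)) *m
    (beta_pa (S n t) (X n t) (y n t) - bstar))).
Proof.
have hA : cvg_std_normal P (fun n t => center (S n t) (row_mx (X n t) (y n t))).
  apply: (freezing_std_normal (z := center)) => //.
  by apply: filterS fixed_data => t [].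
have hB : whp P (fun n t => fnorm (bias (S n t) (row_mx (X n t) (y n t))) ^+ 2 <=
    6 * ratio (row_mx (X n t) (y n t))).
  apply: (freezing_whp (phi := fun n A D => fnorm (bias A D) ^+ 2 <= 6 * ratio D)) => //.
    move=> n d' T' A' B' mA' mB'; apply: measurable_ler_set.
      by apply: measurable_funX; apply: measurable_fnorm; exact: random_bias.
    by apply: measurable_funM; [exact: measurable_cst|exact: measurable_ratio].
  by apply: filterS fixed_data => t [].
have sig := signal_whp m_oo tau0 mX signal.
have [hr0 hpos] := noise_ratio_pa_op1 m_oo tau0 mX me eX iid mean0 var uX taum sig.
have hy : whp P (fun n t => response (row_mx (X n t) (y n t)) = y n t).
  apply: whpS hpos => n t h; apply: responseE.
  rewrite lt_def fnorm_ge0 andbT; apply: contraTneq h => /fnorm_eq0 h.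
  by rewrite /ols h !mulmx0 fnorm0 ltxx.
have hr : op1 P (fun n t => ratio (row_mx (X n t) (y n t))).
  apply: op1_le hr0; apply: whpS hy => n t h.
  by rewrite /ratio h row_mxKl.
have six : 0 < 6 :> R by [].
apply: (slutsky _ _ hA) => [n|n|eps eps0].
- exact: random_center.
- apply: random_studentized_pa => //; last exact: addr_ge0.
  by apply: randomB; [exact: random_beta_pa|exact: random_cst].
- apply: whpS (whpI hy (op1_of_sqr six hB hr eps0)) => n t [hyt h] i.
  by have := h i; rewrite /bias /center /stat hyt row_mxKl scaled_difference.
Qed.

End PartTwo.

End Assembly.

(* The number of regressors is q.+1. *)
Theorem mainTheorem2 (R : realType) (d : measure_display)
    (T : measurableType d) (P : probability T R)
    (q : nat) (m : nat -> nat) (tau : nat -> R) (alpha : R)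
    (frakp frakP : vseq R -> vseq R -> Prop)
    (S : forall n, T -> 'M[R]_(m n, n))
    (X : forall n, T -> 'M[R]_(n, q.+1))
    (e y : forall n, T -> 'cV[R]_n)
    (U : forall n, T -> 'M[R]_(n, q.+1))
    (l : nat -> T -> 'rV[R]_q.+1)
    (V : nat -> T -> 'M[R]_q.+1)
    (bstar : 'cV[R]_q.+1) (sigma_o : R) :
  m n @[n --> \oo] --> \oo ->
  (\forall n \near \oo, (m n < n)%N) ->
  (forall n, random_mx (X n)) ->
  (forall n, random_mx (e n)) ->
  (forall n t, y n t = X n t *m bstar + e n t) ->
  (forall n, indep_mx P (e n) (X n)) ->
  (forall n, iid_entries P (e n)) ->
  (forall n i, ('E_P[fun t => e n t i 0%R] = 0)%E) ->
  (forall n i, ('V_P[fun t => e n t i 0%R] = (sigma_o ^+ 2)%:E)%E) ->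
  (forall n, random_mx (S n)) ->
  (forall n, indep_mx P (S n) (fun t => row_mx (X n t) (y n t))) ->
  alpha = 0 \/ alpha = 1 ->
  conditionsC P S tau alpha frakp frakP X y U l V ->
  {ae P, forall t, lindeberg_feller P e (fun n => X n t)} ->
  ({ae P, forall t,
      frakp (fun n => normalized_residual (X n t) (y n t))
            (fun n => normalized_residual (X n t) (y n t))} ->
   (m n)%:R / (n%:R * tau n) @[n --> \oo] --> (0 : R) ->
   cvg_std_normal P (fun n t =>
     (Num.sqrt (m n)%:R / Num.sqrt (tau n)
      / enorm (sketch_residual (S n t) (X n t) (y n t)))
     *: (sqrtmx (sketch_gram (S n t) (X n t))
         *m (beta_s (S n t) (X n t) (y n t) - bstar)))) /\
  ({ae P, forall t, forall b b' : nat -> 'cV[R]_q.+1,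
      (forall n, enorm (b n) = 1) -> (forall n, enorm (b' n) = 1) ->
      frakP (fun n => U n t *m b n) (fun n => U n t *m b' n)} ->
   cvg_in_prob0 P (fun n t =>
     (m n)%:R%:E / (tau n * enorm (X n t *m bstar) ^+ 2)%:E)%E ->
   cvg_std_normal P (fun n t =>
     let G := sketch_gram (S n t) (X n t) in
     let b := beta_pa (S n t) (X n t) (y n t) in
     (Num.sqrt (m n)%:R / Num.sqrt (tau n))
     *: (invsqrtmx (enorm (S n t *m X n t *m b) ^+ 2 *: invmx G
                    + (alpha + 1) *: (b *m b^T))
         *m (b - bstar)))).
Proof.
move=> m_oo _ mX me yE eX iid mean0 var mS SD alpha01 [tau0 taum bounded onedim cd] lf.
have {}yE : y = (fun n t => X n t *m bstar + e n t).
  by apply: functional_extensionality_dep => n; apply/funext => t; exact: yE.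
subst y.
have alpha0 : 0 <= alpha by case: alpha01 => ->.
split=> [prr mntau|PUU signal].
  exact: (beta_s_studentized m_oo mX me eX iid mean0 var mS SD alpha0 tau0 taum onedim cd
    bounded lf prr mntau).
exact: (beta_pa_studentized m_oo mX me eX iid mean0 var mS SD alpha0 tau0 taum onedim cd
  PUU signal).
Qed.
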